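(* Let $H$ be an ordered graph on $h$ vertices with interval chromatic number $\chi_{<}(H)=2$. In the following, $n$ ranges over positive integers divisible by $h$, and $o(1)$ denotes a quantity tending to $0$ as $n\to\infty$ (with $H$ fixed). \begin{itemize} \item[(i)] Suppose that $H$ does not have Property A. Then $\delta_{<}(H,n)=(1-\alpha^*(H)+o(1))n$. \item[(ii)] Suppose that $H$ has both Property A and Property B. Then $\delta_{<}(H,n)=\left(1-\frac{1}{\chi_{<}(H)}+o(1)\right)n=(1/2+o(1))n$. \item[(iii)] Suppose that $H$ has Property A but not Property B, and one of the vertices $1,h$ has Property C. Then $\delta_{<}(H,n)=\left(1-\frac{1}{\chi_{<}(H)}+o(1)\right)n=(1/2+o(1))n$. \item[(iv)] Suppose that $H$ has Property A but not Property B, and neither of the vertices $1,h$ has Property C. Then $\delta_{<}(H,n)=(1-\alpha^*(H)+o(1))n$. \end{itemize}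
   Context: An ordered graph $H$ on $h$ vertices is a graph with vertex set $[h]=\{1,\dots,h\}$ (more generally, a finite graph with a linearly ordered vertex set). An ordered graph $G$ on $[n]$ contains a copy of $H$ if there is a map $\phi:[h]\to[n]$ with $\phi(i)<\phi(j)$ whenever $i<j$ and with $\phi(i)\phi(j)\in E(G)$ whenever $ij\in E(H)$. An $H$-tiling in $G$ is a collection of vertex-disjoint copies of $H$ in $G$; it is perfect if it covers all vertices of $G$. $\delta(G)$ denotes the minimum degree. For $n$ divisible by $h$, $\delta_{<}(H,n)$ is the smallest integer $k$ such that every ordered graph $G$ on $n$ vertices with $\delta(G)\ge k$ contains a perfect $H$-tiling. The interval chromatic number $\chi_{<}(H)$ is the minimum number of intervals into which $[h]$ can be partitioned so that no two vertices in the same interval are adjacent in $H$. Let $\alpha_0^+(H):=0$ and for $1\le \ell\le\chi_{<}(H)$ let $\alpha_\ell^+(H)$ be the largest $k\in\mathbb N$ (with $k\le h$) such that $[\alpha_{\ell-1}^+(H)+1,k]$ is an independent set in $H$. Let $\alpha_0^-(H):=h+1$ and for $1\le\ell\le\chi_{<}(H)$ let $\alpha_\ell^-(H)$ be the smallest $k\in\mathbb N$ (with $k \geq 1$) such that $[k,\alpha_{\ell-1}^-(H)-1]$ is an independent set in $H$. Define $$\alpha^*(H):=\min_{1\le \ell<\chi_{<}(H)}\min\left\{\frac{\alpha_\ell^+(H)}{\ell h},\ \frac{h-\alpha_\ell^-(H)+1}{\ell h}\right\}.$$ Property A: $H$ has no edge inside the interval $[1,\lfloor h/2\rfloor+1]$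 and no edge inside the interval $[\lceil h/2\rceil,h]$. Property B: for every partition of $[h]$ into two non-empty intervals $[1,i]$ and $[i+1,h]$, there is an edge of $H$ between these two intervals. Property C: if $h$ is not isolated, let $s(H)$ be the smallest vertex of $H$ adjacent to $h$; if $1$ is not isolated, let $l(H)$ be the largest vertex of $H$ adjacent to $1$. The vertex $h$ has Property C if $h$ is not isolated and there is an edge of $H$ inside the interval $[s(H),h-1]$. The vertex $1$ has Property C if $1$ is not isolated and there is an edge of $H$ inside the interval $[2,l(H)]$. *)

(* Defs.v *)
From mathcomp Require Import all_boot all_order all_algebra.
From mathcomp Require Import boolp classical_sets reals topology normedtype.
From mathcomp Require Import sequences.

Set Implicit Arguments.
Unset Strict Implicit.
Unset Printing Implicit Defensive.

Import Order.TTheory GRing.Theory Num.Theory.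
Import numFieldNormedType.Exports.

(* The vertex set [n] = {1, ..., n} is encoded by 'I_n = {0, ..., n-1}; intervals
   and special vertices are given below by their 1-based labels. *)
Record ograph (n : nat) := OGraph {
  edge :> rel 'I_n;
  edge_sym : symmetric edge;
  edge_irrefl : irreflexive edge
}.

Definition label (n : nat) (i : 'I_n) : nat := i.+1.

Definition label_in (n a b : nat) (i : 'I_n) : bool := a <= label i <= b.

Definition adj (n : nat) (G : ograph n) (a b : nat) : bool :=
  [exists i, exists j, [&& label i == a, label j == b & G i j]].

Definition has_edge_in (n : nat) (G : ograph n) (a b : nat) : bool :=
  [exists i, exists j, [&& label_in a b i, label_in a b j & G i j]].

Definition indep_interval (n : nat) (G : ograph n) (a b : nat) : bool :=
  ~~ has_edge_in G a b.

Definition degree (n : nat) (G : ograph n) (v : 'I_n) : nat :=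
  #|[set w | G v w]|.

(* Degrees are smaller than n, so the default n is irrelevant when 0 < n. *)
Definition min_degree (n : nat) (G : ograph n) : nat :=
  \big[minn/n]_(v < n) degree G v.

Definition is_copy (h n : nat) (H : ograph h) (G : ograph n)
    (phi : {ffun 'I_h -> 'I_n}) : Prop :=
  (forall i j : 'I_h, i < j -> phi i < phi j) /\
  (forall i j : 'I_h, H i j -> G (phi i) (phi j)).

Definition is_tiling (h n : nat) (H : ograph h) (G : ograph n)
    (T : {set {ffun 'I_h -> 'I_n}}) : Prop :=
  (forall phi, phi \in T -> is_copy H G phi) /\
  (forall phi psi, phi \in T -> psi \in T -> phi != psi ->
     [disjoint codom phi & codom psi]).

Definition is_perfect_tiling (h n : nat) (H : ograph h) (G : ograph n)
    (T : {set {ffun 'I_h -> 'I_n}}) : Prop :=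
  is_tiling H G T /\ (forall v : 'I_n, exists2 phi, phi \in T & v \in codom phi).

Definition forces_tiling (h : nat) (H : ograph h) (n k : nat) : Prop :=
  forall G : ograph n, k <= min_degree G -> exists T, is_perfect_tiling H G T.

(* For 0 < n, forces_tiling H n n holds vacuously, so the minimum over k <= n is
   attained and is the minimum over all natural numbers. Negative k behave like
   k = 0, which never forces a tiling when H has an edge and 0 < n. *)
Definition delta_lt (h : nat) (H : ograph h) (n : nat) : nat :=
  \big[minn/n]_(k < n.+1 | `[< forces_tiling H n k >]) (k : nat).

Definition is_interval (n : nat) (A : {set 'I_n}) : bool :=
  [forall i in A, forall k in A, forall j : 'I_n, (i <= j <= k) ==> (j \in A)].

Definition indep_set (n : nat) (G : ograph n) (A : {set 'I_n}) : bool :=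
  [forall i in A, forall j in A, ~~ G i j].

Definition interval_coloring (n : nat) (G : ograph n)
    (P : {set {set 'I_n}}) : bool :=
  finset.partition P [set: 'I_n] && [forall A in P, is_interval A && indep_set G A].

(* The partition into singletons is always admissible and has n blocks, so the
   default n does not change the minimum. *)
Definition chi_lt (n : nat) (G : ograph n) : nat :=
  \big[minn/n]_(P | interval_coloring G P) #|P|.

Fixpoint alpha_plus (h : nat) (H : ograph h) (l : nat) : nat :=
  if l is l'.+1 then
    \max_(0 <= k < h.+1 | indep_interval H (alpha_plus H l').+1 k) k
  else 0.

(* The default h.+1 is never below the minimum: k = alpha_minus H l' is itself
   admissible, its interval being empty. *)
Fixpoint alpha_minus (h : nat) (H : ograph h) (l : nat) : nat :=
  if l is l'.+1 then
    \big[minn/h.+1]_(1 <= k < h.+2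
                    | indep_interval H k (alpha_minus H l').-1) k
  else h.+1.

(* All the terms are at most 1, so the default 1 matters only for an empty
   range, that is for chi_lt H <= 1. *)
Definition alpha_star (R : realType) (h : nat) (H : ograph h) : R :=
  (\big[Num.min/1]_(1 <= l < chi_lt H)
     Num.min ((alpha_plus H l)%:R / (l%:R * h%:R))
             ((h%:R - (alpha_minus H l)%:R + 1) / (l%:R * h%:R)))%R.

Definition propertyA (h : nat) (H : ograph h) : Prop :=
  ~~ has_edge_in H 1 (h./2).+1 /\ ~~ has_edge_in H (uphalf h) h.

Definition propertyB (h : nat) (H : ograph h) : Prop :=
  forall i : nat, 1 <= i < h ->
    exists x y : 'I_h, [/\ label_in 1 i x, label_in i.+1 h y & H x y].

Definition isolated (h : nat) (H : ograph h) (a : nat) : Prop :=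
  forall b : nat, ~~ adj H a b.

(* Meaningful only when the vertex h is not isolated. *)
Definition s_vertex (h : nat) (H : ograph h) : nat :=
  \big[minn/h]_(1 <= x < h.+1 | adj H h x) x.

(* Meaningful only when the vertex 1 is not isolated. *)
Definition l_vertex (h : nat) (H : ograph h) : nat :=
  \max_(1 <= x < h.+1 | adj H 1 x) x.

Definition propertyC_last (h : nat) (H : ograph h) : Prop :=
  ~ isolated H h /\ has_edge_in H (s_vertex H) h.-1.

Definition propertyC_first (h : nat) (H : ograph h) : Prop :=
  ~ isolated H 1 /\ has_edge_in H 2 (l_vertex H).

Local Open Scope classical_set_scope.
Local Open Scope ring_scope.

(* delta_lt H n = (c + o(1)) n, for n ranging over the positive multiples of h *)
Definition delta_lt_asymp (R : realType) (h : nat) (H : ograph h) (c : R) : Prop :=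
  exists o : nat -> R, o @ \oo --> (0 : R) /\
    forall n : nat, (0 < n)%N -> (h %| n)%N ->
      (delta_lt H n)%:R = (c + o n) * n%:R.

(* Main.v *)
Require Import Defs.
From mathcomp Require Import all_boot all_order all_algebra reals.
From mathcomp Require Import boolp topology normedtype sequences.
From mathcomp Require Import zify ring lra.

(** Write [a] for the length of the longest initial independent interval of [H],
    [h - b] for that of the longest final one and [m] for the smaller of the two,
    so that [alpha_star H = m / h]. Since [chi_lt H = 2], a complete bipartite
    graph between a set of [p] vertices and a later set of [h - p] vertices
    contains [H] whenever [b <= p <= a].

    Lower bounds. An initial (or final) independent interval of more than [m n / h]
    vertices rules out a perfect tiling; so do two disjoint cliques on intervals
    when Property B holds, and a last (or first) vertex joined exactly to an
    independent half when Property C holds.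

    Almost perfect tilings. If a maximum tiling leaves a set [L] of linear size
    uncovered, then [L] is sparse, so a vertex of [L] has more than [h - m]
    neighbours in a positive proportion of the tiles. By Kovari-Sos-Turan many
    vertices of [L] and many tiles form a complete pattern, and [h - m] tiles can
    be exchanged for [h - m + 1] new ones. No regularity lemma is needed.

    Absorption. Two vertices are exchangeable when a positive proportion of the
    lists [S] of some fixed length can be completed to a tileable set by either
    of them. If every two vertices are exchangeable then a small tileable set
    absorbs every much smaller leftover; it is found by a greedy choice driven by
    an exponential potential, which replaces the usual random selection.

    Exchangeability when degrees exceed [n / 2]: it suffices to treat adjacent
    vertices, as any two vertices have linearly many common neighbours. Two
    vertices with many common neighbours to their right are exchangeable, unless
    those neighbours themselves have few neighbours to the left; such exceptional
    edges are treated by induction on the position of their right end, and the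
    case where the common neighbours lie in between by induction on the length.

    Exchangeability in case (iv): one of the vertices [1], [h], say [1], is
    isolated. Then a vertex close to the beginning of [G] can play the role of
    [1] for any biclique to its right, and every vertex of [G] is completed to
    copies of [H] by linearly dense bicliques, whatever the position of its
    neighbours; this is where the failure of Property C is used. *)

Set Implicit Arguments.
Unset Strict Implicit.
Unset Printing Implicit Defensive.

Lemma exists_subset_card (T : finType) (A : {set T}) t :
  t <= #|A| -> exists2 B : {set T}, B \subset A & #|B| = t.
Proof.
move=> tA; exists [set x in take t (enum A)].
  by apply/subsetP => x; rewrite inE => /mem_take; rewrite mem_enum.
rewrite cardsE (card_uniqP _) ?take_uniq ?enum_uniq // size_take -cardE.
by case: ltnP => // At; apply/eqP; rewrite eqn_leq At tA.
Qed.

Lemma card_ord_lt n k : k <= n -> #|[pred v : 'I_n | v < k]| = k.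
Proof.
by move=> kn; rewrite -sum1_card -(big_ord_widen n (fun=> 1) kn) sum1_card card_ord.
Qed.

(** * Sums over lists of vertices *)

Section ListSums.
Variable V : finType.
Implicit Types (F G : seq V -> nat).

(** A sum over the k-th power of [V]. On booleans it counts lists, so inequalities
    [#|V| ^ k <= C * sumk k P] play the part of probability bounds. *)
Fixpoint sumk (k : nat) F : nat :=
  if k is k'.+1 then \sum_v sumk k' (fun s => F (v :: s)) else F [::].

Lemma leq_sumk k F G :
  (forall s, size s = k -> F s <= G s) -> sumk k F <= sumk k G.
Proof.
elim: k F G => [|k IHk] F G FG /=; first exact: FG.
by apply: leq_sum => v _; apply: IHk => s sk; apply: FG; rewrite /= sk.
Qed.

Lemma eq_sumk k F G :
  (forall s, size s = k -> F s = G s) -> sumk k F = sumk k G.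
Proof.
by move=> FG; apply/eqP; rewrite eqn_leq !leq_sumk // => s /FG ->.
Qed.

Lemma sumkD k F G : sumk k (fun s => F s + G s) = sumk k F + sumk k G.
Proof.
elim: k F G => //= k IHk F G.
by rewrite -big_split; apply: eq_bigr => v _; rewrite IHk.
Qed.

Lemma sumkM k c F : sumk k (fun s => c * F s) = c * sumk k F.
Proof.
elim: k F => //= k IHk F.
by rewrite big_distrr; apply: eq_bigr => v _; rewrite IHk.
Qed.

Lemma sumk_const k c : sumk k (fun=> c) = c * #|V| ^ k.
Proof.
elim: k => [|k IHk] /=; first by rewrite muln1.
by rewrite IHk sum_nat_const expnS mulnCA.
Qed.

Lemma sumk_cat k l F :
  sumk (k + l) F = sumk k (fun s => sumk l (fun t => F (s ++ t))).
Proof. by elim: k F => //= k IHk F; apply: eq_bigr => v _; rewrite IHk. Qed.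

Lemma sumk_sum (I : finType) (P : pred I) k (F : I -> seq V -> nat) :
  \sum_(i | P i) sumk k (F i) = sumk k (fun s => \sum_(i | P i) F i s).
Proof.
elim: k F => //= k IHk F; rewrite exchange_big.
by apply: eq_bigr => v _; rewrite IHk.
Qed.

Lemma sumk_all k (p : pred V) : sumk k (fun s => all p s) = #|p| ^ k.
Proof.
elim: k => //= k IHk.
transitivity (\sum_(v in p) #|p| ^ k); last by rewrite sum_nat_const expnS.
rewrite [RHS]big_mkcond; apply: eq_bigr => v _ /=.
rewrite unfold_in; case: (p v) => /=; first exact: IHk.
by rewrite sumk_const mul0n.
Qed.

(** Averaging one entry at a time: each entry is chosen to maximise the remaining sum. *)
Lemma sumk_max k F : 0 < #|V| ->
  exists2 s, size s = k & sumk k F <= #|V| ^ k * F s.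
Proof.
move=> V0; elim: k F => [|k IHk] F; first by exists [::]; rewrite ?mul1n.
have [v0 _] := card_gt0P V0.
have [v _ vmax] :=
  @arg_maxnP V v0 xpredT (fun v => sumk k (fun s => F (v :: s))) isT.
have [s sk le_s] := IHk (fun s => F (v :: s)).
exists (v :: s) => /=; first by rewrite sk.
apply: (@leq_trans (\sum_(u : V) sumk k (fun s => F (v :: s)))).
  by apply: leq_sum => u _; exact: vmax.
by rewrite sum_nat_const expnS -mulnA leq_mul2l le_s orbT.
Qed.

(** Union bound: each of the k entries meets at most [size b + k] forbidden values. Lists with
    repetitions are thus a fraction O(1/n) of all lists and can be discarded. *)
Lemma sumk_nonuniq k (b : seq V) : uniq b ->
  #|V| * sumk k (fun s => ~~ uniq (b ++ s)) <= k * (size b + k) * #|V| ^ k.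
Proof.
elim: k b => [|k IHk] b ub /=; first by rewrite cats0 ub muln0.
set n := #|V|.
have step v : n * sumk k (fun s => ~~ uniq (b ++ v :: s)) <=
   (v \in b) * (n * n ^ k) + k * ((size b).+1 + k) * n ^ k.
  case: (boolP (v \in b)) => vb.
    apply: (leq_trans _ (leq_addr _ _)); rewrite mul1n leq_mul2l.
    apply/orP; right; rewrite -[n ^ k]mul1n -sumk_const.
    by apply: leq_sumk => s _; case: uniq.
  rewrite mul0n add0n -(size_rcons b v).
  apply: leq_trans (IHk (rcons b v) _); last by rewrite rcons_uniq vb.
  by rewrite leq_mul2l; apply/orP; right; apply: leq_sumk => s _;
     rewrite cat_rcons.
rewrite big_distrr /=.
apply: (@leq_trans (\sum_v ((v \in b) * (n * n ^ k)
                             + k * ((size b).+1 + k) * n ^ k))).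
  by apply: leq_sum => v _; exact: step.
rewrite big_split /= sum_nat_const -big_distrl /=.
have -> : \sum_v (v \in b) = size b.
  rewrite -(card_uniqP ub) -sum1_card [RHS]big_mkcond.
  by apply: eq_bigr => v _; case: (v \in b).
rewrite -/n expnS; set p := n ^ k; nia.
Qed.

End ListSums.

(** * Dense bicliques *)

Section Supersaturation.
Variable V : finType.
Hypothesis V_gt0 : 0 < #|V|.

(* Markov: a positive proportion of the [s] have [#|F s|] at least half of the
   average. *)
Lemma sumk_pow C i j (F : seq V -> pred V) :
  #|V| ^ i.+1 <= C * sumk i (fun s => #|F s|) ->
  #|V| ^ (i + j) <= (2 * C) ^ j.+1 * sumk i (fun s => #|F s| ^ j).
Proof.
set n := #|V| => dense.
set g := fun s => n <= 2 * C * #|F s|.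
have many : n ^ i <= 2 * C * sumk i (fun s => g s).
  have : 2 * C * sumk i (fun s => #|F s|) <=
         2 * C * n * sumk i (fun s => g s) + n * n ^ i.
    rewrite -sumkM -sumkM -sumk_const -sumkD; apply: leq_sumk => s _.
    have : #|F s| <= n by apply: max_card.
    by rewrite /g; case: leqP => /=; nia.
  move: dense; rewrite expnS; move: (sumk _ _) (sumk _ _) (n ^ i) => x y z.
  move: V_gt0; rewrite -/n => n0 d1 d2.
  by rewrite -(leq_pmul2l n0); nia.
have pw : n ^ j * sumk i (fun s => g s) <=
          (2 * C) ^ j * sumk i (fun s => #|F s| ^ j).
  rewrite -!sumkM; apply: leq_sumk => s _; rewrite /g.
  case: (leqP n) => [le_n|_] /=; last by rewrite muln0.
  by rewrite muln1 -expnMn; case: (j) => // j'; rewrite leq_exp2r.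
rewrite expnD (leq_trans (leq_mul many (leqnn _))) //.
by rewrite expnS -!mulnA !leq_mul2l [_ * n ^ j]mulnC pw !orbT.
Qed.

(** Once n is at least 2CK, the bad lists are at most half as many as those satisfying [P], so
    discarding them costs a factor 2. *)
Lemma sumk_most k C K (P bad Q : seq V -> bool) :
  #|V| ^ k <= C * sumk k (fun s => P s) ->
  #|V| * sumk k (fun s => bad s) <= K * #|V| ^ k -> 2 * C * K <= #|V| ->
  (forall s, size s = k -> P s -> ~~ bad s -> Q s) ->
  #|V| ^ k <= 2 * C * sumk k (fun s => Q s).
Proof.
set n := #|V|; move: V_gt0; rewrite -/n => n0 dense badK CK PQ.
have : sumk k (fun s => P s) <= sumk k (fun s => Q s) + sumk k (fun s => bad s).
  rewrite -sumkD; apply: leq_sumk => s sk; case: (boolP (P s)) => // Ps.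
  by case: (boolP (bad s)) => [_|/(PQ s sk Ps) -> //]; exact: leq_addl.
move: dense badK; move: (sumk k _) (sumk k _) (sumk k _) => q b p.
move: (n ^ k) => N dense badK le1.
have d1 := leq_mul (leqnn n) dense.
have d2 := leq_mul (leqnn (C * n)) le1.
have d3 := leq_mul (leqnn C) badK.
have d4 : 2 * C * K * N <= n * N by rewrite leq_mul2r CK orbT.
by rewrite -(leq_pmul2l n0); lia.
Qed.

(** The nested powers come from two uses of [sumk_pow]: first for i + 1 left neighbours of one
    vertex, then for j common right neighbours of these. *)
Definition biclique_const C i j := (2 * (2 * C) ^ i.+2) ^ j.+1.

(* One extra vertex on the left makes the conclusion [all W t] available even
   for [i = 0]. *)
Lemma biclique_count C i j (r : V -> V -> bool) (W : pred V) :
  (forall u v, r u v -> W v) ->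
  #|V| ^ 2 <= C * \sum_v #|[pred u | r u v]| ->
  #|V| ^ (i + j) <= biclique_const C i j *
    sumk i (fun s => sumk j (fun t => allrel r s t && all W t)).
Proof.
move=> rW dense; set n := #|V|.
have step1 : n ^ i.+2 <= (2 * C) ^ i.+2 *
    sumk i.+1 (fun s => #|[pred v | all (r ^~ v) s]|).
  have le1 : n ^ (1 + i.+1) <= (2 * C) ^ i.+2 * \sum_v #|[pred u | r u v]| ^ i.+1.
    have := @sumk_pow C 1 i.+1 (fun s => [pred u | all (r u) s]).
    have E v : #|[pred u | all (r u) [:: v]]| = #|[pred u | r u v]|.
      by apply: eq_card => u; rewrite !inE /= andbT.
    rewrite [sumk 1 _]/= [sumk 1 _]/= (eq_bigr _ (fun v _ => E v)).
    by rewrite (eq_bigr _ (fun v _ => congr1 (expn^~ _) (E v))); apply.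
  apply: (leq_trans le1); rewrite leq_mul2l; apply/orP; right.
  under eq_bigr => v _ do rewrite -sumk_all.
  rewrite sumk_sum; apply: leq_sumk => s _.
  rewrite -sum1_card [X in _ <= X]big_mkcond; apply: leq_sum => v _.
  have -> : all [pred u | r u v] s = all (r^~ v) s by exact: eq_all.
  by rewrite unfold_in; case: all.
have := sumk_pow j step1.
rewrite -/(biclique_const C i j) addSn expnS => le1.
rewrite -(leq_pmul2l V_gt0) -/n; apply: (leq_trans le1).
rewrite mulnCA leq_mul2l; apply/orP; right; rewrite /=.
(* The extra left vertex [u] is summed out against a factor n; its adjacency to all of [t] gives
   [all W t]. *)
rewrite -[n]sum1_card big_distrl /=; apply: leq_sum => u _; rewrite mul1n.
apply: leq_sumk => s _; rewrite -sumk_all; apply: leq_sumk => t _.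
case: (boolP (all _ t)) => // /allP al; rewrite lt0b; apply/andP; split.
  by apply/allrelP => x y xs /al /= /andP[_ /allP]; apply.
by apply/allP => y /al /= /andP[/rW].
Qed.

End Supersaturation.

Lemma card_pair_sum (T1 T2 : finType) (A : {set T1}) (r : T1 -> T2 -> bool)
    (P : pred T2) :
  \sum_(y | P y) #|[set x in A | r x y]| = \sum_(x in A) \sum_(y | P y) r x y.
Proof.
rewrite exchange_big; apply: eq_bigr => y _.
rewrite -sum1_card big_mkcond [RHS]big_mkcond; apply: eq_bigr => x _.
by rewrite inE; case: (x \in A); case: (r x y).
Qed.

(* Kovari-Sos-Turan: pigeonhole over the subsets of a bounded set of vertices
   of large degree. *)
Lemma kovari_sos_turan C t : 0 < C -> exists N0, forall (T1 T2 : finType) (A :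
  {set T1}) (B : {set T2})
    (r : T1 -> T2 -> bool),
  N0 <= #|A| -> N0 <= #|B| ->
  #|A| * #|B| <= C * \sum_(x in A) \sum_(y in B) r x y ->
  exists X : {set T1}, exists Y : {set T2},
   [/\ X \subset A, Y \subset B, #|X| = t, #|Y| = t &
     forall x y, x \in X -> y \in Y -> r x y].
Proof.
(* Among M vertices of [A], each of at least half the average degree, a vertex of [B] has on average
   at least 2t neighbours. *)
move=> C0; set M := 4 * C * t.
exists (2 * C * M + 4 * C * t * 2 ^ M + 1) => T1 T2 A B r leA leB dense.
pose d x := \sum_(y in B) r x y.
have dB x : d x <= #|B| by rewrite -sum1_card; apply: leq_sum => y _; case: (r x y).
have B0 : 0 < #|B| by lia.
set A' := [set x in A | #|B| <= 2 * C * d x].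
have A'card : #|A| <= 2 * C * #|A'|.
  have : 2 * C * \sum_(x in A) d x <= 2 * C * (#|A'| * #|B|) + #|A| * #|B|.
    rewrite -[#|A'|]sum1_card -[#|A|]sum1_card !big_distrl !big_distrr /=.
    rewrite [X in _ <= X + _]big_mkcond [X in _ <= _ + X]big_mkcond /=.
    rewrite [X in X <= _]big_mkcond -big_split /=; apply: leq_sum => x _.
    rewrite inE; case: (x \in A) => //=; have := dB x.
    case: (leqP #|B|) => [_|/ltnW] dxB; rewrite !mul1n ?add0n //.
    by apply: (leq_trans _ (leq_addr _ _)); rewrite leq_mul2l dxB orbT.
  move: dense; rewrite -/(d _); move: (\sum_(x in A) d x) => z.
  by move=> d1 d2; rewrite -(leq_pmul2r B0); nia.
have [|A0 A0A A0M] := @exists_subset_card _ A' M; first by nia.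
have A0d : 2 * t * #|B| <= \sum_(y in B) #|[set x in A0 | r x y]|.
  rewrite card_pair_sum -(leq_pmul2l (_ : 0 < 2 * C)) ?muln_gt0 //.
  apply: (@leq_trans (\sum_(x in A0) #|B|)).
    by rewrite sum_nat_const A0M /M; nia.
  rewrite big_distrr; apply: leq_sum => x /(subsetP A0A).
  by rewrite inE => /andP[].
(* These are at least a fraction 1/(4C) of [B]; they are then classified by their neighbourhood in
   [A0], one of 2^M sets. *)
set B' := [set y in B | t <= #|[set x in A0 | r x y]|].
have B'card : #|B| * t <= M * #|B'|.
  have : \sum_(y in B) #|[set x in A0 | r x y]| <= M * #|B'| + t * #|B|.
    rewrite -[#|B'|]sum1_card -[#|B|]sum1_card !big_distrr /=.
    rewrite [X in _ <= X + _]big_mkcond [X in _ <= _ + X]big_mkcond /=.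
    rewrite [X in X <= _]big_mkcond -big_split /=; apply: leq_sum => y _.
    rewrite inE; case: (y \in B) => //=.
    have : #|[set x in A0 | r x y]| <= M.
      rewrite -A0M; apply: subset_leq_card; apply/subsetP => x.
      by rewrite inE => /andP[].
    case: (leqP t) => [_|/ltnW] /= le1; rewrite ?muln0 ?muln1 ?add0n /=.
      exact: leq_trans le1 (leq_addr _ _).
    by [].
  by move: A0d; nia.
case: (posnP t) => [t0|tp].
  by exists set0, set0; rewrite !sub0set !cards0 t0; split=> // x y; rewrite inE.
have B'big : t * 2 ^ M <= #|B'|.
  rewrite -(leq_pmul2l (_ : 0 < 4 * C * t)) ?muln_gt0 ?C0 //=.
  apply: leq_trans B'card; rewrite mulnCA mulnC leq_mul2r.
  by apply/orP; right; lia.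
have [S SA0 Sbig] : exists2 S : {set T1}, S \in powerset A0 &
    t <= #|[set y in B' | [set x in A0 | r x y] == S]|.
  apply/exists_inP; apply: contraLR B'big; rewrite negb_exists_in -ltnNge.
  move=> /forall_inP small.
  have -> : #|B'| = \sum_(S in powerset A0)
      #|[set y in B' | [set x in A0 | r x y] == S]|.
    rewrite card_pair_sum -sum1_card; apply: eq_bigr => y _.
    rewrite (bigD1 [set x in A0 | r x y]) /=; last first.
      by rewrite inE; apply/subsetP => x; rewrite inE => /andP[].
    rewrite eqxx big1 // => S /andP[_ /negPf].
    by rewrite eq_sym => ->.
  apply: (@leq_ltn_trans (\sum_(S in powerset A0) t.-1)).
    by apply: leq_sum => S /small; lia.
  rewrite sum_nat_const card_powerset A0M mulnC ltn_pmul2r ?expn_gt0 //.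
  by rewrite prednK.
have [y1 y1P] : exists y, y \in [set y in B' | [set x in A0 | r x y] == S].
  by apply/card_gt0P; apply: leq_trans Sbig.
have St : t <= #|S|.
  by move: y1P; rewrite !inE => /andP[/andP[_ tS] /eqP <-].
have [X XS Xt] := exists_subset_card St.
have [Y YS Yt] := exists_subset_card Sbig.
exists X, Y; split => //.
- apply: (subset_trans XS); move: SA0; rewrite inE => /subset_trans; apply.
  by apply: (subset_trans A0A); apply/subsetP => x; rewrite inE => /andP[].
- by apply/subsetP => y /(subsetP YS); rewrite !inE => /andP[/andP[]].
move=> x y /(subsetP XS) xS /(subsetP YS).
by rewrite inE => /andP[_ /eqP SE]; move: xS; rewrite -SE inE => /andP[].
Qed.

(** * Tilings and exchangeable vertices *)

(* An ordered graph with the family of the vertex sets of the copies of [H].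
   Positions are kept abstract so that the order can be reversed while the
   tiles, and all notions defined from them, stay the same. *)
Record tsystem (h : nat) := TSystem {
  vert :> finType;
  pos : vert -> nat;
  sadj : rel vert;
  tile : pred {set vert};
  pos_inj : injective pos;
  pos_lt : forall v, pos v < #|vert|;
  sadj_sym : symmetric sadj;
  sadj_irr : irreflexive sadj;
  tile_card : forall A, tile A -> #|A| = h }.

Section Tileable.
Variables (h : nat) (X : tsystem h).
Implicit Types (A B P Y : {set X}) (x y z : X) (s t : seq X).

Definition before x y := pos x < pos y.
Definition adj_before x y := before x y && sadj x y.

Definition tileable A : Prop :=
  exists F : {set {set X}},
    [/\ trivIset F, cover F = A & forall B, B \in F -> tile B].

Lemma tileable0 : tileable set0.
Proof.
exists set0; split; last by move=> B; rewrite inE.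
  by apply/trivIsetP => B C; rewrite inE.
by rewrite /cover big_set0.
Qed.

Lemma tile_tileable A : tile A -> tileable A.
Proof.
move=> tA; exists [set A]; split; last by move=> B; rewrite inE => /eqP ->.
  by apply/trivIsetP => B C; rewrite !inE => /eqP -> /eqP ->; rewrite eqxx.
by rewrite /cover big_set1.
Qed.

Lemma tileableU A B : [disjoint A & B] ->
  tileable A -> tileable B -> tileable (A :|: B).
Proof.
move=> dAB [F [tF FA FT]] [G [tG GB GT]]; rewrite -FA -GB in dAB *.
exists (F :|: G); split.
- have cross C D : C \in F -> D \in G -> [disjoint C & D].
    move=> CF DG; by apply: disjointW dAB;
      [apply: (bigcup_sup C) | apply: (bigcup_sup D)].
  apply/trivIsetP => C D; rewrite !inE => /orP[] CF /orP[] DF CD.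
  + exact: (trivIsetP tF).
  + exact: cross.
  + by rewrite disjoint_sym; apply: cross.
  + exact: (trivIsetP tG).
- by rewrite /cover bigcup_setU.
- by move=> C; rewrite inE => /orP[/FT|/GT].
Qed.

Lemma tileable_card A : tileable A -> h %| #|A|.
Proof.
move=> [F [tF <- FT]]; rewrite -(eqP tF); apply: dvdn_sum => B /FT /tile_card.
by move=> ->.
Qed.

Definition biclique P Y :=
  forall u v, u \in P -> v \in Y -> adj_before u v.

Lemma biclique_disjoint P Y : biclique P Y -> [disjoint P & Y].
Proof.
move=> PY; rewrite -setI_eq0; apply/eqP/setP => z; rewrite !inE.
by apply/negP => /andP[zP zY]; have /andP[] := PY _ _ zP zY; rewrite /before ltnn.
Qed.

(** For copies of [H] this holds as soon as [1, p] and [p + 1, h] are independent in [H]. *)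
Definition splits p := forall P Y,
  #|P| = p -> #|Y| = h - p -> biclique P Y -> tile (P :|: Y).

(** Left parts of sizes between q and a, one for each of k tiles, realise every total between kq and
    ka. One tile is removed at a time. *)
Lemma splits_tileable q a k P Y :
  (forall p, q <= p <= a -> splits p) -> q <= a <= h ->
  k * q <= #|P| <= k * a -> #|P| + #|Y| = k * h -> biclique P Y ->
  tileable (P :|: Y).
Proof.
move=> bq /andP[qa ah]; elim: k P Y => [|k IHk] P Y Pk PYk PY.
  suff [-> ->] : P = set0 /\ Y = set0 by rewrite setU0; exact: tileable0.
  by split; apply/eqP; rewrite -cards_eq0; lia.
(* The smallest left part that leaves at most [k * a] vertices of [P] to the k remaining tiles. *)
set p := maxn q (#|P| - k * a).
have kqa : k * q <= k * a by rewrite leq_mul2l qa orbT.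
have kah : k * a <= k * h by rewrite leq_mul2l ah orbT.
have pP : p <= #|P| by rewrite /p; move: Pk; rewrite !mulSn; lia.
have pY : h - p <= #|Y| by rewrite /p; move: Pk PYk; rewrite !mulSn; lia.
have [P1 P1P P1c] := exists_subset_card pP.
have [Y1 Y1Y Y1c] := exists_subset_card pY.
have cP := cardsD P P1; have cY := cardsD Y Y1.
rewrite (setIidPr P1P) in cP; rewrite (setIidPr Y1Y) in cY.
have ph : p <= h by rewrite /p; move: Pk; rewrite !mulSn; lia.
have -> : P :|: Y = (P1 :|: Y1) :|: ((P :\: P1) :|: (Y :\: Y1)).
  apply/setP => z; rewrite !inE.
  have := subsetP P1P z; have := subsetP Y1Y z.
  by case: (z \in P1); case: (z \in Y1); case: (z \in P); case: (z \in Y) => //=;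
    (try by move=> _ /(_ isT)); move=> /(_ isT).
have dPY := biclique_disjoint PY.
apply: tileableU.
- rewrite -setI_eq0; apply/eqP/setP => z; rewrite !inE.
  have : ~~ ((z \in P) && (z \in Y)).
    by apply/negP => /andP[zP zY]; move: (disjointFr dPY zP); rewrite zY.
  have := subsetP P1P z; have := subsetP Y1Y z.
  by case: (z \in P1); case: (z \in Y1); case: (z \in P); case: (z \in Y) => //=;
    (try by move=> _ /(_ isT)); move=> /(_ isT).
- apply: tile_tileable; apply: (bq p) => //.
    by rewrite /p; move: Pk; rewrite !mulSn; lia.
  by move=> u v /(subsetP P1P) uP /(subsetP Y1Y) vY; exact: PY.
- apply: IHk.
  + by rewrite /p in P1c; rewrite cP P1c; move: Pk; rewrite !mulSn; lia.
  + by rewrite cP cY P1c Y1c; move: PYk; rewrite mulSn; lia.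
  + by move=> u v; rewrite !inE => /andP[_ uP] /andP[_ vY]; exact: PY.
Qed.

Definition swap x y s : bool :=
  [&& uniq (x :: s), uniq (y :: s),
      `[< tileable [set z in x :: s] >] & `[< tileable [set z in y :: s] >]].

(** Exchangeability with density 1/C. The guard makes the same constant serve as a threshold on the
    size of [X]. *)
Definition reach k C x y :=
  C <= #|X| -> #|X| ^ k <= C * sumk k (fun s => swap x y s).

Lemma reach_sym k C x y : reach k C x y -> reach k C y x.
Proof.
move=> R /R; rewrite (@eq_sumk _ _ _ (fun s => swap y x s)) // => s _.
by rewrite /swap; case: (uniq (x :: s)); case: (uniq (y :: s)) => //; case: asbool;
  case: asbool.
Qed.

Lemma reach_mono k C C' x y : C <= C' -> reach k C x y -> reach k C' x y.
Proof.
move=> CC' R /(leq_trans CC') /R /leq_trans; apply.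
by rewrite leq_mul2r CC' orbT.
Qed.

Lemma vert_gt0 x : 0 < #|X|.
Proof. by apply/card_gt0P; exists x. Qed.

(** By [sumk_nonuniq] a dense family of candidate lists stays dense after removal of those that
    repeat a vertex or contain x or y. The second term of the constant bounds the size of [X] needed
    for this. *)
Lemma reach_dense k C0 x y (P : seq X -> bool) :
  (forall s, size s = k -> uniq (x :: s) -> uniq (y :: s) -> P s ->
     tileable [set z in x :: s] /\ tileable [set z in y :: s]) ->
  #|X| ^ k <= C0 * sumk k (fun s => P s) ->
  reach k (2 * C0 + 4 * C0 * (k * k.+1)) x y.
Proof.
move=> Ptile dense big; have n0 := vert_gt0 x.
have bad : #|X| * sumk k (fun s => ~~ uniq (x :: s) || ~~ uniq (y :: s)) <=
    2 * (k * k.+1) * #|X| ^ k.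
  have := leq_add (@sumk_nonuniq X k [:: x] isT) (@sumk_nonuniq X k [:: y] isT).
  rewrite -mulnDr -sumkD addnn -mul2n mulnA => le1; apply: leq_trans le1.
  rewrite leq_mul2l; apply/orP; right; apply: leq_sumk => s _.
  by case: (~~ uniq (x :: s)) => //; exact: leq_addr.
apply: leq_trans (sumk_most n0 dense bad _ (Q := fun s => swap x y s) _) _.
- by apply: leq_trans big; apply: leq_trans (leq_addl _ _); lia.
- move=> s sk Ps; rewrite negb_or !negbK => /andP[ux uy].
  have [/asboolP tx /asboolP ty] := Ptile s sk ux uy Ps.
  by rewrite /swap ux uy tx ty.
- by rewrite leq_mul2r leq_addr orbT.
Qed.

End Tileable.

(** * Composition and lengthening of exchanges, and dense families of tiles *)

Section Chains.
Variable h : nat.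

Lemma tileable_cat (X : tsystem h) (s t : seq X) : uniq (s ++ t) ->
  tileable [set z in s] -> tileable [set z in t] -> tileable [set z in s ++ t].
Proof.
rewrite cat_uniq => /and3P[_ /hasPn st _] ts tt.
have -> : [set z in s ++ t] = [set z in s] :|: [set z in t].
  by apply/setP => z; rewrite !inE mem_cat.
apply: tileableU => //; rewrite -setI_eq0; apply/eqP/setP => z; rewrite !inE.
by apply/negP => /andP[zs /st]; rewrite /= zs.
Qed.

Lemma tileable_perm (X : tsystem h) (s t : seq X) : perm_eq s t ->
  tileable [set z in s] -> tileable [set z in t].
Proof.
move=> /perm_mem st; have -> // : [set z in s] = [set z in t].
by apply/setP => z; rewrite !inE st.
Qed.

(** If s exchanges x with z and t exchanges z with y, then the list s, z, t exchanges x with y: it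
    is used as xs and zt, or as zs and yt. Linearly many choices of z keep the family dense. *)
Lemma reach_chain k l C D : exists C', forall (X : tsystem h) (x y : X) (Z : {set X}),
  (forall z, z \in Z -> reach k C x z) -> (forall z, z \in Z -> reach l C z y) ->
  #|X| <= D * #|Z| -> reach (k + l.+1) C' x y.
Proof.
set C0 := D * C * C; set m := k + l.+1.
exists (C + (2 * C0 + 4 * C0 * (m * m.+1))) => X x y Z xZ Zy Zbig.
have [Cn|nC] := leqP C #|X|; last first.
  by move=> /(leq_trans (leq_addr _ _)); rewrite leqNgt nC.
apply: reach_mono (leq_addl _ _) _.
pose P s := [exists z, [&& swap x z (take k s), swap z y (drop k.+1 s)
   & drop k s == z :: drop k.+1 s]].
apply: (@reach_dense _ _ _ _ _ _ P).
  move=> s sm ux uy /existsP[z /and3P[swx swy /eqP Es]].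
  have {Es} Es : s = take k s ++ z :: drop k.+1 s by rewrite -Es cat_take_drop.
  move: (take k s) (drop k.+1 s) swx swy Es => s1 s2.
  case/and4P=> _ _ /asboolP tx1 /asboolP tz1 /and4P[_ _ /asboolP tz2 /asboolP ty2] Es.
  rewrite Es in ux uy *; split; first exact: (@tileable_cat _ (x :: s1)).
  have yP : perm_eq ((z :: s1) ++ (y :: s2)) (y :: s1 ++ z :: s2).
    by rewrite -[y :: s2]cat1s -[y :: s1 ++ _]cat1s -[z :: s1]cat1s
      -[z :: s2]cat1s; apply/permP => a; rewrite !count_cat; lia.
  apply: (tileable_perm yP); apply: tileable_cat => //.
  by rewrite (perm_uniq yP).
apply: (@leq_trans (C0 * \sum_(z in Z) sumk k (fun s => swap x z s) *
                        sumk l (fun t => swap z y t))).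
  rewrite expnD expnS /C0 -!mulnA.
  have step : \sum_(z in Z) #|X| ^ k * #|X| ^ l <= C * (C *
     \sum_(z in Z) sumk k (fun s => swap x z s) * sumk l (fun t => swap z y t)).
    rewrite !big_distrr /=; apply: leq_sum => z zZ.
    have := leq_mul (xZ z zZ Cn) (Zy z zZ Cn); rewrite -mulnA.
    by rewrite [sumk k _ * _]mulnCA.
  apply: (@leq_trans (D * (#|Z| * (#|X| ^ k * #|X| ^ l)))).
    by rewrite mulnCA [X in _ <= X]mulnA leq_mul2r Zbig orbT.
  by rewrite leq_mul2l -sum_nat_const step orbT.
rewrite leq_mul2l; apply/orP; right; rewrite sumk_cat.
rewrite (eq_bigr (fun z => sumk k (fun s => sumk l (fun t =>
   nat_of_bool (swap x z s && swap z y t))))).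
  rewrite sumk_sum; apply: leq_sumk => s sk /=.
  rewrite big_mkcond; apply: leq_sum => z _; case: (z \in Z) => //.
  apply: leq_sumk => t _; case: (boolP (_ && _)) => // /andP[sx sy].
  rewrite lt0b; apply/existsP; exists z.
  by rewrite -cat_rcons drop_cat size_rcons sk ltnn subnn drop0 cat_rcons
    take_size_cat // drop_size_cat // sx sy /=.
move=> z _; rewrite mulnC -sumkM; apply: eq_sumk => s _.
by rewrite mulnC -sumkM; apply: eq_sumk => t _; rewrite mulnb.
Qed.

(** A tile put in front of an exchange list lengthens it by h; this serves to bring lists of
    different origins to a common length. *)
Lemma reach_pad k C Ct : exists C', forall (X : tsystem h) (x y : X),
  (#|X| ^ h <= Ct * sumk h (fun s => tile [set z : X in s])) ->
  reach k C x y -> reach (h + k) C' x y.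
Proof.
set C0 := Ct * C; set m := h + k.
exists (C + (2 * C0 + 4 * C0 * (m * m.+1))) => X x y dense R.
have [Cn|nC] := leqP C #|X|; last first.
  by move=> /(leq_trans (leq_addr _ _)); rewrite leqNgt nC.
apply: reach_mono (leq_addl _ _) _.
pose P s := tile [set z : X in take h s] && swap x y (drop h s).
apply: (@reach_dense _ _ _ _ _ _ P).
  move=> s sm ux uy /andP[/tile_tileable tt /and4P[_ _ /asboolP tx /asboolP ty]].
  have pP w : perm_eq (take h s ++ w :: drop h s) (w :: s).
    by rewrite -[w :: drop h s]cat1s -[w :: s]cat1s perm_catCA cat_take_drop.
  by split; apply: (tileable_perm (pP _)); apply: tileable_cat => //;
    rewrite (perm_uniq (pP _)).
apply: (@leq_trans (C0 * (sumk h (fun s => tile [set z : X in s]) *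
                        sumk k (fun t => swap x y t)))).
  have := leq_mul dense (R Cn); rewrite -expnD /C0.
  by rewrite -!mulnA [sumk h _ * _]mulnCA.
rewrite leq_mul2l; apply/orP; right; rewrite sumk_cat.
rewrite mulnC -sumkM; apply: leq_sumk => s sh.
rewrite mulnC -sumkM; apply: leq_sumk => t _.
by rewrite /P take_size_cat // drop_size_cat // mulnb.
Qed.

Lemma reach_pads j k C Ct : exists C', forall (X : tsystem h) (x y : X),
  (#|X| ^ h <= Ct * sumk h (fun s => tile [set z : X in s])) ->
  reach k C x y -> reach (j * h + k) C' x y.
Proof.
elim: j => [|j [C1 H1]]; first by exists C.
have [C2 H2] := reach_pad (j * h + k) C1 Ct.
by exists C2 => X x y dense R; rewrite mulSn -addnA; exact/H2/H1.
Qed.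

(** Both parts of a biclique in a single list, so that [sumk] counts bicliques. *)
Definition biclist (T : Type) i (r : T -> T -> bool) (W : pred T) (s : seq T) : bool :=
  allrel r (take i s) (drop i s) && all W (drop i s).

Lemma biclist_count (V : finType) C i j (r : V -> V -> bool) (W : pred V) :
  0 < #|V| -> (forall u v, r u v -> W v) ->
  #|V| ^ 2 <= C * \sum_v #|[pred u | r u v]| ->
  #|V| ^ (i + j) <= biclique_const C i j * sumk (i + j) (fun s => biclist i r W s).
Proof.
move=> V0 rW /(biclique_count V0 i j rW) /leq_trans; apply.
rewrite leq_mul2l; apply/orP; right; rewrite sumk_cat.
apply: leq_sumk => s si; apply: leq_sumk => t _.
by rewrite /biclist take_size_cat // drop_size_cat.
Qed.

Lemma biclist_biclique (X : tsystem h) i (r : X -> X -> bool) (W : pred X) (s : seq X) :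
  (forall u v, r u v -> adj_before u v) -> biclist i r W s ->
  biclique [set z in take i s] [set z in drop i s].
Proof.
by move=> rlt /andP[/allrelP sr _] u v; rewrite !inE => us vs; apply/rlt/sr.
Qed.

Lemma card_seq (V : finType) (s : seq V) : uniq s -> #|[set z in s]| = size s.
Proof. by move=> us; rewrite cardsE; apply/card_uniqP. Qed.

Lemma set_take_drop (V : finType) i (s : seq V) :
  [set z in s] = [set z in take i s] :|: [set z in drop i s].
Proof. by apply/setP => z; rewrite !inE -mem_cat cat_take_drop. Qed.

Lemma tile_dense p C : p <= h -> exists Ct, forall X : tsystem h,
  splits X p -> Ct <= #|X| ->
  #|X| ^ 2 <= C * \sum_(v : X) #|[pred u | adj_before u v]| ->
  #|X| ^ h <= Ct * sumk h (fun s => tile [set z : X in s]).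
Proof.
move=> ph; set C0 := biclique_const C p (h - p).
exists (2 * C0 + 2 * C0 * (h * h) + 1) => X bX Xbig dense; set n := #|X|.
have n0 : 0 < n by rewrite /n; lia.
have := @biclist_count X C p (h - p) (@adj_before h X) predT n0 (fun _ _ _ => isT) dense.
rewrite subnKC // -/C0 -/n => big.
have bad : n * sumk h (fun s : seq X => ~~ uniq ([::] ++ s)) <= h * h * n ^ h.
  by have := @sumk_nonuniq X h [::] isT; rewrite add0n.
apply: leq_trans (sumk_most n0 big bad _ (Q := fun s => tile [set z : X in s]) _) _.
- by apply: leq_trans Xbig; rewrite -/n; lia.
- move=> s sh bs; rewrite negbK cat0s => us.
  rewrite (set_take_drop p); apply: bX; last exact: biclist_biclique bs.
    by rewrite card_seq ?take_uniq // size_take sh; case: ltngtP ph => // ->.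
  by rewrite card_seq ?drop_uniq // size_drop sh.
- by rewrite leq_mul2r; apply/orP; right; lia.
Qed.

End Chains.

(** Union bound for case distinctions: a large set of neighbours is split into finitely many
    classes, one of which must be large. *)
Lemma card_cover_seq (T : finType) (P : T -> bool) (s : seq (T -> bool)) :
  (forall z, P z -> has (fun Q => Q z) s) ->
  #|[pred z | P z]| <= \sum_(Q <- s) #|[pred z | Q z]|.
Proof.
move=> Ps; rewrite -sum1_card.
under [X in _ <= X]eq_bigr => Q _ do rewrite -sum1_card big_mkcond.
rewrite exchange_big big_mkcond; apply: leq_sum => z _.
rewrite unfold_in /=; case: ifP => // /Ps; elim: s {Ps} => //= Q s IHs.
by rewrite big_cons unfold_in /=; case: (Q z) => //=; rewrite add0n.
Qed.

(** * Reversal of the order *)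

Section Mirror.
Variables (h : nat) (X : tsystem h).

Definition mpos (v : X) := #|X| - (pos v).+1.

Lemma mpos_inj : injective mpos.
Proof.
move=> u v; rewrite /mpos => E; apply: pos_inj.
by have := pos_lt u; have := pos_lt v; lia.
Qed.

Lemma mpos_lt v : mpos v < #|X|.
Proof. by rewrite /mpos; have := pos_lt v; lia. Qed.

Definition mirror : tsystem h :=
  TSystem mpos_inj mpos_lt (@sadj_sym _ X) (@sadj_irr _ X) (@tile_card _ X).

Lemma mirror_before (u v : X) : @before _ mirror u v = before v u.
Proof.
by rewrite /before /= /mpos; have := pos_lt u; have := pos_lt v; lia.
Qed.

Lemma mirror_adj_before (u v : X) : @adj_before _ mirror u v = adj_before v u.
Proof. by rewrite /adj_before mirror_before /= sadj_sym. Qed.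

Lemma mirror_splits p : p <= h -> splits X p -> splits mirror (h - p).
Proof.
move=> ph bX P Y Pc Yc PY; rewrite setUC; apply: (bX Y P).
- by rewrite Yc subKn.
- by rewrite Pc.
- by move=> u v uY vP; rewrite -mirror_adj_before; exact: PY.
Qed.

End Mirror.

(** * Left and right degrees, and exchanges by bicliques on one side *)

Section Degrees.
Variable h : nat.
Implicit Types X : tsystem h.

Definition ldeg X (v : X) := #|[pred u | adj_before u v]|.
Definition rdeg X (v : X) := #|[pred u | adj_before v u]|.
Definition deg X (v : X) := #|[pred u | sadj v u]|.

Lemma mirror_ldeg X (v : X) : @ldeg (mirror X) v = rdeg v.
Proof. by apply: eq_card => u; rewrite !inE mirror_adj_before. Qed.

Lemma deg_split X (v : X) : deg v = ldeg v + rdeg v.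
Proof.
rewrite /deg -(cardID [pred u : X | before u v]); congr (_ + _); apply: eq_card => u.
  by rewrite !inE /adj_before andbC sadj_sym.
rewrite !inE /adj_before andbC /before; case: (boolP (sadj v u)) => [|_];
  last by rewrite !andbF.
rewrite !andbT -leqNgt leq_eqVlt => av; case: eqP => // E.
by rewrite (pos_inj E) sadj_irr in av.
Qed.

Lemma sum_ldeg X : \sum_(v : X) ldeg v = \sum_(v : X) rdeg v.
Proof.
rewrite /ldeg /rdeg; under eq_bigr => v _ do rewrite -sum1_card big_mkcond.
rewrite exchange_big; apply: eq_bigr => v _; rewrite -sum1_card [RHS]big_mkcond.
by apply: eq_bigr.
Qed.

Lemma card_pos_between X a b : #|[pred z : X | a <= pos z < b]| <= b - a.
Proof.
rewrite cardE -(size_map (@pos _ X)) -(size_iota a (b - a)).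
apply: uniq_leq_size; first by rewrite (map_inj_uniq (@pos_inj _ X)) enum_uniq.
by move=> k /mapP[z]; rewrite mem_enum inE => zab ->; rewrite mem_iota; lia.
Qed.

Lemma before_total X (x y : X) : x != y -> before x y || before y x.
Proof.
move=> xy; rewrite /before -neq_ltn; apply: contra xy => /eqP E.
by apply/eqP/pos_inj.
Qed.

(* Each of [x] and [y] can join the left part of a biclique whose right part
   consists of common right neighbours of [x] and [y]. *)
Lemma reach_right p M : 0 < p < h -> exists C, forall X (x y : X),
  splits X p ->
  #|X| <= M * #|[pred w | [&& adj_before x w, adj_before y w & #|X| <= M * ldeg w]]| ->
  reach h.-1 C x y.
Proof.
(* The left part has one vertex less than a tile requires: its place is taken by x or by y. *)
move=> /andP[p0 ph]; set C0 := biclique_const (M * M) p.-1 (h - p).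
exists (2 * C0 + 4 * C0 * (h.-1 * h.-1.+1)) => X x y bX big.
pose W : pred X := [pred w | [&& adj_before x w, adj_before y w & #|X| <= M * ldeg w]].
pose r u w := adj_before u w && W w.
have hE : p.-1 + (h - p) = h.-1 by lia.
have n0 := vert_gt0 x.
have dense : #|X| ^ 2 <= M * M * \sum_v #|[pred u | r u v]|.
  apply: (@leq_trans (M * \sum_(w in W) #|X|)).
    by rewrite sum_nat_const mulnA -mulnn leq_mul2r big orbT.
  rewrite -mulnA leq_mul2l big_distrr /= [X in X <= _]big_mkcond.
  apply/orP; right; apply: leq_sum => w _; case: (boolP (w \in W)) => // wW.
  have /and3P[_ _ le1] := wW; apply: (leq_trans le1).
  rewrite leq_mul2l; apply/orP; right; apply: subset_leq_card; apply/subsetP => u.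
  by rewrite !inE /r => ->.
have := @biclist_count X _ p.-1 (h - p) r W n0 _ dense.
rewrite hE => /(_ (fun u v => fun H => proj2 (andP H))) cnt.
apply: (@reach_dense _ _ _ _ _ _ (biclist p.-1 r W)) cnt => s sh ux uy bs.
have Wd : {in drop p.-1 s, forall w, W w} by apply/allP; case/andP: bs.
have st := @biclist_biclique _ _ _ _ W _ (fun u v H => proj1 (andP H)) bs.
have one z : (forall w, W w -> adj_before z w) -> uniq (z :: s) ->
    tileable [set t in z :: s].
  move=> zW uz; apply: tile_tileable.
  have us : uniq s by case/andP: uz.
  have -> : [set t in z :: s] =
     (z |: [set t in take p.-1 s]) :|: [set t in drop p.-1 s].
    by rewrite -setUA -set_take_drop; apply/setP => t; rewrite !inE.
  apply: bX.
  + rewrite cardsU1 inE card_seq ?take_uniq // size_take sh.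
    have -> : z \in take p.-1 s = false.
      by apply/negP => /mem_take zs; case/andP: uz; rewrite zs.
    by case: ltngtP; lia.
  + by rewrite card_seq ?drop_uniq // size_drop sh; lia.
  + move=> u v; rewrite !in_setU1 => /orP[/eqP-> |us'] vs; last exact: st.
    by apply: zW; apply: Wd; rewrite inE in vs.
by split; apply: one => // w /and3P[].
Qed.

Lemma reach_left p M : 0 < p < h -> exists C, forall X (x y : X),
  splits X p ->
  #|X| <= M * #|[pred w | [&& adj_before w x, adj_before w y & #|X| <= M * rdeg w]]| ->
  reach h.-1 C x y.
Proof.
move=> /andP[p0 ph]; have [|C HC] := @reach_right (h - p) M; first by lia.
exists C => X x y bX big; apply: (HC (mirror X)).
  by apply: mirror_splits bX; lia.
apply: leq_trans big _; rewrite leq_mul2l; apply/orP; right.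
by apply: subset_leq_card; apply/subsetP => w;
  rewrite !inE !mirror_adj_before mirror_ldeg.
Qed.

End Degrees.

(** * Minimum degree above one half *)

Section HalfDegree.
Variables (h p N : nat).
Hypotheses (p_bnd : 0 < p < h) (N_gt0 : 0 < N).
Implicit Types X : tsystem h.

(** The second condition says that every degree is at least (1/2 + 1/N) |X|. *)
Definition half_degree p X :=
  splits X p /\ forall v : X, (N + 2) * #|X| <= 2 * N * deg v.

(** By [codegree] two vertices have at least 32 |X| / M common neighbours, more than at most seven
    negligible classes, each of size at most 2 |X| / M, can contain. *)
Local Notation M := (16 * N).

Lemma mirror_half X : half_degree p X -> half_degree (h - p) (mirror X).
Proof. by move=> [bX dX]; split=> //; apply: mirror_splits bX; lia. Qed.

(** Inclusion and exclusion: twice (1/2 + 1/N) |X| exceeds |X| by 2 |X| / N. *)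
Lemma codegree X (x y : X) : half_degree p X ->
  2 * #|X| <= N * #|[pred z | sadj x z && sadj y z]|.
Proof.
move=> [_ dX]; have dx := dX x; have dy := dX y.
have := cardUI [pred z | sadj x z] [pred z | sadj y z].
have := max_card [predU [pred z | sadj x z] & [pred z | sadj y z]].
rewrite -/(deg x) -/(deg y).
have -> : #|[predI [pred z | sadj x z] & [pred z | sadj y z]]| =
   #|[pred z | sadj x z && sadj y z]| by apply: eq_card => z; rewrite !inE.
move: #|[predU _ & _]| #|[pred z | sadj x z && sadj y z]| (deg x) (deg y) dx dy.
move=> u i dx dy; nia.
Qed.

Lemma half_pad j k C : exists C', forall X (x y : X), half_degree p X ->
  reach k C x y -> reach (j * h + k) C' x y.
Proof.
(* Degrees of at least n/2 give at least n^2/4 edges, whence the constant 4. *)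
have [|Ct HCt] := @tile_dense h p 4; first by lia.
have [C1 HC1] := reach_pads h j k C Ct.
exists (C1 + Ct) => X x y hX R Cn.
have {}R := HC1 X x y _ R.
apply: (reach_mono (leq_addr _ _) (R _) Cn); apply: HCt.
- by case: hX.
- lia.
case: hX => _ dX.
have sdeg : \sum_(v : X) deg v = 2 * \sum_(v : X) ldeg v.
  by rewrite mul2n -addnn {2}sum_ldeg -big_split; apply: eq_bigr => v _; exact: deg_split.
have : \sum_(v : X) #|X| <= 2 * \sum_(v : X) deg v.
  rewrite big_distrr; apply: leq_sum => v _ /=.
  rewrite -(leq_pmul2l N_gt0); apply: (@leq_trans ((N + 2) * #|X|));
    first by rewrite leq_mul2r leq_addr orbT.
  by apply: (leq_trans (dX v)); rewrite mulnCA mulnA.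
by rewrite sum_nat_const sdeg mulnn mulnA.
Qed.

(** Lengths are kept in the form [j * h + h.-1]: a list and one more vertex then have a multiple of
    h elements, and all lengths can be equalised by padding. *)
Lemma half_chain j C j' C' : exists C'', forall X (x y : X) (Z : pred X),
  (forall z, Z z -> reach (j * h + h.-1) C x z /\ reach (j' * h + h.-1) C' z y) ->
  #|X| <= M * #|Z| -> reach ((j + j').+1 * h + h.-1) C'' x y.
Proof.
have [C'' HC] := reach_chain h (j * h + h.-1) (j' * h + h.-1) (C + C') M.
exists C'' => X x y Z RZ big.
have -> : (j + j').+1 * h + h.-1 = (j * h + h.-1) + (j' * h + h.-1).+1 by lia.
apply: (HC X x y [set z | Z z]); last by rewrite cardsE.
  by move=> z; rewrite inE => /RZ[R _]; apply: reach_mono R; exact: leq_addr.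
by move=> z; rewrite inE => /RZ[_ R]; apply: reach_mono R; exact: leq_addl.
Qed.

(** In an interval of length at most (i + 1) |X| / M, the points farther than i |X| / M from one end
    fill a band of width about |X| / M; the factor 2 absorbs rounding. *)
Lemma band_count X i a b (Q : X -> bool) : M <= #|X| -> M * (b - a) <= i.+1 * #|X| ->
  ((forall z, Q z -> a <= pos z < b /\ i * #|X| < M * (b - pos z)) \/
   (forall z, Q z -> a <= pos z < b /\ i * #|X| < M * (pos z - a))) ->
  M * #|[pred z | Q z]| <= 2 * #|X|.
Proof.
set n := #|X| => Mn ab HQ; set q := (i * n) %/ M.
have M0 : 0 < M by rewrite muln_gt0 N_gt0.
apply: (@leq_trans (M * (b - a - q))).
  rewrite leq_mul2l; apply/orP; right; case: HQ => HQ.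
    apply: (leq_trans _ (leq_trans (card_pos_between X a (b - q)) _)); last by lia.
    apply: subset_leq_card; apply/subsetP => z /HQ [/andP[az zb]].
    by rewrite !inE az [M * _]mulnC -ltn_divLR // -/q; lia.
  apply: (leq_trans _ (leq_trans (card_pos_between X (a + q) b) _)); last by lia.
  apply: subset_leq_card; apply/subsetP => z /HQ [/andP[az zb]].
  by rewrite !inE zb [M * _]mulnC -ltn_divLR // -/q; lia.
have E := divn_eq (i * n) M; have := ltn_pmod (i * n) M0.
rewrite -/q in E; move: (_ %% _) E => r E rM; move: ab Mn;
  rewrite [i.+1 * _]mulSn E => ab Mn.
by rewrite mulnBr; lia.
Qed.

(** Induction on the distance from w to the right end, in steps of |X| / M. Few common neighbours of
    x and w precede w. Those after w either have many left neighbours, and [reach_right] applies, or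
    are again poor on the left and, outside a narrow band, closer to the end, and one chains through
    them. *)
Lemma reach_left_poor i : exists j C, forall X (x w : X), half_degree p X ->
  adj_before x w -> M * ldeg w < #|X| -> M * (#|X| - pos w) <= i * #|X| ->
  reach (j * h + h.-1) C x w.
Proof.
elim: i => [|i [j [C IH]]].
  exists 0, 0 => X x w _ _ _; have := pos_lt w; nia.
have [C1 HC1] := @reach_right h p M p_bnd.
have [C2 HC2] := half_pad (j + j).+1 h.-1 C1.
have [C3 HC3] := half_chain j C j C.
exists (j + j).+1, (C2 + C3 + M) => X x w hX xw wLP wpos.
have [Mn|nM] := leqP M #|X|; last first.
  by move=> /(leq_trans (leq_addl _ _)); rewrite leqNgt nM.
pose P1 z := [&& adj_before x z, adj_before w z & #|X| <= M * ldeg z].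
pose P3 z := [&& adj_before x z, adj_before w z,
  M * ldeg z < #|X| & M * (#|X| - pos z) <= i * #|X|].
pose P4 (z : X) := (pos w <= pos z) && (i * #|X| < M * (#|X| - pos z)).
have big := codegree x w hX.
have : #|[pred z | sadj x z && sadj w z]| <=
   \sum_(Q <- [:: P1; (fun z => adj_before z w); P3; P4]) #|[pred z | Q z]|.
  apply: card_cover_seq => z /andP[xz wz] /=.
  have zw : z != w by apply: contraTneq wz => ->; rewrite sadj_irr.
  have /andP[xw' _] := xw.
  rewrite /P1 /P3 /P4 /adj_before xz wz (sadj_sym z) wz !andbT.
  case: (boolP (before w z)) => wz'; last first.
    by have := before_total zw; rewrite (negPf wz') orbF => ->; rewrite orbT.
  have -> : before x z by rewrite /before in xw' wz' *; lia.
  rewrite /= leqNgt; case: (_ < _) => //=; rewrite orbF.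
  rewrite (ltnW wz') /= ltnNge; case: (_ <= _) => //=; rewrite ?orbT //.
rewrite !big_cons big_nil addn0 -/(ldeg w) => tot.
have P4c : M * #|[pred z | P4 z]| <= 2 * #|X|.
  by apply: (band_count Mn wpos); left => z /andP[wz ->]; rewrite wz pos_lt.
have [P1big|P1small] := leqP #|X| (M * #|[pred z | P1 z]|).
  apply: (@reach_mono _ _ _ C2); first by lia.
  by apply: HC2 => //; apply: HC1 P1big; case: hX.
have [P3big|P3small] := leqP #|X| (M * #|[pred z | P3 z]|); last by nia.
apply: (@reach_mono _ _ _ C3); first by lia.
apply: HC3 P3big => z /and4P[xz wz zLP zpos]; split; first exact: IH.
by apply: reach_sym; exact: IH.
Qed.

End HalfDegree.

(** * Exchanging any two vertices when degrees exceed one half *)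

Section HalfReach.
Variables (h p N : nat).
Hypotheses (p_bnd : 0 < p < h) (N_gt0 : 0 < N).
Implicit Types X : tsystem h.
Local Notation M := (16 * N).

(** Induction on the length of the edge, in steps of |X| / M, according to the position of the
    common neighbours of its ends. *)
Lemma reach_edge i : exists j C, forall X (x y : X), half_degree N p X ->
  adj_before x y -> M * (pos y - pos x) <= i * #|X| -> reach (j * h + h.-1) C x y.
Proof.
have [jL [CL HL]] := reach_left_poor p_bnd N_gt0 M.
have mp_bnd : 0 < h - p < h by lia.
have [jR [CR HR]] := reach_left_poor mp_bnd N_gt0 M.
elim: i => [|i [j [C IH]]].
  by exists 0, 0 => X x y _ /andP[xy _]; rewrite /before in xy; nia.
have [C1 HC1] := @reach_right h p M p_bnd.
have [C2 HC2] := @reach_left h p M p_bnd.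
have [C3 HC3] := half_chain p_bnd N_gt0 jL CL jL CL.
have [C4 HC4] := half_chain p_bnd N_gt0 jR CR jR CR.
have [C5 HC5] := half_chain p_bnd N_gt0 j C j C.
(* The index of a common length to which the lists of all five cases are padded. *)
set J := jL + jL + (jR + jR) + (j + j) + 3.
have [D1 HD1] := half_pad p_bnd N_gt0 J h.-1 C1.
have [D2 HD2] := half_pad p_bnd N_gt0 J h.-1 C2.
have [D3 HD3] := half_pad p_bnd N_gt0 (J - (jL + jL).+1) ((jL + jL).+1 * h + h.-1) C3.
have [D4 HD4] := half_pad p_bnd N_gt0 (J - (jR + jR).+1) ((jR + jR).+1 * h + h.-1) C4.
have [D5 HD5] := half_pad p_bnd N_gt0 (J - (j + j).+1) ((j + j).+1 * h + h.-1) C5.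
have pad_eq k : k <= J -> (J - k) * h + (k * h + h.-1) = J * h + h.-1.
  by move=> kJ; rewrite addnA -mulnDl subnK.
exists J, (D1 + D2 + D3 + D4 + D5 + M) => X x y hX xy yx.
have [Mn|nM] := leqP M #|X|; last first.
  by move=> /(leq_trans (leq_addl _ _)); rewrite leqNgt nM.
have Mpos (v : X) : M * (#|X| - pos v) <= M * #|X| by rewrite leq_mul2l leq_subr orbT.
(* [P1] and [P2] give bicliques on one side; [P3] and [P4] are chained by [reach_left_poor] and its
   mirror image, [P5] by two shorter edges; [P6] and [P7] are narrow bands. *)
pose P1 z := [&& adj_before x z, adj_before y z & #|X| <= M * ldeg z].
pose P2 z := [&& adj_before z x, adj_before z y & #|X| <= M * rdeg z].
pose P3 z := [&& adj_before x z, adj_before y z & M * ldeg z < #|X|].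
pose P4 z := [&& adj_before z x, adj_before z y & M * rdeg z < #|X|].
pose P5 z := [&& adj_before x z, adj_before z y, M * (pos z - pos x) <= i * #|X|
  & M * (pos y - pos z) <= i * #|X|].
pose P6 z := [&& before x z, before z y & i * #|X| < M * (pos z - pos x)].
pose P7 z := [&& before x z, before z y & i * #|X| < M * (pos y - pos z)].
have big := codegree p_bnd N_gt0 x y hX.
have : #|[pred z | sadj x z && sadj y z]| <=
   \sum_(Q <- [:: P1; P2; P3; P4; P5; P6; P7]) #|[pred z | Q z]|.
  apply: card_cover_seq => z /andP[xz yz] /=.
  have zx : z != x by apply: contraTneq xz => ->; rewrite sadj_irr.
  have zy : z != y by apply: contraTneq yz => ->; rewrite sadj_irr.
  have /andP[xy' _] := xy.
  have [zx' | xz'] := orP (before_total zx).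
    have zy' : before z y by rewrite /before in xy' zx' *; lia.
    have [c|c] := leqP #|X| (M * rdeg z).
      by rewrite (_ : P2 z) ?orbT // /P2 /adj_before zx' zy' c !(sadj_sym z) xz yz.
    by rewrite (_ : P4 z) ?orbT // /P4 /adj_before zx' zy' c !(sadj_sym z) xz yz.
  have [zy' | yz'] := orP (before_total zy).
    have [c|c] := leqP (M * (pos z - pos x)) (i * #|X|); last first.
      by rewrite (_ : P6 z) ?orbT // /P6 xz' zy' c.
    have [d|d] := leqP (M * (pos y - pos z)) (i * #|X|); last first.
      by rewrite (_ : P7 z) ?orbT // /P7 xz' zy' d.
    by rewrite (_ : P5 z) ?orbT // /P5 /adj_before xz' zy' c d (sadj_sym z) xz yz.
  have [c|c] := leqP #|X| (M * ldeg z).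
    by rewrite (_ : P1 z) // /P1 /adj_before xz' yz' c xz yz.
  by rewrite (_ : P3 z) ?orbT // /P3 /adj_before xz' yz' c xz yz.
rewrite !big_cons big_nil addn0 => tot.
have P6c : M * #|[pred z | P6 z]| <= 2 * #|X|.
  by apply: (band_count p_bnd N_gt0 Mn yx); right => z /and3P[xz zy ->]; split=> //;
    apply/andP; split=> //; exact: ltnW.
have P7c : M * #|[pred z | P7 z]| <= 2 * #|X|.
  by apply: (band_count p_bnd N_gt0 Mn yx); left => z /and3P[xz zy ->]; split=> //;
    apply/andP; split=> //; exact: ltnW.
have [P1big|P1small] := leqP #|X| (M * #|[pred z | P1 z]|).
  apply: (@reach_mono _ _ _ D1); first by lia.
  by apply: HD1 => //; apply: HC1 P1big; case: hX.
have [P2big|P2small] := leqP #|X| (M * #|[pred z | P2 z]|).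
  apply: (@reach_mono _ _ _ D2); first by lia.
  by apply: HD2 => //; apply: HC2 P2big; case: hX.
have [P3big|P3small] := leqP #|X| (M * #|[pred z | P3 z]|).
  apply: (@reach_mono _ _ _ D3); first by lia.
  rewrite -(@pad_eq (jL + jL).+1); last by rewrite /J; lia.
  apply: HD3 => //; apply: HC3 P3big => z /and3P[xz yz zLP].
  by split; last apply: reach_sym; apply: HL.
have [P4big|P4small] := leqP #|X| (M * #|[pred z | P4 z]|).
  apply: (@reach_mono _ _ _ D4); first by lia.
  rewrite -(@pad_eq (jR + jR).+1); last by rewrite /J; lia.
  apply: HD4 => //; apply: HC4 P4big => z /and3P[xz yz zRP].
  split; last apply: reach_sym; apply: (HR (mirror X)) => //;
    by rewrite ?mirror_adj_before ?mirror_ldeg ?leq_mul2l ?leq_subr ?orbT //;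
      exact: (mirror_half p_bnd N_gt0).
have [P5big|P5small] := leqP #|X| (M * #|[pred z | P5 z]|); last by nia.
apply: (@reach_mono _ _ _ D5); first by lia.
rewrite -(@pad_eq (j + j).+1); last by rewrite /J; lia.
apply: HD5 => //; apply: HC5 P5big => z /and4P[xz zy zx' zy'].
by split; exact: IH.
Qed.

(** Every edge has length at most |X|, so [reach_edge] with index M covers all edges; any two
    vertices are then joined through their common neighbours. *)
Lemma half_reach : exists j C, forall X, half_degree N p X ->
  forall x y : X, reach (j * h + h.-1) C x y.
Proof.
have [j [C HC]] := reach_edge M.
have [C' HC'] := half_chain p_bnd N_gt0 j C j C.
exists (j + j).+1, C' => X hX x y.
have edge (u v : X) : sadj u v -> reach (j * h + h.-1) C u v.
  move=> uv; have neq : u != v by apply: contraTneq uv => ->; rewrite sadj_irr.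
  have le_pos (w z : X) : M * (pos w - pos z) <= M * #|X|.
    by rewrite leq_mul2l; have := pos_lt w; lia.
  case/orP: (before_total neq) => uv'; last apply: reach_sym; apply: HC => //.
    by rewrite /adj_before uv'.
  by rewrite /adj_before uv' sadj_sym.
apply: (HC' X x y (fun z => sadj x z && sadj y z)).
  by move=> z /andP[xz yz]; split; apply: edge; rewrite // sadj_sym.
apply: leq_trans (_ : 16 * (2 * #|X|) <= _); first by lia.
by rewrite -mulnA leq_mul2l (codegree p_bnd N_gt0).
Qed.

End HalfReach.

(** * Absorption *)

Lemma exp_dominates h B : 0 < B -> exists n0, forall n, n0 <= n -> n ^ h < 2 ^ (n %/ B).
Proof.
move=> B0; case: h => [|h].
  exists B => n Bn; rewrite expn0 -[1](expn0 2) ltn_exp2l //.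
  by rewrite divn_gt0.
(* With r = n / K one has n < (r + 1)^2 and r + 1 <= 2^r, and the exponent 2(h + 1)r is at most n /
   B. *)
set K := B * (2 * h.+1); have K0 : 0 < K by rewrite muln_gt0 B0.
exists (K * K) => n nK; set r := n %/ K.
have Kr : K <= r by rewrite leq_divRL.
have nr : n < r.+1 ^ 2.
  apply: leq_trans (_ : r.+1 * K <= _); first by rewrite -ltn_divLR.
  by rewrite -mulnn leq_mul2l; apply/orP; right; lia.
apply: (@leq_trans ((r.+1 ^ 2) ^ h.+1)); first by rewrite ltn_exp2r.
rewrite -expnM; apply: (@leq_trans ((2 ^ r) ^ (2 * h.+1))).
  by rewrite leq_exp2r // ltn_expl.
rewrite -expnM leq_exp2l // /r /K divnMA mulnC.
by rewrite mulnC leq_trunc_div.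
Qed.

Lemma bernoulli c k : c ^ k * (c + k) <= c * c.+1 ^ k.
Proof.
elim: k => [|k IHk]; first by rewrite !expn0 mul1n muln1 addn0.
rewrite !expnS mulnCA; apply: leq_trans (leq_mul (leqnn c.+1) IHk).
by move: (c ^ k) => p; nia.
Qed.

(** Bernoulli gives (1 + 1/c)^c >= 2; this is raised to the power 2t. *)
Lemma exp_ratio4 c t : 0 < c -> 4 ^ t * c ^ (2 * c * t) <= c.+1 ^ (2 * c * t).
Proof.
move=> c0; have E b : b ^ (2 * c * t) = (b ^ c) ^ (2 * t) by rewrite -expnM mulnCA mulnA.
rewrite !E (_ : 4 ^ t = 2 ^ (2 * t)); last by rewrite expnM.
rewrite -expnMn.
case: t {E} => // t; rewrite leq_exp2r //.
have := bernoulli c c; rewrite addnn -mul2n mulnA mulnC leq_pmul2l //.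
by rewrite mulnC.
Qed.

Section Absorbing.
Variable h : nat.
Hypothesis h_gt0 : 0 < h.
Implicit Type X : tsystem h.

Fixpoint swaps X k (Z Y A : seq X) : bool :=
  match Z, Y with
  | z :: Z', y :: Y' => swap z y (take k A) && swaps k Z' Y' (drop k A)
  | _, _ => true
  end.

Lemma swaps_sym X k (Z Y A : seq X) : swaps k Z Y A = swaps k Y Z A.
Proof.
elim: Z Y A => [|z Z IH] [|y Y] A //=; rewrite IH; congr (_ && _).
by rewrite /swap; case: (uniq (z :: _)); case: (uniq (y :: _)) => //=; rewrite andbC.
Qed.

Lemma swaps_tileable X k (Z Y A : seq X) : size Z = size Y ->
  size A = size Z * k -> uniq (Z ++ A) -> swaps k Z Y A ->
  tileable [set z in Z ++ A].
Proof.
elim: Z Y A => [|z Z IH] [|y Y] A //=.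
  move=> _ /size0nil -> _ _;
    suff -> : [set z in [::]] = set0 :> {set X} by exact: tileable0.
  by apply/setP => z; rewrite !inE.
move=> [ZY] sA uA /andP[/and4P[_ _ /asboolP tz _] mA].
have pA : perm_eq ((z :: take k A) ++ (Z ++ drop k A)) (z :: Z ++ A).
  by rewrite -{3}(cat_take_drop k A) /= perm_cons perm_catCA.
have {}uA : uniq ((z :: take k A) ++ (Z ++ drop k A)) by rewrite (perm_uniq pA).
apply: (tileable_perm pA).
apply: tileable_cat => //; apply: (IH Y) => //.
  by rewrite size_drop sA mulSn addKn.
by move: uA; rewrite cat_uniq => /and3P[].
Qed.

Lemma swaps_count X k C (Z Y : seq X) : size Z = size Y -> C <= #|X| ->
  (forall x y : X, reach k C x y) ->
  #|X| ^ (size Z * k) <= C ^ size Z * sumk (size Z * k) (fun A => swaps k Z Y A).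
Proof.
move=> ZY Cn R; elim: Z Y ZY => [|z Z IH] [|y Y] //= [ZY].
have := leq_mul (R z y Cn) (IH _ ZY); rewrite -expnD => /leq_trans; apply.
rewrite mulnACA -expnS leq_mul2l; apply/orP; right; rewrite sumk_cat.
rewrite mulnC -sumkM; apply: leq_sumk => s sk.
rewrite mulnC -sumkM; apply: leq_sumk => t _.
by rewrite take_size_cat // drop_size_cat // mulnb.
Qed.

Definition absorb X (Z A : seq X) : bool :=
  [&& uniq (Z ++ A), `[< tileable [set z in A] >] & `[< tileable [set z in Z ++ A] >]].

(** An absorber of Z is a tile y_1, ..., y_h followed by lists A_i exchanging z_i with y_i. Without
    Z, each A_i is completed by y_i; with Z, it is completed by z_i and the y_i form a tile. *)
Lemma absorb_count k C Ct : exists C', forall X, C' <= #|X| ->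
  #|X| ^ h <= Ct * sumk h (fun s => tile [set z : X in s]) ->
  (forall x y : X, reach k C x y) ->
  forall Z : seq X, uniq Z -> size Z = h ->
  #|X| ^ (h + h * k) <= C' * sumk (h + h * k) (fun A => absorb Z A).
Proof.
set m := h + h * k; set C0 := Ct * C ^ h.
exists (C + 2 * C0 + 2 * C0 * (m * (h + m)) + 1) => X Xbig dense R Z uZ sZ.
have n0 : 0 < #|X| by lia.
pose P s := tile [set z : X in take h s] && swaps k Z (take h s) (drop h s).
have cnt : #|X| ^ m <= C0 * sumk m (fun s => P s).
  apply: (@leq_trans (Ct * sumk h (fun s => tile [set z : X in s]) * #|X| ^ (h * k))).
    by rewrite expnD leq_mul2r dense orbT.
  rewrite /C0 -!mulnA leq_mul2l; apply/orP; right.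
  rewrite sumk_cat mulnC -!sumkM; apply: leq_sumk => s sh.
  rewrite mulnC; case: (boolP (tile _)) => ts; last by rewrite mul0n.
  have := @swaps_count X k C Z s; rewrite sZ sh mul1n => /(_ erefl _ R) => H.
  apply: leq_trans (H _) _; first by lia.
  rewrite leq_mul2l; apply/orP; right; apply: leq_sumk => t _.
  by rewrite /P take_size_cat // drop_size_cat // ts.
have bad := sumk_nonuniq m uZ; rewrite sZ in bad.
apply: leq_trans (sumk_most n0 cnt bad _ (Q := fun A => absorb Z A) _) _.
- lia.
- move=> s sm /andP[ts ms]; rewrite negbK => uZs; rewrite /absorb uZs /=.
  have us : uniq s by move: uZs; rewrite cat_uniq => /and3P[].
  have sth : size (take h s) = h by rewrite size_take sm /m; case: ltngtP; nia.
  have sdh : size (drop h s) = size Z * k by rewrite size_drop sm /m sZ addKn.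
  apply/andP; split; apply/asboolP.
    rewrite -(cat_take_drop h s); apply: (swaps_tileable (Y := Z) (k := k)).
    + by rewrite sth sZ.
    + by rewrite sdh sZ sth.
    + by rewrite cat_take_drop.
    + by rewrite swaps_sym.
  have ps : perm_eq (take h s ++ (Z ++ drop h s)) (Z ++ s).
    by rewrite -{3}(cat_take_drop h s) perm_catCA.
  rewrite -(perm_uniq ps) in uZs.
  apply: (tileable_perm ps); apply: tileable_cat => //; first exact: tile_tileable.
  apply: (swaps_tileable (Y := take h s) (k := k)) => //; first by rewrite sth sZ.
  by move: uZs; rewrite cat_uniq => /and3P[].
- by rewrite leq_mul2r; apply/orP; right; lia.
Qed.

(** * Greedy choice of disjoint absorbers *)

Section Greedy.
Variables (X : tsystem h) (m C : nat).
Hypotheses (n_h : h <= #|X|)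
  (dense : forall Z : seq X, uniq Z -> size Z = h ->
     #|X| ^ m <= C * sumk m (fun A => absorb Z A)).

(** Each absorber of Z halves the weight of Z. A potential below 2^(T - t) forces more than t
    absorbers for every Z at once. *)
Definition potential T (As : seq (seq X)) : nat :=
  sumk h (fun Z => uniq Z * 2 ^ (T - count (absorb Z) As)).

Lemma size_flatten_const (As : seq (seq X)) :
  all (fun A => size A == m) As -> size (flatten As) = m * size As.
Proof.
elim: As => [|A As IH] /=; first by rewrite muln0.
by case/andP=> /eqP sA /IH sB; rewrite size_cat sA sB mulnS.
Qed.

Lemma leq_sumk1 k (F : seq X -> nat) s : size s = k -> F s <= sumk k F.
Proof.
elim: k F s => [|k IHk] F [|v s] //= [sk].
apply: leq_trans (IHk (fun s => F (v :: s)) s sk) _.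
by rewrite (bigD1 v) //= leq_addr.
Qed.

Lemma potential_gt0 T As : 0 < potential T As.
Proof.
have sZ : size (take h (enum X)) = h by rewrite size_take -cardE; case: ltngtP n_h.
apply: leq_trans (leq_sumk1 _ sZ).
by rewrite take_uniq ?enum_uniq // mul1n expn_gt0.
Qed.

(** By averaging, some new list absorbs a fraction at least 1/(2C) of the total weight; halving that
    part multiplies the potential by at most 1 - 1/(4C). *)
Lemma greedy_absorbers T j : j <= T -> 2 * C * (m * (m * T + m)) <= #|X| ->
  exists As : seq (seq X), [/\ size As = j, uniq (flatten As),
    all (fun A => (size A == m) && `[< tileable [set z in A] >]) As &
    (4 * C) ^ j * potential T As <= (4 * C).-1 ^ j * (#|X| ^ h * 2 ^ T)].
Proof.
move=> jT nbig; elim: j jT => [|j IHj] jT.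
  exists [::]; split=> //; rewrite !expn0 !mul1n.
  apply: (@leq_trans (sumk h (fun _ : seq X => 2 ^ T))); last first.
    by rewrite sumk_const mulnC.
  by apply: leq_sumk => Z _; rewrite /= subn0; case: uniq; rewrite ?mul1n ?mul0n.
have [|As [sAs uAs allAs pAs]] := IHj; first exact: ltnW.
pose U := flatten As.
have sU : size U = m * j.
  by rewrite /U -sAs; apply: size_flatten_const; apply: sub_all allAs => A /andP[].
have n0 : 0 < #|X| by apply: leq_trans n_h.
(* Disjointness from the lists already chosen costs only a factor 2 in the density. *)
pose good Z A := absorb Z A && uniq (U ++ A).
have many (Z : seq X) : uniq Z -> size Z = h ->
    #|X| ^ m <= 2 * C * sumk m (fun A => good Z A).
  move=> uZ sZ; have bad := sumk_nonuniq m uAs; rewrite -/U sU in bad.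
  apply: (sumk_most n0 (dense uZ sZ) bad) => [|A _ ZA]; last by rewrite negbK /good ZA.
  apply: leq_trans nbig; rewrite leq_mul2l leq_mul2l leq_add2r leq_mul2l.
  by rewrite (ltnW jT) !orbT.
pose w Z := uniq Z * 2 ^ (T - count (absorb Z) As).
pose G A := sumk h (fun Z => w Z * good Z A).
have Gsum : #|X| ^ m * potential T As <= 2 * C * sumk m G.
  have -> : sumk m G = sumk h (fun Z => w Z * sumk m (fun A => good Z A)).
    rewrite /G; elim: (m) (good) => //= k IHk g.
    have -> : (\sum_v sumk k (fun s => sumk h (fun Z => w Z * g Z (v :: s)))) =
      \sum_v sumk h (fun Z => w Z * sumk k (fun s => g Z (v :: s))).
      by apply: eq_bigr => v _; exact: (IHk (fun Z s => g Z (v :: s))).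
    by rewrite sumk_sum; apply: eq_sumk => Z _; rewrite big_distrr.
  rewrite -!sumkM; apply: leq_sumk => Z sZ; rewrite -/(w Z).
  have [uZ|nuZ] := boolP (uniq Z); last by rewrite /w (negPf nuZ) mul0n !muln0.
  by rewrite mulnC mulnCA leq_mul2l many ?orbT.
have [A sA GA] := sumk_max m G n0.
have {Gsum} GA : potential T As <= 2 * C * G A.
  rewrite -(leq_pmul2l (_ : 0 < #|X| ^ m)) ?expn_gt0 ?n0 //.
  by apply: (leq_trans Gsum); rewrite mulnCA leq_mul2l GA orbT.
(* As the potential is positive, some Z witnesses that [A] is tileable and disjoint from the earlier
   lists. *)
have [Z sZ /andP[ZA UA]] : exists2 Z, size Z = h & good Z A.
  have [Z sZ le1] := sumk_max h (fun Z => w Z * good Z A) n0.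
  exists Z => //; move: (potential_gt0 T As) GA le1; rewrite -/(G A).
  by case: (good Z A) => //; rewrite muln0 muln0; nia.
exists (A :: As); split.
- by rewrite /= sAs.
- by rewrite /= uniq_catC.
- by rewrite /= allAs sA eqxx /=; case/and3P: ZA => _ ->.
have half : 2 * potential T (A :: As) + G A <= 2 * potential T As.
  rewrite -!sumkM -sumkD; apply: leq_sumk => Y sY.
  rewrite /w; case: (uniq Y) => //=; rewrite !mul1n.
  (* Fewer than T lists have been chosen, so the truncated exponent really drops by one. *)
  have cT : count (absorb Y) As < T.
    by apply: leq_ltn_trans (count_size _ _) _; rewrite sAs.
  have gle : good Y A <= absorb Y A by rewrite /good; case: (absorb Y A) => //=;
    exact: leq_b1.
  move: gle; case: (absorb Y A) => /= gle; last first.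
    by move: gle; rewrite leqn0 => /eqP ->; rewrite muln0 addn0.
  rewrite -subn_gt0 in cT; rewrite add1n subnS.
  case: (T - count (absorb Y) As) cT => // d _.
  rewrite /= expnS mul2n [X in _ <= X]mul2n -[X in _ <= X]addnn leq_add2l.
  by rewrite -mul2n -[X in _ <= X]muln1 leq_mul2l gle orbT.
have step : 4 * (C * potential T (A :: As)) <= (4 * C).-1 * potential T As by nia.
rewrite !expnS [4 * C * _ ^ _]mulnC -!mulnA.
apply: leq_trans (leq_mul (leqnn _) step) _.
by rewrite mulnCA leq_mul2l pAs orbT.
Qed.

End Greedy.

(** [L] is cut into r pieces of size h. Each piece uses up one absorber, so r absorbers per piece
    always leave a free one. *)
Lemma absorb_all X (As : seq (seq X)) (L : seq X) r :
  size L = r * h -> uniq (L ++ flatten As) ->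
  (forall A, A \in As -> tileable [set z in A]) ->
  (forall Z : seq X, uniq Z -> size Z = h -> r <= count (absorb Z) As) ->
  tileable [set z in L ++ flatten As].
Proof.
elim: r As L => [|r IHr] As L sL uL tA cnt.
  rewrite (size0nil sL) /= in uL *.
  elim: As uL tA {cnt} => [|A As IH] uAs tA.
    suff -> : [set z in flatten [::]] = set0 :> {set X} by exact: tileable0.
    by apply/setP => z; rewrite !inE.
  apply: tileable_cat => //; first by apply: tA; rewrite mem_head.
  apply: IH; first by move: uAs; rewrite cat_uniq => /and3P[].
  by move=> B BA; apply: tA; rewrite inE BA orbT.
have sZ : size (take h L) = h.
  by rewrite size_take sL mulSn; case: ltngtP => //; lia.
have uLL : uniq L by move: uL; rewrite cat_uniq => /and3P[].
have uZ : uniq (take h L) by exact: take_uniq.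
have /hasP[A AAs ZA] : has (absorb (take h L)) As.
  by rewrite has_count; apply: leq_trans (cnt _ uZ sZ).
have pAs := perm_to_rem AAs.
have pL : perm_eq ((take h L ++ A) ++ (drop h L ++ flatten (rem A As))) (L ++ flatten As).
  apply: (@perm_trans _ (L ++ flatten (A :: rem A As))).
    rewrite -{3}(cat_take_drop h L) /= -!catA perm_cat2l.
    by rewrite perm_catCA.
  by rewrite perm_cat2l; apply: perm_flatten; rewrite perm_sym.
apply: (tileable_perm pL); rewrite -(perm_uniq pL) in uL.
apply: tileable_cat => //; first by case/and3P: ZA => _ _ /asboolP.
apply: IHr.
- by rewrite size_drop sL mulSn addKn.
- by move: uL; rewrite cat_uniq => /and3P[].
- by move=> B /mem_rem; exact: tA.
- move=> Y uY sY; have := cnt Y uY sY; rewrite (permP pAs) /= => le1.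
  by rewrite -ltnS; apply: (leq_trans le1); case: absorb.
Qed.

Lemma absorbing_set k C Ct B : 0 < B -> exists D n0, 0 < D /\ forall X, n0 <= #|X| ->
  #|X| ^ h <= Ct * sumk h (fun s => tile [set z : X in s]) ->
  (forall x y : X, reach k C x y) ->
  exists A : {set X}, [/\ tileable A, B * #|A| <= #|X| &
    forall L : {set X}, [disjoint A & L] -> D * #|L| <= #|X| -> h %| #|L| ->
      tileable (L :|: A)].
Proof.
move=> B0; have [C1 HC1] := absorb_count k C Ct.
(* One greedy step multiplies the potential by at most [c / c.+1], so [2 * c * t] steps divide it by
   at least 4^t. *)
set m := h + h * k; set C2 := C1.+1; set c := (4 * C2).-1.
have c0 : 0 < c by rewrite /c; lia.
(* The first term keeps the absorbing set below n / B, the second leaves room for the disjoint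
   choices. *)
set D := B * m * (2 * c) + 4 * C2 * (m * m) * (2 * c) + 1.
have D0 : 0 < D by rewrite /D addn1.
have [n0 Hn0] := exp_dominates h D0.
exists D, (n0 + C1 + h + 4 * C2 * (m * m)); split=> // X Xbig dense R.
set n := #|X| in Xbig *; set t := n %/ D; set T := 2 * c * t.
have tD : t * D <= n by exact: leq_trunc_div.
have cnt Z : uniq Z -> size Z = h -> n ^ m <= C2 * sumk m (fun A => absorb (X := X) Z A).
  move=> uZ sZ; apply: leq_trans (HC1 X _ dense R Z uZ sZ) _; first by rewrite -/n; lia.
  by rewrite leq_mul2r leqnSn orbT.
have [|||As [sAs uAs allAs pAs]] := @greedy_absorbers X m C2 _ cnt T T.
- by rewrite -/n; lia.
- by [].
- have : t * (4 * C2 * (m * m) * (2 * c)) <= n.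
    by apply: leq_trans tD; rewrite leq_mul2l /D -addnA [X in _ <= X]addnCA leq_addr orbT.
  by rewrite -/n /T; lia.
(* Otherwise Z alone has weight at least 2^(T - t), while the final potential is at most n^h 2^T /
   4^t, which is smaller because n^h < 2^t. *)
have many (Z : seq X) : uniq Z -> size Z = h -> t < count (absorb Z) As.
  move=> uZ sZ; rewrite ltnNge; apply/negP => few.
  have le1 : 2 ^ (T - t) <= potential T As.
    apply: leq_trans (leq_sumk1 _ sZ); rewrite uZ mul1n leq_exp2l //.
    exact: leq_sub2l.
  have r4 := exp_ratio4 t c0; rewrite -/T (_ : c.+1 = 4 * C2) in r4;
    last by rewrite /c; lia.
  have nh : n ^ h < 2 ^ t by apply: Hn0; rewrite -/n; lia.
  have tT : t <= T by rewrite /T -[X in X <= _]mul1n leq_mul2r; lia.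
  have : c ^ T * (4 ^ t * 2 ^ (T - t)) <= c ^ T * (n ^ h * 2 ^ T).
    apply: leq_trans pAs; rewrite mulnA [c ^ T * _]mulnC.
    exact: leq_mul.
  rewrite leq_pmul2l ?expn_gt0 ?c0 // (_ : 4 ^ t = 2 ^ t * 2 ^ t); last first.
    by rewrite -expnMn.
  rewrite -mulnA -expnD subnKC // leq_pmul2r ?expn_gt0 //.
  by rewrite leqNgt nh.
have sF : size (flatten As) = m * T.
  by rewrite -sAs; apply: size_flatten_const; apply: sub_all allAs => A /andP[].
have tA A : A \in As -> tileable [set z in A].
  by move=> AAs; have /andP[_ /asboolP] := allP allAs A AAs.
exists [set z in flatten As]; split.
- by apply: (@absorb_all X As [::] 0).
- rewrite card_seq // sF /T -/n; apply: leq_trans tD.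
  rewrite (_ : B * _ = t * (B * m * (2 * c))); last by lia.
  by rewrite leq_mul2l /D -addnA leq_addr orbT.
- move=> L dL DL /dvdnP[r Lr].
  have -> : L :|: [set z in flatten As] = [set z in enum L ++ flatten As].
    by apply/setP => z; rewrite !inE mem_cat mem_enum.
  apply: (@absorb_all X As (enum L) r) => //; first by rewrite -cardE.
    rewrite cat_uniq enum_uniq uAs andbT /=; apply/hasPn => z zF.
    rewrite /= mem_enum; apply/negP => zL.
    by have := disjointFr dL (_ : z \in [set z in flatten As]);
      rewrite inE zF zL => /(_ isT).
  move=> Z uZ sZ; apply: leq_trans (ltnW (many Z uZ sZ)).
  rewrite /t leq_divRL //; apply: leq_trans DL; rewrite mulnC leq_mul2l Lr.
  by rewrite leq_pmulr ?orbT.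
Qed.

End Absorbing.

(** * Almost perfect tilings *)

Lemma sum_leq_max (T : finType) (F : T -> nat) : 0 < #|T| ->
  exists i, \sum_j F j <= #|T| * F i.
Proof.
case/card_gt0P=> i0 _; have [i _ imax] := @arg_maxnP T i0 xpredT F isT.
by exists i; rewrite -sum_nat_const; apply: leq_sum => j _; exact: imax.
Qed.

Section AlmostTiling.
Variables (h a b m : nat).
Hypotheses (h_gt0 : 0 < h) (ma : m <= a) (mb : m <= b) (ah : a <= h) (bh : b <= h).
Implicit Types X : tsystem h.

(** [S] supplies a vertices when it is on the left and b when it is on the right, so at most [h - m]
    are asked of [Y]. *)
Lemma one_tile X (S Y : {set X}) : splits X a -> splits X (h - b) ->
  h <= #|S| -> h - m <= #|Y| -> biclique S Y \/ biclique Y S ->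
  exists S1 Y1 : {set X}, [/\ S1 \subset S, Y1 \subset Y, #|S1| <= h & tile (S1 :|: Y1)].
Proof.
move=> bXa bXb Sh Yh [SY|YS].
  have [|S1 S1S cS1] := @exists_subset_card _ S a; first exact: leq_trans Sh.
  have [|Y1 Y1Y cY1] := @exists_subset_card _ Y (h - a); first by lia.
  exists S1, Y1; split; rewrite ?cS1 //; apply: bXa => // u v uS vY.
  by apply: SY; [exact: (subsetP S1S) | exact: (subsetP Y1Y)].
have [|S1 S1S cS1] := @exists_subset_card _ S b; first exact: leq_trans Sh.
have [|Y1 Y1Y cY1] := @exists_subset_card _ Y (h - b); first by lia.
exists S1, Y1; split; rewrite ?cS1 // setUC; apply: bXb => //.
  by rewrite cS1 subKn.
by move=> u v uY vS; apply: YS; [exact: (subsetP Y1Y) | exact: (subsetP S1S)].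
Qed.

(** One tile for each q, built from its own [Y q] and at most h vertices of the shared reservoir
    [S]. *)
Lemma pack X (I : eqType) (qs : seq I) (S : {set X}) (Y : I -> {set X}) :
  splits X a -> splits X (h - b) -> uniq qs -> size qs * h <= #|S| ->
  (forall q, q \in qs -> h - m <= #|Y q|) ->
  (forall q, q \in qs -> biclique S (Y q) \/ biclique (Y q) S) ->
  {in qs &, forall q q', q != q' -> [disjoint Y q & Y q']} ->
  exists D : {set X}, [/\ tileable D, #|D| = size qs * h &
    forall z, z \in D -> z \in S \/ exists2 q, q \in qs & z \in Y q].
Proof.
move=> bXa bXb; elim: qs S => [|q qs IH] S /=.
  by move=> *; exists set0; rewrite cards0; split=> // [|z]; rewrite ?inE //;
    exact: tileable0.
move=> /andP[qqs uqs] Sc Yc SY dY; rewrite mulSn in Sc.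
have hS : h <= #|S| by lia.
have [S1 [Y1 [S1S Y1Y S1h tS1]]] :=
  one_tile bXa bXb hS (Yc q (mem_head _ _)) (SY q (mem_head _ _)).
have inq q' : q' \in qs -> q' \in q :: qs by rewrite inE => ->; rewrite orbT.
have cSS1 : size qs * h <= #|S :\: S1|.
  have := cardsD S S1; rewrite (setIidPr S1S); lia.
have [|q' /inq q'qs|q' q'' /inq q'qs /inq q''qs|D [tD cD Dsub]] := IH (S :\: S1) uqs cSS1.
- by move=> q' /inq; exact: Yc.
- case: (SY q' q'qs) => B; [left|right] => u v.
    by rewrite inE => /andP[_ uS] vY; exact: B.
  by rewrite [v \in _]inE => uY /andP[_ vS]; exact: B.
- exact: dY.
have Sdis q' : q' \in q :: qs -> [disjoint S & Y q'].
  by case/SY=> /biclique_disjoint //; rewrite disjoint_sym.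
have dD : [disjoint (S1 :|: Y1) & D].
  rewrite -setI_eq0; apply/eqP/setP => z; rewrite !inE; apply/negP => /andP[+ /Dsub].
  case/orP=> [zS1|/(subsetP Y1Y) zY].
    case=> [|[q' /inq q'qs zY']]; first by rewrite !inE zS1.
    by have := disjointFr (Sdis q' q'qs) (subsetP S1S _ zS1); rewrite zY'.
  case=> [|[q' q'qs zY']].
    rewrite inE => /andP[_ zS].
    by have := disjointFr (Sdis q (mem_head _ _)) zS; rewrite zY.
  have qq' : q != q' by apply: contraNneq qqs => ->.
  by have := disjointFr (dY _ _ (mem_head _ _) (inq _ q'qs) qq') zY; rewrite zY'.
exists (S1 :|: Y1 :|: D); split.
- by apply: tileableU => //; exact: tile_tileable.
- have := cardsUI (S1 :|: Y1) D; rewrite (disjoint_setI0 dD) cards0 addn0 => ->.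
  by rewrite (tile_card tS1) cD mulSn.
- move=> z; rewrite !inE -orbA =>
  /or3P[/(subsetP S1S)|/(subsetP Y1Y) zY|/Dsub[|[q' q'qs zY]]].
  + by left.
  + by right; exists q; rewrite ?mem_head.
  + by rewrite inE => /andP[_]; left.
  + by right; exists q' => //; exact: inq.
Qed.

Lemma sum_rel_deg X (L : {set X}) :
  \sum_(v in L) \sum_(u in L) sadj v u = 2 * \sum_(u in L) \sum_(v in L) adj_before u v.
Proof.
rewrite mul2n -addnn [X in _ = X + _]exchange_big -big_split; apply: eq_bigr => v _.
rewrite -big_split; apply: eq_bigr => u _ /=; rewrite /adj_before (sadj_sym u).
case: (boolP (sadj v u)) => vu; last by rewrite !andbF.
have : v != u by apply: contraTneq vu => ->; rewrite sadj_irr.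
by move=> /before_total; rewrite !andbT /before; case: ltngtP.
Qed.

(* In a maximal tiling with many uncovered vertices, a positive proportion of
   the pairs (uncovered vertex [v], tile [B]) has the same pattern of more than
   [h - m] neighbours of [v] in [B]. Breaking [h - m] such tiles frees, for each
   position in the pattern, enough vertices for a new tile whose other vertices
   are uncovered. *)
Lemma almost_tiling N E : 0 < N -> 0 < E -> exists n0, forall X, n0 <= #|X| ->
  splits X a -> splits X (h - b) ->
  (forall v : X, N * (h - m) * #|X| + #|X| <= N * h * deg v) ->
  forall A : {set X}, 4 * N * h * #|A| <= #|X| ->
  exists D : {set X}, [/\ [disjoint A & D], tileable D & E * #|~: (A :|: D)| <= #|X|].
Proof.
move=> N0 E0.
have C1_gt0 : 0 < 8 * N * h by rewrite !muln_gt0 N0 h_gt0.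
have [n1 kst1] := kovari_sos_turan h C1_gt0.
(* The pattern of v in a tile: the positions of its neighbours, and the positions that come after
   v. *)
set colT := ({set 'I_h} * {set 'I_h})%type.
have C2_gt0 : 0 < 2 * N * h * #|{: colT}|.
  rewrite muln_gt0; apply/andP; split; first by lia.
  by apply/card_gt0P; exists (set0, set0).
have [n2 kst2] := kovari_sos_turan (h * h) C2_gt0.
exists (E * (n1 + n2) + 2 * N * (h * h) * n2 + 1) => X Xbig bXa bXb degX A smallA.
set n := #|X| in Xbig degX smallA *.
pose ok (D : {set X}) := [disjoint A & D] && `[< tileable D >].
have ok0 : ok set0.
  apply/andP; split; last by apply/asboolP; exact: tileable0.
  by rewrite -setI_eq0 setI0.
have [D /andP[AD /asboolP tD] Dmax] := @arg_maxnP _ set0 ok (fun D : {set X} => #|D|) ok0.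
exists D; split=> //; set L := ~: (A :|: D).
rewrite leqNgt; apply/negP => Lbig.
have inL v : (v \in L) = (v \notin A) && (v \notin D) by rewrite !inE negb_or.
set l := #|L| in Lbig.
have ln : l <= n by exact: max_card.
have l0 : 0 < l by lia.
have [x0 _] := card_gt0P l0.
have max_contra (D' : {set X}) :
  [disjoint A & D'] -> tileable D' -> #|D| < #|D'| -> False.
  move=> AD' /asboolP tD'; have := Dmax D'; rewrite /ok AD' tD' => /(_ isT) /=.
  by rewrite leqNgt => /negP.
have [F [tF coverF FT]] := tD.
(* A dense [L] would contain a large biclique, hence one more tile. *)
have sparse : 8 * N * h * \sum_(u in L) \sum_(v in L) adj_before u v < l * l.
  rewrite ltnNge; apply/negP => le1.
  have Ln1 : n1 <= #|L| by rewrite -/l; nia.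
  have [S [Y [SL YL Sh Yh SY]]] := kst1 _ _ L L _ Ln1 Ln1 le1.
  have hS : h <= #|S| by rewrite Sh.
  have hY : h - m <= #|Y| by rewrite Yh leq_subr.
  have [S1 [Y1 [S1S Y1Y _ tS1]]] := one_tile bXa bXb hS hY (or_introl SY).
  have sub z : z \in S1 :|: Y1 -> z \in L.
    by rewrite inE => /orP[/(subsetP S1S)/(subsetP SL)|/(subsetP Y1Y)/(subsetP YL)].
  have dis : [disjoint D & S1 :|: Y1].
    rewrite -setI_eq0; apply/eqP/setP => z; rewrite in_setI in_set0; apply/negP.
    by move=> /andP[zD /sub]; rewrite inL zD andbF.
  apply: (max_contra (D :|: (S1 :|: Y1))).
  - rewrite -setI_eq0; apply/eqP/setP => z; rewrite in_setI in_setU in_set0; apply/negP.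
    move=> /andP[zA /orP[zD|/sub]]; last by rewrite inL zA.
    by have := disjointFr AD zA; rewrite zD.
  - by apply: tileableU => //; exact: tile_tileable.
  - have := cardsUI D (S1 :|: Y1).
    rewrite (disjoint_setI0 dis) cards0 addn0 (tile_card tS1) => ->.
    by rewrite -[X in X < _]addn0 ltn_add2l.
pose u (q : 'I_h) (B : {set X}) := nth x0 (enum B) q.
have sB B : B \in F -> size (enum B) = h by move=> /FT /tile_card; rewrite -cardE.
have uB q B : B \in F -> u q B \in B.
  by move=> BF; rewrite -mem_enum mem_nth // sB.
pose Q v B := [set q | sadj v (u q B)].
pose P v B := [set q | before v (u q B)].
pose bad := \sum_(v in L) \sum_(B in F) (h - m < #|Q v B|).
have degD v : \sum_(z in D) sadj v z = \sum_(B in F) #|Q v B|.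
  rewrite -coverF big_trivIset //; apply: eq_bigr => B BF.
  rewrite -[LHS]big_enum (big_nth x0) sB // big_mkord -sum1_card [RHS]big_mkcond.
  by apply: eq_bigr => q _; rewrite inE; case: sadj.
have FD : #|F| * h = #|D|.
  rewrite -coverF -(eqP tF) (eq_bigr (fun=> h)); first by rewrite sum_nat_const.
  by move=> B /FT /tile_card.
have Fn : #|F| * h <= n by rewrite FD; exact: max_card.
(* Degrees exceed (1 - m/h) n by n/(Nh). Since [L] is sparse and [A] small, the surplus comes from
   tiles with more than [h - m] neighbours. *)
have badbig : l * n <= 2 * N * (h * h) * bad.
  have degL v : v \in L ->
    deg v <= \sum_(z in L) sadj v z + \sum_(z in D) sadj v z + #|A|.
    move=> _; rewrite /deg -[#|A|]sum1_card -[X in X <= _]sum1_card.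
    rewrite [X in X <= _]big_mkcond [X in _ <= X + _ + _]big_mkcond.
    rewrite [X in _ <= _ + X + _]big_mkcond [X in _ <= _ + X]big_mkcond /=.
    rewrite -!big_split /=; apply: leq_sum => z _; rewrite inL unfold_in /=.
    by case: (sadj v z); case: (z \in A); case: (z \in D).
  have sdeg : \sum_(v in L) deg v <= 2 * (\sum_(u in L) \sum_(v in L) adj_before u v) +
      \sum_(v in L) \sum_(B in F) #|Q v B| + l * #|A|.
    rewrite -sum_rel_deg -sum_nat_const -!big_split; apply: leq_sum => v vL /=.
    by rewrite -degD; exact: degL.
  have sQ : \sum_(v in L) \sum_(B in F) #|Q v B| <= l * #|F| * (h - m) + h * bad.
    rewrite /bad big_distrr /= -mulnA -sum_nat_const -big_split; apply: leq_sum => v _ /=.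
    rewrite big_distrr /= -sum_nat_const -big_split; apply: leq_sum => B _ /=.
    have Qh : #|Q v B| <= h by rewrite -[X in _ <= X]card_ord max_card.
    case: (ltnP (h - m)) => [_|le1] /=; last by rewrite muln0 addn0.
    by rewrite muln1; exact: leq_trans Qh (leq_addl _ _).
  have dl : l * (N * (h - m) * n + n) <= N * h * \sum_(v in L) deg v.
    by rewrite big_distrr /= -sum_nat_const; apply: leq_sum => v _; exact: degX.
  have e1 : l * l <= l * n by rewrite leq_mul2l ln orbT.
  have e2 := leq_mul (leqnn (N * h)) sdeg.
  have e3 := leq_mul (leqnn (N * h)) sQ.
  have e4 := leq_mul (leqnn l) smallA.
  have e5 := leq_mul (leqnn (N * l * (h - m))) Fn.
  move: sparse dl e1 e2 e3 e4 e5; clear.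
  move: (\sum_(u in L) _) (\sum_(v in L) \sum_(B in F) _) (\sum_(v in L) _) => s1 s2 s3.
  by move: (h - m) bad => k bd; lia.
have Fbig : n <= 2 * N * (h * h) * #|F|.
  rewrite -(leq_pmul2l l0); apply: (leq_trans badbig).
  rewrite [X in _ <= X]mulnCA leq_mul2l; apply/orP; right.
  rewrite /l -sum_nat_const; apply: leq_sum => v _.
  by rewrite -sum1_card; apply: leq_sum => B _; exact: leq_b1.
pose col (c : colT) v B := [&& Q v B == c.1, P v B == c.2 & h - m < #|c.1|].
have [c cbig] : exists c : colT, bad <= #|{:
  colT}| * \sum_(v in L) \sum_(B in F) col c v B.
  have [|c Hc] := @sum_leq_max colT (fun c => \sum_(v in L) \sum_(B in F) col c v B).
    by apply/card_gt0P; exists (set0, set0).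
  exists c; apply: leq_trans Hc; rewrite exchange_big; apply: leq_sum => v _ /=.
  rewrite exchange_big; apply: leq_sum => B _ /=.
  rewrite (bigD1 (Q v B, P v B)) //= /col /= !eqxx; exact: leq_addr.
have Ln2 : n2 <= #|L| by rewrite -/l; nia.
have Fn2 : n2 <= #|F| by nia.
have dens2 : #|L| * #|F| <= 2 * N * h * #|{:
  colT}| * \sum_(v in L) \sum_(B in F) col c v B.
  rewrite -/l -(leq_pmul2r h_gt0).
  have cb := leq_mul (leqnn (2 * N * (h * h))) cbig.
  have e1 := leq_mul (leqnn l) Fn.
  move: cb e1 badbig; clear.
  by move: (\sum_(v in L) _) #|{: colT}| bad => s1 s2 s3; lia.
have [S [T [SL TF cS cT colST]]] := kst2 _ _ L F (col c) Ln2 Fn2 dens2.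
have [s0 s0S] : exists s0, s0 \in S by apply/card_gt0P; rewrite cS muln_gt0 h_gt0.
have [B0 B0T] : exists B0, B0 \in T by apply/card_gt0P; rewrite cT muln_gt0 h_gt0.
have cQ : h - m < #|c.1| by have /and3P[_ _] := colST s0 B0 s0S B0T.
have [|T1 T1T cT1] := @exists_subset_card _ T (h - m).
  by rewrite cT; apply: leq_trans (leq_subr _ _) _; exact: leq_pmull.
have T1F B : B \in T1 -> B \in F by move=> /(subsetP T1T)/(subsetP TF).
pose Y q := [set u q B | B in T1].
have u_inj q q' B B' : B \in F -> B' \in F -> u q B = u q' B' -> B = B' /\ q = q'.
  move=> BF BF' uu; have EB : B = B'.
    apply: contraTeq (uB q B BF) => /(trivIsetP tF B B' BF BF') dBB.
    by rewrite uu; apply: contraL (uB q' B' BF') => /(disjointFr dBB) ->.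
  split=> //; apply: val_inj; move: uu; rewrite /u -EB => /eqP.
  by rewrite nth_uniq ?sB ?enum_uniq ?ltn_ord // => /eqP.
have cY q : #|Y q| = h - m.
  rewrite card_in_imset // => B B' /T1F BF /T1F BF' uu.
  by have [] := u_inj q q B B' BF BF' uu.
have inD B z : B \in F -> z \in B -> z \in D.
  by move=> BF zB; rewrite -coverF; apply/bigcupP; exists B.
have SY q : q \in c.1 -> biclique S (Y q) \/ biclique (Y q) S.
  move=> qc; case: (boolP (q \in c.2)) => qP; [left|right].
    move=> v z vS /imsetP[B BT ->].
    have /and3P[/eqP Qv /eqP Pv _] := colST v B vS (subsetP T1T _ BT).
    by move: qc qP; rewrite -Qv -Pv !inE /adj_before => -> ->.
  move=> z v /imsetP[B BT ->] vS.
  have /and3P[/eqP Qv /eqP Pv _] := colST v B vS (subsetP T1T _ BT).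
  move: qc qP; rewrite -Qv -Pv !inE /adj_before => av nlt; rewrite sadj_sym av andbT.
  have : v != u q B by apply: contraTneq av => ->; rewrite sadj_irr.
  by move=> /before_total; rewrite (negPf nlt).
have [|||||D1 [tD1 cD1 D1sub]] := @pack X _ (enum c.1) S Y bXa bXb.
- exact: enum_uniq.
- rewrite cS -cardE leq_mul2r; apply/orP; right.
  by rewrite -[X in _ <= X]card_ord max_card.
- by move=> q _; rewrite cY.
- by move=> q; rewrite mem_enum; exact: SY.
- move=> q q' _ _ qq'; rewrite -setI_eq0; apply/eqP/setP => z; rewrite !inE.
  apply/negP => /andP[/imsetP[B BT ->] /imsetP[B' BT' uu]].
  by have [_ E'] := u_inj _ _ _ _ (T1F _ BT) (T1F _ BT') uu; rewrite E' eqxx in qq'.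
have F1F : F :\: T1 \subset F by exact: subsetDl.
have tF1 : trivIset (F :\: T1) by exact: trivIsetS tF.
set D2 := cover (F :\: T1).
have D2D z : z \in D2 -> z \in D.
  by case/bigcupP=> B; rewrite inE => /andP[_ BF] zB; exact: inD zB.
have tD2 : tileable D2 by exists (F :\: T1); split=> // B; rewrite inE => /andP[_ /FT].
have D12 : [disjoint D1 & D2].
  rewrite -setI_eq0; apply/eqP/setP => z; rewrite in_setI in_set0; apply/negP.
  move=> /andP[/D1sub zD1 zD2]; case: zD1 => [/(subsetP SL)|[q _ /imsetP[B BT zu]]].
    by rewrite inL (D2D _ zD2) andbF.
  case/bigcupP: zD2 => B'; rewrite inE => /andP[nB' BF'] zB'.
  have BB' : B != B' by apply: contraNneq nB' => <-.
  have := disjointFr (trivIsetP tF B B' (T1F _ BT) BF' BB') (uB q _ (T1F _ BT)).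
  by rewrite -zu zB'.
have cD2 : #|D2| = (#|F| - (h - m)) * h.
  rewrite /D2 -(eqP tF1) (eq_bigr (fun=> h)); last first.
    by move=> B; rewrite inE => /andP[_ /FT /tile_card].
  by rewrite sum_nat_const cardsD (setIidPr _) ?cT1 //; apply/subsetP => B /T1F.
(* [h - m] tiles are broken up and [#|c.1|], a larger number, are gained. *)
apply: (max_contra (D1 :|: D2)).
- rewrite -setI_eq0; apply/eqP/setP => z; rewrite in_setI in_setU in_set0; apply/negP.
  move=> /andP[zA /orP[/D1sub|/D2D zD]]; last by have := disjointFr AD zA; rewrite zD.
  case=> [/(subsetP SL)|[q _ /imsetP[B BT zu]]]; first by rewrite inL zA.
  by have := disjointFr AD zA; rewrite zu (inD B) // ?uB // T1F.
- exact: tileableU.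
- have cT1F : h - m <= #|F| by rewrite -cT1; apply/subset_leq_card/subsetP => B /T1F.
  have := cardsUI D1 D2; rewrite (disjoint_setI0 D12) cards0 addn0 => ->.
  rewrite cD1 cD2 -FD -cardE -mulnDl ltn_pmul2r //.
  by rewrite -[X in X < _](subnKC cT1F) ltn_add2r.
Qed.

End AlmostTiling.

(** * Patterns with an isolated end vertex *)

Section FreeEnds.
Variables (h q a s : nat).
Hypotheses (q_gt0 : 0 < q) (qa : q < a) (ah : a < h) (s_bnd : 0 < s <= a).
Implicit Types X : tsystem h.

(* [first_free]: vertex 1 of the pattern is isolated. [last_fits]: the last
   vertex of the pattern has all its neighbours in the right part. *)
Definition first_free X := forall p (z : X) (P Y : {set X}),
  0 < p -> q <= p <= a -> #|P| = p.-1 -> #|Y| = h - p -> biclique P Y ->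
  (forall u, u \in P :|: Y -> before z u) -> tile (z |: (P :|: Y)).

Definition last_fits X := forall (x : X) (P Y : {set X}),
  #|P| = s.-1 -> #|Y| = h - s -> biclique P Y ->
  (forall v, v \in Y -> adj_before v x) -> tile (x |: (P :|: Y)).

Definition free_ends X :=
  [/\ forall p, q <= p <= a -> splits X p, first_free X & last_fits X].

(** One tile takes x with i vertices of [P] and j of [Y]; what is left is a biclique for
    [splits_tileable]. *)
Lemma tile_rest X (x : X) (P Y : {set X}) i j k :
  (forall p, q <= p <= a -> splits X p) -> biclique P Y -> x \notin P :|: Y ->
  (forall P1 Y1 : {set X}, P1 \subset P -> Y1 \subset Y -> #|P1| = i -> #|Y1| = j ->
     tile (x |: (P1 :|: Y1))) ->
  i <= #|P| -> j <= #|Y| -> k * q <= #|P| - i <= k * a ->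
  #|P| + #|Y| = i + j + k * h -> tileable (x |: (P :|: Y)).
Proof.
move=> bX PY xPY tX iP jY Pk PYk.
have [P1 P1P cP1] := exists_subset_card iP.
have [Y1 Y1Y cY1] := exists_subset_card jY.
have cP := cardsD P P1; have cY := cardsD Y Y1.
rewrite (setIidPr P1P) in cP; rewrite (setIidPr Y1Y) in cY.
have -> : x |: (P :|: Y) = (x |: (P1 :|: Y1)) :|: ((P :\: P1) :|: (Y :\: Y1)).
  apply/setP => z; rewrite !inE.
  have := subsetP P1P z; have := subsetP Y1Y z.
  by case: (z == x); case: (z \in P1); case: (z \in Y1); case: (z \in P);
    case: (z \in Y) => //=; (try by move=> _ /(_ isT)); move=> /(_ isT).
have dPY := biclique_disjoint PY.
apply: tileableU; last 2 first.
- exact/tile_tileable/tX.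
- apply: (@splits_tileable _ _ q a k) => //; first by lia.
  + by rewrite cP cP1.
  + by rewrite cP cY cP1 cY1; lia.
  + by move=> u v; rewrite !inE => /andP[_ uP] /andP[_ vY]; exact: PY.
rewrite -setI_eq0; apply/eqP/setP => z; rewrite !inE.
have : ~~ ((z \in P) && (z \in Y)).
  by apply/negP => /andP[zP zY]; move: (disjointFr dPY zP); rewrite zY.
have := subsetP P1P z; have := subsetP Y1Y z.
case: (z =P x) => [->|_].
  move: xPY; rewrite inE negb_or => /andP[/negPf -> /negPf ->].
  by rewrite !andbF.
by case: (z \in P1); case: (z \in Y1); case: (z \in P); case: (z \in Y) => //=;
    (try by move=> _ /(_ isT)); move=> /(_ isT).
Qed.

(* The sizes of the parts of bicliques that miss one vertex to be tiled by
   [h + 1] copies: they admit the missing vertex in the left part, in the right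
   part, as the first vertex or as the last vertex of a copy. *)
Definition lsize := s.-1 + h * a.
Definition rsize := h * (h - a) + (h - s).

Lemma lrsize : lsize + rsize = (h.+1 * h).-1.
Proof. by rewrite /lsize /rsize; nia. Qed.

(** * Completing a biclique by one vertex *)

Section Fill.
Variables (X : tsystem h) (x : X) (P Y : {set X}).
Hypotheses (fX : free_ends X) (cP : #|P| = lsize) (cY : #|Y| = rsize)
  (PY : biclique P Y) (xPY : x \notin P :|: Y).

Lemma fill_first : (forall u, u \in P :|: Y -> before x u) -> tileable (x |: (P :|: Y)).
Proof.
(* After the tile of x, s + (h - 1)a left vertices remain: at most ha as s <= a, and at least hq as
   q < a. *)
case: fX => bX ff _ xlt; apply: (@tile_rest _ _ _ _ a.-1 (h - a) h) => //.
- move=> P1 Y1 P1P Y1Y c1 c2; apply: (ff a) => //; try lia.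
    by move=> u v uP vY; apply: PY; [exact: (subsetP P1P) | exact: (subsetP Y1Y)].
  move=> u; rewrite inE => uPY; apply: xlt; rewrite inE.
  by case/orP: uPY => [/(subsetP P1P)|/(subsetP Y1Y)] ->; rewrite ?orbT.
- by rewrite cP /lsize; nia.
- by rewrite cY /rsize; nia.
- by rewrite cP /lsize; apply/andP; split; nia.
- by rewrite cP cY lrsize; nia.
Qed.

Lemma fill_last : (forall v, v \in Y -> adj_before v x) -> tileable (x |: (P :|: Y)).
Proof.
(* Exactly [h * a] left and [h * (h - a)] right vertices remain. *)
case: fX => bX _ lf xlt; apply: (@tile_rest _ _ _ _ s.-1 (h - s) h) => //.
- move=> P1 Y1 P1P Y1Y c1 c2; apply: lf => //.
    by move=> u v uP vY; apply: PY; [exact: (subsetP P1P) | exact: (subsetP Y1Y)].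
  by move=> v /(subsetP Y1Y); exact: xlt.
- by rewrite cP /lsize; nia.
- by rewrite cY /rsize; nia.
- by rewrite cP /lsize; apply/andP; split; nia.
- by rewrite cP cY lrsize; nia.
Qed.

Lemma fill_left : (forall v, v \in Y -> adj_before x v) -> tileable (x |: (P :|: Y)).
Proof.
case: fX => bX _ _ xlt; rewrite setUA.
have cxP : #|x |: P| = lsize.+1.
  by rewrite cardsU1 cP; move: xPY; rewrite inE negb_or => /andP[->].
apply: (@splits_tileable _ _ q a h.+1) => //; first by lia.
- by rewrite cxP /lsize; apply/andP; split; nia.
- by rewrite cxP cY addSn lrsize; nia.
- by move=> u v; rewrite !inE => /orP[/eqP -> /xlt|uP vY] //; exact: PY.
Qed.

Lemma fill_right : (forall u, u \in P -> adj_before u x) -> tileable (x |: (P :|: Y)).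
Proof.
case: fX => bX _ _ xlt; rewrite setUCA.
have cxY : #|x |: Y| = rsize.+1.
  by rewrite cardsU1 cY; move: xPY; rewrite inE negb_or => /andP[_ ->].
apply: (@splits_tileable _ _ q a h.+1) => //; first by lia.
- by rewrite cP /lsize; apply/andP; split; nia.
- by rewrite cP cxY addnS lrsize; nia.
- by move=> u v uP; rewrite !inE => /orP[/eqP ->|vY]; [exact: xlt | exact: PY].
Qed.

End Fill.

(** * Exchanges through the vertices near the beginning *)

Section Reach.
Variable N : nat.
Hypothesis N_gt0 : 0 < N.
Local Notation M := (8 * N).
Local Notation M' := (4 * M).

(** Few enough vertices to be removed from the dense sets below, yet a positive proportion of
    all. *)
Definition low X (z : X) := M' * pos z < #|X|.

Lemma low_upper X : M' <= #|X| -> 2 * M * #|[pred z : X | low z]| <= #|X|.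
Proof.
set n := #|X| => nbig; set t := n %/ M'.
have M'0 : 0 < M' by lia.
have tn : t * M' <= n by exact: leq_trunc_div.
have : #|[pred z : X | low z]| <= t.+1.
  rewrite -[X in _ <= X]subn0; apply: leq_trans (card_pos_between X 0 t.+1).
  apply: subset_leq_card; apply/subsetP => z; rewrite !inE /low -/n => lz.
  by rewrite /= ltnS /t leq_divRL // mulnC ltnW.
by move: #|_| => c; nia.
Qed.

Lemma low_lower X : M' <= #|X| -> #|X| <= 2 * M' * #|[pred z : X | low z]|.
Proof.
set n := #|X| => nbig; set t := n %/ M'.
have M'0 : 0 < M' by lia.
have nt : n < t.+1 * M' by rewrite -ltn_divLR.
have t0 : 0 < t by rewrite divn_gt0.
have tn : t <= n by exact: leq_div.
have : #|[predC [pred z : X | low z]]| <= n - t.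
  apply: leq_trans (card_pos_between X t n).
  apply: subset_leq_card; apply/subsetP => z; rewrite !inE /low -/n -leqNgt => lz.
  rewrite pos_lt andbT -(leq_pmul2l M'0); apply: leq_trans lz.
  by rewrite mulnC; exact: leq_trunc_div.
have := cardC [pred z : X | low z]; rewrite -/n.
by move: #|_| #|_| => c c'; nia.
Qed.

(** At most |X| / 2M vertices are low, so each w in [A] keeps at least half of |X| / M left
    neighbours. *)
Lemma dense_of_right X (A : X -> bool) : M' <= #|X| ->
  #|X| <= M * #|[pred w | A w]| -> (forall w, A w -> #|X| <= M * ldeg w) ->
  #|X| ^ 2 <= 2 * M * M * \sum_v #|[pred u | [&& adj_before u v, ~~ low u & A v]]|.
Proof.
set n := #|X| => nbig Abig Aw.
apply: (@leq_trans (M * \sum_(w | A w) n)).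
  by rewrite sum_nat_const mulnA -mulnn leq_mul2r Abig orbT.
rewrite [2 * M * M]mulnC -[X in _ <= X]mulnA leq_mul2l big_distrr /= big_mkcond.
apply/orP; right; apply: leq_sum => w _; case: (boolP (A w)) => // wA.
have le1 := Aw w wA; have low_c := low_upper nbig; rewrite -/n in low_c.
have : ldeg w <= #|[pred u | [&& adj_before u w, ~~ low u & true]]| + #|[pred z :
  X | low z]|.
  rewrite -cardUI; apply: leq_trans (leq_addr _ _).
  apply: subset_leq_card; apply/subsetP => u; rewrite !inE andbT => ->.
  by case: low.
by move: #|_| #|_| (ldeg w) le1 low_c => c c' d; nia.
Qed.

(** Here low vertices are removed from [A] itself, which keeps at least |X| / 2M members. *)
Lemma dense_of_left X (A : X -> bool) : M' <= #|X| ->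
  #|X| <= M * #|[pred w | A w]| -> (forall w, A w -> #|X| <= M * rdeg w) ->
  #|X| ^ 2 <= 2 * M * M * \sum_v #|[pred u | [&& adj_before u v, ~~ low u & A u]]|.
Proof.
set n := #|X| => nbig Abig Aw.
pose A' w := ~~ low w && A w.
have A'big : n <= 2 * M * #|[pred w | A' w]|.
  have low_c := low_upper nbig; rewrite -/n in low_c.
  have : #|[pred w | A w]| <= #|[pred w | A' w]| + #|[pred z : X | low z]|.
    rewrite -cardUI; apply: leq_trans (leq_addr _ _).
    by apply: subset_leq_card; apply/subsetP => u; rewrite !inE /A' => ->; case: low.
  by move: #|_| #|_| #|_| low_c Abig => c c' d; nia.
have -> : \sum_v #|[pred u | [&& adj_before u v,
  ~~ low u & A u]]| = \sum_(w | A' w) rdeg w.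
  rewrite [RHS]big_mkcond /rdeg.
  under eq_bigr => v _ do rewrite -sum1_card big_mkcond.
  rewrite exchange_big; apply: eq_bigr => u _ /=.
  transitivity (\sum_v (if A' u && adj_before u v then 1 else 0)).
    by apply: eq_bigr => v _; rewrite unfold_in /= /A' andbC.
  case: (A' u) => /=; last exact: big1.
  by rewrite -big_mkcond sum1_card.
apply: (@leq_trans (2 * M * \sum_(w | A' w) n)).
  by rewrite sum_nat_const mulnA -mulnn leq_mul2r A'big orbT.
rewrite -[X in _ <= X]mulnA leq_mul2l big_distrr /=; apply/orP; right.
by apply: leq_sum => w /andP[_ /Aw].
Qed.

(** A low z precedes every biclique without low vertices and completes it as a first vertex. It
    remains to find a dense family of such bicliques that x completes as well. *)
Lemma reach_low : exists C, forall X (x z : X), free_ends X ->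
  (forall v : X, #|X| <= N * deg v) -> low z -> reach (h.+1 * h).-1 C x z.
Proof.
set C0 := biclique_const (2 * M * M) lsize rsize; set K := (h.+1 * h).-1.
exists (2 * C0 + 4 * C0 * (K * K.+1) + M') => X x z fX degX lowz.
have [nbig|nM] := leqP M' #|X|; last first.
  by move=> /(leq_trans (leq_addl _ _)); rewrite leqNgt nM.
apply: reach_mono (leq_addr _ _) _.
have n0 := vert_gt0 x.
have lsize0 : 0 < lsize by rewrite /lsize; nia.
have rsize0 : 0 < rsize by rewrite /rsize; nia.
(* [phi] records how the edges of the biclique are tied to x; the completion by z is the same in all
   cases. *)
have done_by (phi : X -> X -> bool) :
    #|X| ^ 2 <= 2 * M * M * \sum_v #|[pred u | [&& adj_before u v,
      ~~ low u & phi u v]]| ->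
    (forall (P Y : {set X}), #|P| = lsize -> #|Y| = rsize -> biclique P Y ->
       x \notin P :|: Y ->
       (forall u, u \in P -> exists2 v, v \in Y & phi u v) ->
       (forall v, v \in Y -> exists2 u, u \in P & phi u v) ->
       tileable (x |: (P :|: Y))) ->
    reach K (2 * C0 + 4 * C0 * (K * K.+1)) x z.
  move=> dense fill.
  pose r u v := [&& adj_before u v, ~~ low u & phi u v].
  have := @biclist_count X _ lsize rsize r predT n0 (fun _ _ _ => isT) dense.
  rewrite lrsize -/K -/C0 => cnt.
  apply: (@reach_dense _ _ _ _ _ _ (biclist lsize r predT)) cnt => t tK ux uz bt.
  have ut : uniq t by case/andP: ux.
  pose P := [set y in take lsize t]; pose Y := [set y in drop lsize t].
  have rPY u v : u \in P -> v \in Y -> r u v.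
    by rewrite !inE; case/andP: bt => /allrelP tr _; exact: tr.
  have PY : biclique P Y by move=> u v uP /(rPY u v uP) /and3P[].
  have cP : #|P| = lsize.
    rewrite card_seq ?take_uniq // size_take tK; case: ltngtP => //.
    by rewrite /K -lrsize; lia.
  have cY : #|Y| = rsize by rewrite card_seq ?drop_uniq // size_drop tK /K -lrsize addKn.
  have [u0 u0P] : exists u, u \in P by apply/card_gt0P; rewrite cP.
  have [v0 v0Y] : exists v, v \in Y by apply/card_gt0P; rewrite cY.
  have EPY w : w \in P :|: Y = (w \in t) by rewrite -set_take_drop inE.
  have set_cons w : [set y in w :: t] = w |: (P :|: Y).
    by apply/setP => y; rewrite in_setU1 EPY !inE.
  rewrite !set_cons; split.
    apply: fill => //; first by rewrite EPY; case/andP: ux.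
      by move=> u uP; exists v0 => //; case/and3P: (rPY u v0 uP v0Y).
    by move=> v vY; exists u0 => //; case/and3P: (rPY u0 v u0P vY).
  apply: fill_first => //; first by rewrite EPY; case/andP: uz.
  have zP u : u \in P -> before z u.
    move=> uP; have /and3P[_ lu _] := rPY u v0 uP v0Y.
    move: lowz lu; rewrite /low /before -leqNgt => l1 l2; have := leq_trans l1 l2.
    by rewrite ltn_pmul2l //; lia.
  move=> u; rewrite inE => /orP[/zP //|uY].
  have /and3P[/andP[l1 _] _ _] := rPY u0 u u0P uY.
  by have := zP u0 u0P; rewrite /before in l1 *; move=> l2; exact: ltn_trans l2 l1.
(* If [P1] is large, x joins the left part; if [P2], the right part. Members of [P3] have many right
   neighbours and form left parts after x; members of [P4] have many left neighbours and form right
   parts whose vertices all precede x and are adjacent to it. *)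
pose P1 w := adj_before x w && (#|X| <= M * ldeg w).
pose P2 w := adj_before w x && (#|X| <= M * rdeg w).
pose P3 w := adj_before x w && (M * ldeg w < #|X|).
pose P4 w := adj_before w x && (M * rdeg w < #|X|).
have tot : deg x <= \sum_(Q <- [:: P1; P2; P3; P4]) #|[pred z | Q z]|.
  apply: card_cover_seq => w xw.
  have : x != w by apply: contraTneq xw => ->; rewrite sadj_irr.
  case/before_total/orP=> lw;
    rewrite /= /P1 /P2 /P3 /P4 /adj_before lw ?(sadj_sym w) xw /=.
    by rewrite leqNgt; case: (M * ldeg w < _); rewrite //= ?orbT.
  by rewrite [#|X| <= M * rdeg w]leqNgt; case: (M * rdeg w < _); rewrite //= ?orbT.
rewrite !big_cons big_nil addn0 in tot.
have degx := degX x.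
have [P1big|P1small] := leqP #|X| (M * #|[pred w | P1 w]|).
  apply: (done_by (fun _ v => P1 v)).
    by apply: dense_of_right => // w /andP[].
  move=> P Y cP cY PY xPY _ fY; apply: fill_left => // v /fY[_ _ /andP[]] //.
have [P2big|P2small] := leqP #|X| (M * #|[pred w | P2 w]|).
  apply: (done_by (fun u _ => P2 u)).
    by apply: dense_of_left => // w /andP[].
  move=> P Y cP cY PY xPY fP _; apply: fill_right => // u /fP[_ _ /andP[]] //.
have [P3big|P3small] := leqP #|X| (M * #|[pred w | P3 w]|).
  apply: (done_by (fun u _ => P3 u)).
    apply: dense_of_left => // w /andP[_ lw].
    by have := degX w; rewrite (deg_split w); nia.
  move=> P Y cP cY PY xPY fP _; apply: fill_first => // u.
  rewrite inE => /orP[/fP[_ _ /andP[/andP[]]] //|uY].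
  have [u0 u0P] : exists u, u \in P by apply/card_gt0P; rewrite cP.
  have [_ _ /andP[/andP[l1 _] _]] := fP u0 u0P; have /andP[l2 _] := PY u0 u u0P uY.
  by rewrite /before in l1 l2 *; exact: ltn_trans l1 l2.
have P4big : #|X| <= M * #|[pred w | P4 w]| by nia.
apply: (done_by (fun _ v => P4 v)).
  apply: dense_of_right => // w /andP[_ lw].
  by have := degX w; rewrite (deg_split w); nia.
by move=> P Y cP cY PY xPY _ fY; apply: fill_last => // v /fY[_ _ /andP[]].
Qed.

Lemma free_ends_reach : exists C, forall X, free_ends X ->
  (forall v : X, #|X| <= N * deg v) ->
  forall x y : X, reach ((h.+1 * h).-1 + (h.+1 * h).-1.+1) C x y.
Proof.
have [C HC] := reach_low.
have [C' HC'] := reach_chain h (h.+1 * h).-1 (h.+1 * h).-1 C (2 * M').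
exists (C' + M') => X fX degX x y.
have [nbig|nM] := leqP M' #|X|; last first.
  by move=> /(leq_trans (leq_addl _ _)); rewrite leqNgt nM.
apply: reach_mono (leq_addr _ _) _; apply: (HC' X x y [set z | low z]).
- by move=> z; rewrite inE => lz; exact: HC.
- by move=> z; rewrite inE => lz; apply: reach_sym; exact: HC.
- by rewrite cardsE; exact: low_lower.
Qed.

End Reach.
End FreeEnds.

(** * Tilings by copies of an ordered graph *)

(** The absorbing set is reserved first. An almost perfect tiling of the rest leaves few vertices,
    in number divisible by h, and these are absorbed. *)
Lemma tileable_all h a b m N k C : 0 < h -> 0 < N -> m <= a <= h -> m <= b <= h ->
  exists n0, forall X : tsystem h, n0 <= #|X| -> h %| #|X| ->
  splits X a -> splits X (h - b) ->
  (forall v : X, N * (h - m) * #|X| + #|X| <= N * h * deg v) ->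
  (forall x y : X, reach k C x y) -> tileable [set: X].
Proof.
move=> h0 N0 /andP[ma ah] /andP[mb bh].
have [Ct HCt] := tile_dense (2 * (N * h)) ah.
have [|D [n1 [D0 HD]]] := absorbing_set h0 k C Ct (_ : 0 < 4 * N * h).
  by rewrite !muln_gt0 N0.
have [n2 H2] := almost_tiling h0 ma mb ah bh N0 D0.
exists (Ct + n1 + n2) => X Xbig hX bXa bXb degX R.
have dense : #|X| ^ 2 <= 2 * (N * h) * \sum_(v : X) ldeg v.
  rewrite [2 * _]mulnC -mulnA mul2n -addnn {2}sum_ldeg -big_split /=.
  rewrite -mulnn -[X in X * _]/(#|X|) -sum_nat_const big_distrr; apply: leq_sum => v _ /=.
  by rewrite -deg_split; apply: leq_trans (degX v); exact: leq_addl.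
have [|||A [tA Asmall absA]] := HD X => //; first by lia.
  by apply: HCt => //; lia.
have [||D1 [AD1 tD1 D1big]] := H2 X _ bXa bXb degX A => //; first by lia.
set L := ~: (A :|: D1) in D1big.
have AL : [disjoint A & L].
  by rewrite -setI_eq0; apply/eqP/setP => z; rewrite !inE; case: (z \in A).
have D1L : [disjoint L :|: A & D1].
  rewrite -setI_eq0; apply/eqP/setP => z; rewrite !inE.
  have := disjointFr AD1 (x := z); case: (z \in A); case: (z \in D1) => //.
  by move=> /(_ isT).
have hL : h %| #|L|.
  have := cardsC (A :|: D1); have := cardsUI A D1.
  rewrite (disjoint_setI0 AD1) cards0 addn0 => -> E.
  rewrite -(dvdn_addr _ (_ : h %| #|A| + #|D1|)) ?E //.
  by apply: dvdn_add; exact: tileable_card.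
have -> : [set: X] = (L :|: A) :|: D1.
  by apply/setP => z; rewrite !inE; case: (z \in A); case: (z \in D1).
by apply: tileableU => //; exact: absA.
Qed.

(** * The system of copies of [H] in [G] *)

Section Concrete.
Variables (h n : nat) (H : ograph h) (G : ograph n).

Definition tile_of (A : {set 'I_n}) : bool :=
  `[< exists phi, is_copy H G phi /\ A = [set phi i | i : 'I_h] >].

Lemma copy_inj (phi : {ffun 'I_h -> 'I_n}) : is_copy H G phi -> injective phi.
Proof.
move=> [phi_lt _] i j E; apply: val_inj.
by case: (ltngtP i j) => // /phi_lt; rewrite E ltnn.
Qed.

Lemma tile_of_card A : tile_of A -> #|A| = h.
Proof.
by move=> /asboolP[phi [cphi ->]]; rewrite card_imset ?card_ord //; exact: copy_inj.
Qed.

Lemma ord_lt_card (v : 'I_n) : v < #|'I_n|.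
Proof. by rewrite card_ord. Qed.

Definition copy_system : tsystem h :=
  TSystem (@ord_inj n) ord_lt_card (@edge_sym n G) (@edge_irrefl n G) tile_of_card.

Lemma tileable_perfect : tileable (X := copy_system) [set: 'I_n] ->
  exists T, is_perfect_tiling H G T.
Proof.
move=> [F [tF covF FT]].
pose ch B := [pick phi : {ffun 'I_h -> 'I_n} |
  `[< is_copy H G phi /\ B = [set phi i | i : 'I_h] >]].
have chP B phi : ch B = Some phi -> is_copy H G phi /\ B = [set phi i | i : 'I_h].
  by rewrite /ch; case: pickP => // psi /asboolP Hpsi [<-].
have chE B : B \in F -> exists phi, ch B = Some phi.
  move=> /FT /asboolP[phi Hphi]; rewrite /ch; case: pickP => [psi _|/(_ phi)].
    by exists psi.
  by move/asboolP.
have codomP B phi : ch B = Some phi -> codom phi =i B.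
  move=> /chP[_ ->] v; apply/codomP/imsetP => [[i ->]|[i _ ->]]; first by exists i.
  by exists i.
exists [set phi | [exists B in F, ch B == Some phi]]; split; first split.
- by move=> phi; rewrite inE => /existsP[B /andP[_ /eqP /chP[]]].
- move=> phi psi; rewrite !inE => /existsP[B /andP[BF /eqP EB]].
  move=> /existsP[B' /andP[BF' /eqP EB']] neq.
  have BB' : B != B'.
    by apply: contraNneq neq => E; move: EB'; rewrite -E EB => -[->].
  rewrite (eq_disjoint (codomP _ _ EB)) (eq_disjoint_r (codomP _ _ EB')).
  exact: (trivIsetP tF).
- move=> v; have : v \in cover F by rewrite covF inE.
  case/bigcupP=> B BF vB; have [phi E] := chE B BF.
  exists phi; last by rewrite (codomP _ _ E).
  by rewrite inE; apply/existsP; exists B; rewrite BF E eqxx.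
Qed.

Lemma increasing_enum (A : {set 'I_n}) : #|A| = h ->
  exists f : {ffun 'I_h -> 'I_n}, (forall i j : 'I_h, i < j -> f i < f j) /\
    A = [set f i | i : 'I_h].
Proof.
move=> cA; exists [ffun i => enum_val (cast_ord (esym cA) i)]; split; last first.
  apply/setP => v; apply/idP/imsetP => [vA|[i _ ->]]; last by rewrite ffunE;
    exact: enum_valP.
  exists (cast_ord cA (enum_rank_in vA v)) => //.
  by rewrite ffunE cast_ordK enum_rankK_in.
move=> i j ij; rewrite !ffunE.
have v0 : 'I_n := enum_val (cast_ord (esym cA) i).
rewrite !(enum_val_nth v0) /=.
have srt : sorted (relpre val ltn) (enum A).
  rewrite /enum_mem -enumT; apply: sorted_filter.
    by move=> x y z; exact: ltn_trans.
  by rewrite -sorted_map val_enum_ord iota_ltn_sorted.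
have szA : size (enum A) = h by rewrite -cardE.
by apply: (sorted_ltn_nth _ v0 srt); rewrite ?inE ?szA // => x y z; exact: ltn_trans.
Qed.

Definition block (B0 B1 B2 : {set 'I_n}) (i : nat) : {set 'I_n} :=
  if i < #|B0| then B0 else if i < #|B0| + #|B1| then B1 else B2.

(** The copy is the increasing enumeration f of the union; counting the vertices below [f i] shows
    that [f i] lies in the block of i. *)
Lemma tile_blocks (B0 B1 B2 : {set 'I_n}) :
  (forall u v, u \in B0 -> v \in B1 -> u < v) ->
  (forall u v, u \in B0 -> v \in B2 -> u < v) ->
  (forall u v, u \in B1 -> v \in B2 -> u < v) ->
  #|B0| + #|B1| + #|B2| = h ->
  (forall (i j : 'I_h) (u v : 'I_n), H i j -> i < j -> u < v ->
     u \in block B0 B1 B2 i -> v \in block B0 B1 B2 j -> G u v) ->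
  tile_of (B0 :|: B1 :|: B2).
Proof.
move=> l01 l02 l12 cB adjB.
have [A defA] : exists A, A = B0 :|: B1 :|: B2 by eexists.
rewrite -defA.
have dis (C C' : {set 'I_n}) : (forall u v, u \in C -> v \in C' -> u < v) -> C :&:
  C' = set0.
  move=> CC'; apply/setP => z; rewrite !inE; apply/negP => /andP[zC zC'].
  by have := CC' _ _ zC zC'; rewrite ltnn.
have cA : #|A| = h.
  rewrite defA cardsU cardsU setIUl (dis _ _ l01) (dis _ _ l02) (dis _ _ l12) setU0
    !cards0.
  by rewrite !subn0.
have [f [f_lt AE]] := increasing_enum cA.
have fA i : f i \in A by rewrite AE imset_f.
have rank (i : 'I_h) : #|[set v in A | v < f i]| = i.
  have -> : [set v in A | v < f i] = f @: [set j : 'I_h | j < i].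
    apply/setP => v; rewrite !inE; apply/andP/imsetP => [[]|[j]].
      rewrite {1}AE => /imsetP[j _ ->] lt_ji; exists j => //; rewrite inE.
      by move: lt_ji; case: (ltngtP i j) => // [/f_lt|/val_inj ->]; lia.
    by rewrite inE => ji ->; split; [exact: fA | exact: f_lt].
  rewrite card_imset; last first.
    move=> j j' E; apply: val_inj.
    by case: (ltngtP j j') => // /f_lt; rewrite E ltnn.
  by rewrite cardsE card_ord_lt // ltnW.
have sub_rank (C : {set 'I_n}) (i : 'I_h) :
  (forall v, v \in C -> v \in A /\ v < f i) -> #|C| <= i.
  move=> Ci; rewrite -(rank i); apply: subset_leq_card; apply/subsetP => v vC.
  by rewrite inE; apply/andP; exact: Ci.
have rank_sub (C : {set 'I_n}) (i : 'I_h) : (forall v, v \in A -> v < f i -> v \in C) ->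
    f i \in C -> i < #|C|.
  move=> Ci fC; rewrite (cardsD1 (f i)) fC -[X in X < _](rank i) ltnS subset_leq_card //.
  apply/subsetP => v; rewrite !inE => /andP[vA vi]; rewrite Ci // andbT.
  by apply: contraTneq vi => ->; rewrite ltnn.
have inA v : v \in A = [|| v \in B0, v \in B1 | v \in B2] by rewrite defA !inE orbA.
have c01 : #|B0 :|: B1| = #|B0| + #|B1| by rewrite cardsU (dis _ _ l01) cards0 subn0.
have blk i : f i \in block B0 B1 B2 i.
  have := fA i; rewrite /block inA => /or3P[f0|f1|f2].
  - rewrite rank_sub // => v; rewrite inA => /or3P[//|v1|v2] lt_v.
      by have := l01 _ _ f0 v1; rewrite ltnNge ltnW.
    by have := l02 _ _ f0 v2; rewrite ltnNge ltnW.
  - rewrite ltnNge sub_rank /=; last first.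
      by move=> v v0; rewrite inA v0; split => //; exact: l01.
    rewrite -c01 rank_sub ?inE ?f1 ?orbT // => v; rewrite inA inE.
    move=> /or3P[->|->|v2] // lt_v; rewrite ?orbT //.
    by have := l12 _ _ f1 v2; rewrite ltnNge ltnW.
  - have le1 : #|B0 :|: B1| <= i.
      apply: sub_rank => v; rewrite inE inA => /orP[v0|v1]; rewrite ?v0 ?v1 ?orbT.
        by split=> //; exact: l02.
      by split=> //; exact: l12.
    rewrite c01 in le1; rewrite ltnNge (leq_trans (leq_addr _ _) le1) /=.
    by rewrite ltnNge le1.
apply/asboolP; exists f; split=> //; split=> // i j Hij.
case: (ltngtP i j) => [ij|ji|/val_inj E].
- by apply: (adjB i j) => //; exact: f_lt.
- rewrite edge_sym; apply: (adjB j i) => //; [by rewrite edge_sym | exact: f_lt].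
- by move: Hij; rewrite E edge_irrefl.
Qed.

(* Forces the cardinal of a set of vertices of [copy_system] to be read in ['I_n]. *)
Definition card_ord_set (A : {set 'I_n}) := #|A|.

Section Splits.
Variables q a : nat.
Hypotheses (qa : q <= a) (ah : a <= h).
Hypotheses (leftH : forall i j : 'I_h, H i j -> i < j -> a <= j)
  (rightH : forall i j : 'I_h, H i j -> i < j -> i < q).

(** An edge i < j of [H] has i < q <= p <= a <= j, so it runs between the two parts. *)
Lemma copy_system_splits p : q <= p <= a -> splits copy_system p.
Proof.
move=> qpa P Y cP cY PY.
have {}cP : card_ord_set P = p := cP; have {}cY : card_ord_set Y = h - p := cY.
rewrite /card_ord_set in cP cY.
rewrite -[_ :|: _]setU0; apply: tile_blocks.
- by move=> u v uP vY; have /andP[] := PY u v uP vY.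
- by move=> u v _; rewrite inE.
- by move=> u v _; rewrite inE.
- by rewrite cP cY cards0; lia.
move=> i j u v Hij ij uv; have := leftH Hij ij; have := rightH Hij ij.
rewrite /block cP cY => iq aj; have jh := ltn_ord j.
have -> : i < p by lia.
have -> : j < p = false by lia.
have -> : j < p + (h - p) by lia.
by move=> uP vY; have /andP[] := PY u v uP vY.
Qed.

Lemma copy_system_first_free : (forall i j : 'I_h, H i j -> i < j -> 0 < i) ->
  first_free q a copy_system.
Proof.
move=> iso p z P Y p0 qpa cP cY PY zlt.
have {}cP : card_ord_set P = p.-1 := cP; have {}cY : card_ord_set Y = h - p := cY.
rewrite /card_ord_set in cP cY.
rewrite setUA; apply: tile_blocks.
- by move=> u v; rewrite inE => /eqP-> vP; apply: zlt; rewrite inE vP.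
- by move=> u v; rewrite inE => /eqP-> vY; apply: zlt; rewrite inE vY orbT.
- by move=> u v uP vY; have /andP[] := PY u v uP vY.
- by rewrite cards1 cP cY; lia.
move=> i j u v Hij ij uv; have := leftH Hij ij; have := rightH Hij ij.
have := iso _ _ Hij ij; rewrite /block cP cards1 => i0 iq aj.
have -> : i < 1 = false by lia.
have -> : i < 1 + p.-1 by lia.
have -> : j < 1 = false by lia.
have -> : j < 1 + p.-1 = false by lia.
by move=> uP vY; have /andP[] := PY u v uP vY.
Qed.

(** Reversal turns left sizes p into h - p, so the range from q to a becomes [h - a] to [h - q], and
    the free vertex is the last one. *)
Lemma mirror_first_free : (forall i j : 'I_h, H i j -> i < j -> j.+1 < h) ->
  first_free (h - a) (h - q) (mirror copy_system).
Proof.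
move=> iso p z P Y p0 qpa cP cY PY zlt.
have {}cP : card_ord_set P = p.-1 := cP; have {}cY : card_ord_set Y = h - p := cY.
rewrite /card_ord_set in cP cY.
rewrite setUC [P :|: Y]setUC; apply: tile_blocks.
- move=> u v uY vP; have := PY v u vP uY.
  by rewrite (@mirror_adj_before h copy_system) => /andP[].
- move=> u v uY; rewrite inE => /eqP->.
  by have := zlt u; rewrite (@mirror_before h copy_system); apply; rewrite inE uY orbT.
- move=> u v uP; rewrite inE => /eqP->.
  by have := zlt u; rewrite (@mirror_before h copy_system); apply; rewrite inE uP.
- by rewrite cards1 cP cY; lia.
move=> i j u v Hij ij uv; have := leftH Hij ij; have := rightH Hij ij.
have := iso _ _ Hij ij; rewrite /block cP cY => jh iq aj.
have -> : i < h - p by lia.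
have -> : j < h - p = false by lia.
have -> : j < h - p + p.-1 by lia.
move=> uY vP; have := PY v u vP uY.
by rewrite (@mirror_adj_before h copy_system) => /andP[].
Qed.

End Splits.

(** Blocks of sizes s - 1, h - s and 1: every edge joins the middle block either to the first block
    or to the last vertex. *)
Lemma copy_system_last_fits s : 0 < s < h ->
  (forall i j : 'I_h, H i j -> i < j ->
     [/\ i < s.-1, s.-1 <= j & j.+1 < h] \/ (s.-1 <= i /\ j.+1 = h)) ->
  last_fits s copy_system.
Proof.
move=> sh edges x P Y cP cY PY xY.
have {}cP : card_ord_set P = s.-1 := cP; have {}cY : card_ord_set Y = h - s := cY.
rewrite /card_ord_set in cP cY.
have [y yY] : exists y, y \in Y by apply/card_gt0P; rewrite cY; lia.
rewrite setUC; apply: tile_blocks.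
- by move=> u v uP vY; have /andP[] := PY u v uP vY.
- move=> u v uP; rewrite inE => /eqP->.
  have /andP[l1 _] := PY u y uP yY; have /andP[l2 _] := xY y yY.
  exact: ltn_trans l1 l2.
- by move=> u v uY; rewrite inE => /eqP->; have /andP[] := xY u uY.
- by rewrite cards1 cP cY; lia.
move=> i j u v Hij ij uv; rewrite /block cP cY;
  case: (edges _ _ Hij ij) => [[i1 j1 j2]|[i1 j1]].
  have -> : i < s.-1 by [].
  have -> : j < s.-1 = false by lia.
  have -> : j < s.-1 + (h - s) by lia.
  by move=> uP vY; have /andP[] := PY u v uP vY.
have -> : i < s.-1 = false by lia.
have -> : i < s.-1 + (h - s) by lia.
have -> : j < s.-1 = false by lia.
have -> : j < s.-1 + (h - s) = false by lia.
by rewrite inE => uY /eqP ->; have /andP[] := xY u uY.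
Qed.

Lemma mirror_last_fits s : 0 < s < h ->
  (forall i j : 'I_h, H i j -> i < j ->
     (i = 0 :> nat /\ j <= h - s) \/ [/\ 0 < i, i <= h - s & h - s < j]) ->
  last_fits s (mirror copy_system).
Proof.
move=> sh edges x P Y cP cY PY xY.
have {}cP : card_ord_set P = s.-1 := cP; have {}cY : card_ord_set Y = h - s := cY.
rewrite /card_ord_set in cP cY.
have [y yY] : exists y, y \in Y by apply/card_gt0P; rewrite cY; lia.
rewrite [P :|: Y]setUC setUA; apply: tile_blocks.
- move=> u v; rewrite inE => /eqP-> vY; have := xY v vY.
  by rewrite (@mirror_adj_before h copy_system) => /andP[].
- move=> u v; rewrite inE => /eqP-> vP.
  have := PY v y vP yY; have := xY y yY.
  rewrite !(@mirror_adj_before h copy_system) => /andP[l1 _] /andP[l2 _];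
    exact: ltn_trans l1 l2.
- move=> u v uY vP; have := PY v u vP uY.
  by rewrite (@mirror_adj_before h copy_system) => /andP[].
- by rewrite cards1 cP cY; lia.
move=> i j u v Hij ij uv; rewrite /block cY cards1.
case: (edges _ _ Hij ij) => [[i1 j1]|[i0 i1 j1]].
  have -> : i < 1 by lia.
  have -> : j < 1 = false by lia.
  have -> : j < 1 + (h - s) by lia.
  rewrite inE => /eqP -> vY; have := xY v vY.
  by rewrite (@mirror_adj_before h copy_system) => /andP[].
have -> : i < 1 = false by lia.
have -> : i < 1 + (h - s) by lia.
have -> : j < 1 = false by lia.
have -> : j < 1 + (h - s) = false by lia.
move=> uY vP; have := PY v u vP uY.
by rewrite (@mirror_adj_before h copy_system) => /andP[].
Qed.

End Concrete.

(** * Structure of the pattern *)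

Lemma bigminn_le (I : eqType) (r : seq I) (P : pred I) (F : I -> nat) d j :
  j \in r -> P j -> \big[minn/d]_(i <- r | P i) F i <= F j.
Proof.
elim: r => // i r IHr; rewrite inE big_cons => /orP[/eqP <-|jr] Pj.
  by rewrite Pj geq_minl.
by case: (P i); rewrite ?IHr //; apply: leq_trans (geq_minr _ _) (IHr jr Pj).
Qed.

Lemma bigminn_le_id (I : Type) (r : seq I) (P : pred I) (F : I -> nat) d :
  \big[minn/d]_(i <- r | P i) F i <= d.
Proof.
elim: r => [|i r IHr]; rewrite ?big_nil // big_cons; case: (P i) => //.
exact: leq_trans (geq_minr _ _) IHr.
Qed.

Section Pattern.
Variables (h : nat) (H : ograph h).

Lemma indepP a b : reflect (forall i j :
  'I_h, a <= i.+1 <= b -> a <= j.+1 <= b -> ~~ H i j)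
  (indep_interval H a b).
Proof.
rewrite /indep_interval /has_edge_in /label_in /label.
apply: (iffP idP) => [nex i j ia ja|ind].
  apply: contra nex => Hij; apply/existsP; exists i; apply/existsP; exists j.
  by rewrite ia ja.
apply/negP => /existsP[i /existsP[j /and3P[ia ja Hij]]].
by have := ind i j ia ja; rewrite Hij.
Qed.

Lemma indep_sub a b a' b' : a <= a' -> b' <= b ->
  indep_interval H a b -> indep_interval H a' b'.
Proof. by move=> aa bb /indepP ind; apply/indepP => i j ia ja; apply: ind; lia. Qed.

(* In 1-based labels, [1, a1] and [b1 + 1, h] are the extremal independent
   intervals. *)
Definition a1 := alpha_plus H 1.
Definition b1 := (alpha_minus H 1).-1.

Lemma a1_indep : indep_interval H 1 a1.
Proof.
rewrite /a1 /=; apply: (big_ind (indep_interval H 1)) => // [|x y].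
  by apply/indepP => i j; lia.
by rewrite /maxn; case: ltnP.
Qed.

Lemma leq_a1 k : k <= h -> indep_interval H 1 k -> k <= a1.
Proof.
move=> kh ind; rewrite /a1 /=.
by apply: (bigmaxn_sup_seq k) => //; rewrite mem_index_iota.
Qed.

Lemma alpha_minus1_indep : indep_interval H (alpha_minus H 1) h.
Proof.
rewrite /=; apply: (big_ind (fun x => indep_interval H x h)) => // [|x y].
  by apply/indepP => i j; lia.
by rewrite /minn; case: ltnP.
Qed.

Lemma alpha_minus1_gt0 : 0 < alpha_minus H 1.
Proof.
rewrite /= big_seq_cond; apply: (big_ind (fun x => 0 < x)) => // [x y x0 y0|k].
  by rewrite leq_min x0.
by rewrite mem_index_iota => /andP[/andP[]].
Qed.

Lemma b1_indep : indep_interval H b1.+1 h.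
Proof. by rewrite /b1 prednK ?alpha_minus1_gt0 //; exact: alpha_minus1_indep. Qed.

Lemma b1_leq k : k <= h -> indep_interval H k.+1 h -> b1 <= k.
Proof.
move=> kh ind; rewrite /b1 -ltnS prednK ?alpha_minus1_gt0 //=.
by apply: (@bigminn_le _ _ _ id) => //; rewrite mem_index_iota; lia.
Qed.

Lemma left_edge (i j : 'I_h) : H i j -> i < j -> a1 <= j.
Proof.
move=> Hij ij; rewrite leqNgt; apply/negP => ja.
by have := indepP _ _ a1_indep i j; rewrite Hij => N; apply: (negP (N _ _)); lia.
Qed.

Lemma right_edge (i j : 'I_h) : H i j -> i < j -> i < b1.
Proof.
move=> Hij ij; rewrite ltnNge; apply/negP => qi.
have := indepP _ _ b1_indep i j; rewrite Hij => N; have jh := ltn_ord j.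
by apply: (negP (N _ _)); lia.
Qed.

Lemma adjP (x y : nat) : reflect (exists i j :
  'I_h, [/\ i.+1 = x, j.+1 = y & H i j]) (adj H x y).
Proof.
rewrite /adj /label; apply:
  (iffP existsP) => [[i /existsP[j /and3P[/eqP ix /eqP jy Hij]]]|].
  by exists i, j.
by move=> [i [j [ix jy Hij]]]; exists i; apply/existsP; exists j; rewrite ix jy !eqxx.
Qed.

Lemma edge_neq (i j : 'I_h) : H i j -> i != j :> nat.
Proof. by move=> Hij; apply: contraTneq Hij => /val_inj ->; rewrite edge_irrefl. Qed.

Definition first_isolated := forall i j : 'I_h, H i j -> i < j -> 0 < i.
Definition last_isolated := forall i j : 'I_h, H i j -> i < j -> j.+1 < h.

Lemma isolated_first : Defs.isolated H 1 -> first_isolated.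
Proof.
move=> iso i j Hij ij; rewrite lt0n; apply/negP => /eqP i0.
by case/adjP: (iso j.+1); exists i, j; rewrite i0.
Qed.

Lemma isolated_last : Defs.isolated H h -> last_isolated.
Proof.
move=> iso i j Hij ij; have := ltn_ord j; rewrite leq_eqVlt => /orP[/eqP jh|//].
by case/adjP: (iso i.+1); exists j, i; rewrite edge_sym.
Qed.

Lemma s_vertex_leq x : adj H h x -> s_vertex H <= x.
Proof.
move=> ax; apply: (@bigminn_le _ _ _ id) => //; rewrite mem_index_iota.
by case/adjP: ax => i [j [_ <- _]]; have := ltn_ord j; lia.
Qed.

Lemma s_vertex_adj : ~ Defs.isolated H h -> adj H h (s_vertex H).
Proof.
have [//|sh] : adj H h (s_vertex H) \/ s_vertex H = h.
  rewrite /s_vertex; apply: (big_ind (fun x => adj H h x \/ x = h)); first by right.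
    by move=> x y Hx Hy; rewrite /minn; case: ltnP.
  by left.
move=> niso; exfalso; apply: niso => b; apply/negP => ab.
have := s_vertex_leq ab; rewrite sh.
case/adjP: ab => i [j [ih jb Hij]]; have := edge_neq Hij; have := ltn_ord j.
by lia.
Qed.

Lemma l_vertex_geq x : adj H 1 x -> x <= l_vertex H.
Proof.
move=> ax; apply: (bigmaxn_sup_seq x) => //; rewrite mem_index_iota.
by case/adjP: ax => i [j [_ <- _]]; have := ltn_ord j; lia.
Qed.

Lemma l_vertex_adj : ~ Defs.isolated H 1 -> adj H 1 (l_vertex H).
Proof.
have [//|l0] : adj H 1 (l_vertex H) \/ l_vertex H = 0.
  rewrite /l_vertex; apply: (big_ind (fun x => adj H 1 x \/ x = 0)); first by right.
    by move=> x y Hx Hy; rewrite /maxn; case: ltnP.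
  by left.
move=> niso; exfalso; apply: niso => b; apply/negP => ab.
have := l_vertex_geq ab; rewrite l0; case/adjP: ab => i [j [_ <- _]]; lia.
Qed.

Hypothesis chi2 : chi_lt H = 2.

Lemma h_ge2 : 1 < h.
Proof. by rewrite -chi2 /chi_lt bigminn_le_id. Qed.

Lemma not_indep : ~~ indep_interval H 1 h.
Proof.
apply/negP => /indepP ind.
suff : chi_lt H <= 1 by rewrite chi2.
rewrite -(cards1 [set: 'I_h]);
  apply: (@bigminn_le _ _ _ (fun P : {set {set 'I_h}} => #|P|)).
  by rewrite mem_index_enum.
rewrite /interval_coloring /finset.partition /cover big_set1 eqxx trivIset1 /=.
apply/andP; split.
  rewrite inE eq_sym; apply/negP => /eqP E; have := h_ge2.
  by rewrite -[X in _ < X]card_ord -cardsT E cards0.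
apply/forall_inP => A; rewrite inE => /eqP ->; apply/andP; split.
  apply/forall_inP => i _; apply/forall_inP => j _; apply/forallP => k.
  by apply/implyP; rewrite inE.
apply/forall_inP => i _; apply/forall_inP => j _; apply: ind; have := ltn_ord i;
  have := ltn_ord j; lia.
Qed.

Lemma a1_lt : a1 < h.
Proof.
rewrite ltnNge; apply/negP => ha; apply: (negP not_indep).
by apply: indep_sub a1_indep.
Qed.

Lemma b1_gt0 : 0 < b1.
Proof.
case: (posnP b1) => // q0; case/negP: not_indep.
by have := b1_indep; rewrite q0.
Qed.

(** In a colouring by two intervals, the block of the first vertex has a last vertex x; labels up to
    x are independent, and so are those after x. *)
Lemma b1_le_a1 : b1 <= a1.
Proof.
have h2 := h_ge2.
(* The minimum may be given by its default value h, which then equals 2. *)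
have [h2'|[P [colP cP]]] : h = 2 \/ exists P, interval_coloring H P /\ #|P| = 2.
  have : chi_lt H = h \/ exists P, interval_coloring H P /\ #|P| = chi_lt H.
    rewrite /chi_lt; apply: (big_ind (fun x => x = h \/
       exists P, interval_coloring H P /\ #|P| = x)); first by left.
      by move=> x y Hx Hy; rewrite /minn; case: ltnP.
    by move=> P colP; right; exists P.
  by rewrite chi2 => -[E|]; [left; rewrite -E|right].
  apply: (@leq_trans 1).
    apply: b1_leq; first by lia.
    apply/indepP => i j i1 j1; have E : i = j by apply: val_inj => /=; lia.
    by rewrite E edge_irrefl.
  apply: leq_a1; first by lia.
  apply/indepP => i j i1 j1; have E : i = j by apply: val_inj => /=; lia.
  by rewrite E edge_irrefl.
have /andP[partP /forall_inP blocks] := colP.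
pose o : 'I_h := Ordinal (ltnW h2).
have /and3P[/eqP covP trivP nP0] := partP.
have oB : o \in cover P by rewrite covP inE.
set B := pblock P o; have BP : B \in P by exact: pblock_mem.
have oinB : o \in B by rewrite mem_pblock.
have [x xB xmax] := @arg_maxnP _ o (mem B) (fun i : 'I_h => i : nat) oinB.
have /andP[/forall_inP intB /forall_inP indB] := blocks B BP.
have [C CP Cmem] : exists2 C, C \in P & forall j, j \notin B -> j \in C.
  have cPB : #|P :\ B| = 1 by have := cardsD1 B P; rewrite BP cP add1n => -[].
  have [C CPB] : exists C, C \in P :\ B by apply/card_gt0P; rewrite cPB.
  have := CPB; rewrite in_setD1 => /andP[_ CP].
  exists C => // j jB; have jcov : j \in cover P by rewrite covP inE.
  have PC : P :\ B = [set C].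
    by apply/eqP; rewrite eq_sym eqEcard sub1set CPB cards1 cPB.
  have : pblock P j \in P :\ B.
    rewrite in_setD1 pblock_mem // andbT; apply: contraNneq jB => <-.
    by rewrite mem_pblock.
  by rewrite PC inE => /eqP <-; rewrite mem_pblock.
have /andP[_ /forall_inP indC] := blocks C CP.
have xh := ltn_ord x.
apply: (@leq_trans x.+1).
  apply: b1_leq => //; apply/indepP => i j i1 j1.
  have notB (k : 'I_h) : x < k -> k \notin B.
    by move=> xk; apply/negP => /xmax /=; rewrite leqNgt xk.
  have [xi xj] : x < i /\ x < j by move: i1 j1; clear; lia.
  by apply: (forall_inP (indC i _)); apply/Cmem/notB.
apply: leq_a1 => //; apply/indepP => i j i1 j1.
have inB (k : 'I_h) : k <= x -> k \in B.
  by move=> kx; have /forall_inP/(_ x xB)/forallP/(_ k)/implyP := intB o oinB; apply;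
    rewrite kx.
have [ix jx] : i <= x /\ j <= x by move: i1 j1; clear; lia.
by apply: (forall_inP (indB i _)); apply/inB.
Qed.

(** Both intervals of Property A have [h./2 + 1] vertices, so both extremal independent intervals
    must be at least that long. *)
Lemma propertyAP : propertyA H <-> h./2 < minn a1 (h - b1).
Proof.
have h2 := h_ge2; have E := odd_double_half h.
split=> [[A1 A2]|]; rewrite leq_min.
  apply/andP; split; first by apply: leq_a1 => //; lia.
  have : b1 <= (uphalf h).-1.
    by apply: b1_leq; rewrite ?prednK //; rewrite uphalf_half; lia.
  by rewrite uphalf_half; lia.
move=> /andP[A1 A2]; split; first exact: indep_sub a1_indep.
by apply: indep_sub b1_indep; rewrite ?uphalf_half; lia.
Qed.

(** If neither end is isolated, an edge at 1 ends beyond [a1] and crosses every cut up to [a1],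
    while an edge at h starts within the first [b1 <= a1] labels and crosses the later cuts. *)
Lemma not_propertyB : ~ propertyB H -> first_isolated \/ last_isolated.
Proof.
move=> nB; apply: contrapT => /not_orP[nf nl]; apply: nB => c /andP[c1 ch].
have h2 := h_ge2.
have [ca|ac] := leqP c a1.
  move/existsNP: nf => [i /existsNP[j /not_implyP[Hij /not_implyP[ij]]]].
  move=> /negP; rewrite -eqn0Ngt => /eqP i0; exists i, j.
  have := left_edge Hij ij; have jh := ltn_ord j.
  by split=> //; rewrite /label_in /label; lia.
move/existsNP: nl => [i /existsNP[j /not_implyP[Hij /not_implyP[ij /negP jh']]]].
exists i, j; have := right_edge Hij ij; have jh := ltn_ord j; have := b1_le_a1.
by split=> //; rewrite /label_in /label; lia.
Qed.

(** Without Property C the interval [s(H), h - 1] is independent, so every edge not at h starts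
    before s(H), and s = s(H) works. If h is isolated, s = [b1 + 1] does. *)
Lemma last_pattern : b1 < a1 -> ~ propertyC_last H -> exists s, [/\ 0 < s, s <= a1 &
  forall i j : 'I_h, H i j -> i < j ->
    [/\ i < s.-1, s.-1 <= j & j.+1 < h] \/ (s.-1 <= i /\ j.+1 = h)].
Proof.
move=> qa nC; have [iso|niso] := pselect (Defs.isolated H h).
  exists b1.+1; split=> // i j Hij ij; left; split=> /=.
  - exact: right_edge ij.
  - by apply: leq_trans (left_edge Hij ij); exact: ltnW.
  - exact: (isolated_last iso Hij).
have ind : ~~ has_edge_in H (s_vertex H) h.-1.
  by apply/negP => e; apply: nC; split.
have sadj := s_vertex_adj niso; have s_min := s_vertex_leq.
set s := s_vertex H in ind sadj s_min.
have h2 := h_ge2.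
case/adjP: sadj => i0 [j0 [ih js Hij0]]; rewrite edge_sym in Hij0.
have ne := edge_neq Hij0; have jh0 := ltn_ord j0.
have ij0 : j0 < i0 by lia.
have := right_edge Hij0 ij0 => sq.
exists s; split; [by lia|by lia|] => i j Hij ij.
have jh := ltn_ord j; have aj := left_edge Hij ij.
have [jl|jl] := eqVneq j.+1 h.
  right; split=> //; rewrite -ltnS prednK; last by lia.
  apply: (@s_min i.+1) => //; apply/adjP; exists j, i; split=> //.
  by rewrite edge_sym.
left; split; [|lia|lia].
rewrite ltnNge; apply/negP => si.
have : ~~ H i j by apply: (indepP _ _ ind); lia.
by rewrite Hij.
Qed.

(** Mirror image of [last_pattern], with s = h + 1 - l(H), or [h - a1 + 1] if 1 is isolated. *)
Lemma first_pattern : b1 < a1 -> ~ propertyC_first H -> exists s, [/\ 0 < s, s <= h - b1 &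
  forall i j : 'I_h, H i j -> i < j ->
    (i = 0 :> nat /\ j <= h - s) \/ [/\ 0 < i, i <= h - s & h - s < j]].
Proof.
move=> qa nC; have h2 := h_ge2; have ah := a1_lt.
have [iso|niso] := pselect (Defs.isolated H 1).
  exists (h - a1).+1; split=> [//||i j Hij ij]; first by lia.
  have := isolated_first iso Hij ij; have := right_edge Hij ij; have := left_edge Hij ij.
  by right; split; lia.
have ind : ~~ has_edge_in H 2 (l_vertex H).
  by apply/negP => e; apply: nC; split.
have ladj := l_vertex_adj niso; have l_max := l_vertex_geq.
set l := l_vertex H in ind ladj l_max.
case/adjP: ladj => i0 [j0 [ih jl Hij0]].
have ne := edge_neq Hij0; have jh0 := ltn_ord j0.
have ij0 : i0 < j0 by lia.
have al := left_edge Hij0 ij0.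
exists (h.+1 - l); split; [by lia|by lia|] => i j Hij ij.
have jh := ltn_ord j; have iq := right_edge Hij ij.
have [i1|i1] := posnP i.
  left; split=> //; have : j.+1 <= l by apply: l_max; apply/adjP; exists i, j; rewrite i1.
  by lia.
right; split; [by []|lia|].
rewrite ltnNge; apply/negP => jl'.
have : ~~ H i j by apply: (indepP _ _ ind); lia.
by rewrite Hij.
Qed.

End Pattern.

(** * Bounds on the threshold *)

Section FromRel.
Variables (n : nat) (e : rel nat).
Definition rel_edge (u v : 'I_n) := (u != v) && (e u v || e v u).
Lemma rel_edge_sym : symmetric rel_edge.
Proof. by move=> u v; rewrite /rel_edge eq_sym orbC. Qed.
Lemma rel_edge_irrefl : irreflexive rel_edge.
Proof. by move=> u; rewrite /rel_edge eqxx. Qed.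
Definition rel_ograph := OGraph rel_edge_sym rel_edge_irrefl.

Lemma card_interval c d : d <= n -> #|[pred v : 'I_n | c <= v < d]| = d - c.
Proof.
move=> dn.
have [cd|dc] := leqP c d; last first.
  by rewrite (eqP (ltnW dc)) eq_card0 // => v; rewrite !inE; lia.
have := cardID [pred v : 'I_n | v < c] [pred v : 'I_n | v < d].
rewrite card_ord_lt // (_ : #|[predI _ & _]| = c); last first.
  rewrite -[RHS](@card_ord_lt n); last exact: leq_trans cd dn.
  by apply: eq_card => v; rewrite !inE; lia.
rewrite (_ : #|[predD _ & _]| = #|[pred v : 'I_n | c <= v < d]|); first by lia.
by apply: eq_card => v; rewrite !inE; lia.
Qed.

(* The successor accounts for [v] itself, which may lie in the interval. *)
Lemma degree_interval (v : 'I_n) c d : d <= n ->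
  (forall u : 'I_n, c <= u < d -> u != v -> e v u || e u v) ->
  d - c <= (degree rel_ograph v).+1.
Proof.
move=> dn vu; rewrite -(card_interval c dn) (cardD1 v).
apply: (@leq_trans (1 + #|[predD1 [pred u : 'I_n | c <= u < d] & v]|)).
  by rewrite leq_add2r leq_b1.
rewrite add1n ltnS; apply: subset_leq_card; apply/subsetP => u; rewrite !inE /=.
by move=> /andP[uv cu]; rewrite /rel_edge eq_sym uv /=; exact: vu.
Qed.
End FromRel.

(** * Perfect tilings from degree conditions *)

Section Bounds.
Variables (h : nat) (H : ograph h).
Hypothesis chi2 : chi_lt H = 2.

Local Notation a := (a1 H).
Local Notation q := (b1 H).
Definition msize := minn a (h - q).
Local Notation m := msize.

Lemma copy_system_deg n (G : ograph n) (v : copy_system H G) : deg v = degree G v.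
Proof. by rewrite /deg /degree cardsE. Qed.

Lemma copy_system_splits_all n (G : ograph n) p :
  q <= p <= a -> splits (copy_system H G) p.
Proof.
apply: copy_system_splits; [exact: b1_le_a1|exact: ltnW (a1_lt chi2)| |].
  by move=> i j; exact: left_edge.
by move=> i j; exact: right_edge.
Qed.

Lemma ograph_perfect N k C : 0 < N -> exists n0, forall n (G : ograph n),
  n0 <= n -> h %| n -> (forall v, N * (h - m) * n + n <= N * h * degree G v) ->
  (forall x y : copy_system H G, reach k C x y) -> exists T, is_perfect_tiling H G T.
Proof.
move=> N0; have h2 := h_ge2 chi2; have ah := a1_lt chi2; have qa := b1_le_a1 chi2.
have h0 : 0 < h by lia.
have mb : m <= h - q <= h by rewrite /m geq_minr leq_subr.
have ma : m <= a <= h by rewrite /m geq_minl ltnW.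
have [n0 Hn0] := tileable_all k C h0 N0 ma mb.
exists n0 => n G nbig hn degG R; apply: tileable_perfect.
apply: (Hn0 (copy_system H G)); rewrite ?card_ord //.
- by apply: copy_system_splits_all; rewrite qa leqnn.
- by apply: copy_system_splits_all; lia.
- by move=> v; rewrite copy_system_deg; exact: degG.
Qed.

Lemma perfect_half_degree N : 0 < N -> exists n0, forall n (G : ograph n),
  n0 <= n -> h %| n -> (forall v, N * (h - m) * n + n <= N * h * degree G v) ->
  (forall v, (N + 2) * n <= 2 * N * degree G v) ->
  exists T, is_perfect_tiling H G T.
Proof.
move=> N0; have ah := a1_lt chi2; have qa := b1_le_a1 chi2; have q0 := b1_gt0 chi2.
have a_bnd : 0 < a < h by lia.
have [j [C HC]] := half_reach a_bnd N0.
have [n0 Hn0] := ograph_perfect (j * h + h.-1) C N0.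
exists n0 => n G nbig hn degG halfG; apply: Hn0 => //; apply: HC; split.
  by apply: copy_system_splits_all; rewrite qa leqnn.
by move=> v; rewrite copy_system_deg card_ord.
Qed.

(** One end vertex is isolated by [not_propertyB], and the failure of Property C at the other end
    gives [last_fits]. If the isolated one is h, the argument runs in the mirror image. *)
Lemma perfect_free_ends N : 0 < N -> h./2 < m -> ~ propertyB H ->
  ~ propertyC_first H -> ~ propertyC_last H -> exists n0, forall n (G : ograph n),
  n0 <= n -> h %| n -> (forall v, N * (h - m) * n + n <= N * h * degree G v) ->
  exists T, is_perfect_tiling H G T.
Proof.
move=> N0 hm nB nC1 nC2.
have ah := a1_lt chi2; have q0 := b1_gt0 chi2; have h2 := h_ge2 chi2.
have qa : q < a by move: hm; rewrite /m; have := odd_double_half h; lia.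
have Nh0 : 0 < N * h by rewrite muln_gt0 N0; lia.
have lH i j : H i j -> i < j -> a <= j by exact: left_edge.
have rH i j : H i j -> i < j -> i < q by exact: right_edge.
have degN n (G : ograph n) : (forall v, N * (h - m) * n + n <= N * h * degree G v) ->
    forall v : copy_system H G, #|copy_system H G| <= N * h * deg v.
  by move=> degG v; rewrite copy_system_deg card_ord; apply: leq_trans (degG v);
    exact: leq_addl.
case: (not_propertyB chi2 nB) => iso.
  have [s [s0 sa Hs]] := last_pattern chi2 qa nC2.
  have s_bnd : 0 < s <= a by rewrite s0.
  have [C HC] := free_ends_reach q0 qa ah s_bnd Nh0.
  have [n0 Hn0] := ograph_perfect ((h.+1 * h).-1 + (h.+1 * h).-1.+1) C N0.
  exists n0 => n G nbig hn degG; apply: Hn0 => //; apply: HC; last exact: degN.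
  split; first exact: copy_system_splits_all.
    by apply: copy_system_first_free => //; exact: ltnW.
  by apply: copy_system_last_fits => //; lia.
have [s [s0 sa Hs]] := first_pattern chi2 qa nC1.
have s_bnd : 0 < s <= h - q by rewrite s0.
have q0' : 0 < h - a by lia.
have qa' : h - a < h - q by lia.
have ah' : h - q < h by lia.
have [C HC] := free_ends_reach q0' qa' ah' s_bnd Nh0.
have [n0 Hn0] := ograph_perfect ((h.+1 * h).-1 + (h.+1 * h).-1.+1) C N0.
exists n0 => n G nbig hn degG; apply: Hn0 => //.
apply: (HC (mirror (copy_system H G))); last exact: degN.
split.
- move=> p pb; rewrite -(@subKn p h); last by lia.
  by apply: mirror_splits; [lia | apply: copy_system_splits_all; lia].
- by apply: mirror_first_free => //; exact: ltnW.
- by apply: mirror_last_fits => //; lia.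
Qed.

Lemma leq_min_degree n (G : ograph n) d : d <= n ->
  (forall v, d <= degree G v) -> d <= min_degree G.
Proof.
move=> dn dG; rewrite /min_degree; apply: (big_ind (fun x => d <= x)) => // x y dx dy.
by rewrite leq_min dx.
Qed.

Lemma min_degree_leq n (G : ograph n) v : min_degree G <= degree G v.
Proof. by apply: (@bigminn_le _ _ _ (degree G)); rewrite ?mem_index_enum. Qed.

Lemma degree_lt n (G : ograph n) v : degree G v < n.
Proof.
rewrite -[X in _ < X]card_ord -cardsT; apply: proper_card; apply/properP.
by split; [exact: subsetT | exists v; rewrite !inE // edge_irrefl].
Qed.

Lemma delta_lt_leq n k : k <= n -> forces_tiling H n k -> delta_lt H n <= k.
Proof.
move=> kn fk; have kn' : k < n.+1 by [].
apply: (@bigminn_le _ _ _ (fun k : 'I_n.+1 => k : nat) _ (Ordinal kn')).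
  by rewrite mem_index_enum.
exact/asboolP.
Qed.

Lemma delta_lt_gt n (G : ograph n) d : 0 < n -> (forall v, d <= degree G v) ->
  ~ (exists T, is_perfect_tiling H G T) -> d < delta_lt H n.
Proof.
move=> n0 dG nT; have dn : d < n by apply:
  leq_ltn_trans (dG (Ordinal n0)) (degree_lt _ _).
rewrite /delta_lt; apply: (big_ind (fun x => d < x)) => // [x y dx dy|k /asboolP fk].
  by rewrite leq_min dx.
rewrite ltnNge; apply/negP => kd; apply: nT; apply: fk.
by apply: leq_trans kd _; apply: leq_min_degree => //; exact: ltnW.
Qed.

(** Every vertex is [phi i] for exactly one phi in [T] and one i. *)
Lemma perfect_count n (G : ograph n) T (Q : pred 'I_n) : is_perfect_tiling H G T ->
  #|[pred v | Q v]| = \sum_(phi in T) #|[pred i | Q (phi i)]|.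
Proof.
move=> [[copT disT] covT].
have -> : \sum_(phi in T) #|[pred i | Q (phi i)]| =
    \sum_(v | Q v) \sum_(phi in T) \sum_(i < h) (phi i == v).
  rewrite exchange_big; apply: eq_bigr => phi _;
    rewrite exchange_big -sum1_card big_mkcond.
  apply: eq_bigr => i _; rewrite unfold_in /=; case: (boolP (Q (phi i))) => Qi.
    rewrite (bigD1 (phi i)) //= eqxx big1 // => v /andP[_].
    by rewrite eq_sym => /negPf ->.
  by rewrite big1 // => v Qv; case: eqP => // E; rewrite E Qv in Qi.
rewrite -sum1_card; apply: eq_bigr => v _.
have [phi phiT /codomP[i0 vE]] := covT v.
rewrite (bigD1 phi) //= (bigD1 i0) //= vE eqxx !big1 //.
  move=> psi /andP[psiT neq]; rewrite big1 // => i _; case: eqP => // E.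
  have := disT _ _ phiT psiT; rewrite eq_sym neq => /(_ isT) dis.
  have := disjointFr dis (codom_f phi i0); rewrite -E codom_f //.
move=> i ii0; case: eqP => // E; move: ii0.
by rewrite (copy_inj (copT _ phiT) E) eqxx.
Qed.

Lemma down_closed_card (p : pred 'I_h) : (forall i j : 'I_h, i < j -> p j -> p i) ->
  forall i : 'I_h, p i = (i < #|[pred i | p i]|).
Proof.
move=> down i.
case: (boolP (p i)) => pi; apply/esym.
  rewrite -[X in X <= _](@card_ord_lt h i.+1) //; apply: subset_leq_card;
    apply/subsetP => j.
  rewrite !inE ltnS leq_eqVlt => /orP[/eqP/val_inj-> //|ji]; exact: down ji pi.
apply/negbTE; rewrite -leqNgt -[X in _ <= X](@card_ord_lt h i); last exact: ltnW.
apply: subset_leq_card; apply/subsetP => j; rewrite !inE => pj.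
by rewrite ltnNge; apply: contra pi; rewrite leq_eqVlt => /orP[/eqP/val_inj-> //|ij];
  exact: down ij pj.
Qed.

(** A threshold K cuts a copy into an initial and a final segment; the lower bounds depend on where
    this cut can fall. *)
Lemma copy_below n (G : ograph n) phi K : is_copy H G phi ->
  forall i : 'I_h, (phi i < K) = (i < #|[pred i | phi i < K]|).
Proof.
move=> [phi_lt _]; apply: down_closed_card => i j ij; exact: ltn_trans (phi_lt _ _ ij).
Qed.

Lemma card_below n (phi : {ffun 'I_h -> 'I_n}) K : #|[pred i | phi i < K]| <= h.
Proof. by rewrite -[X in _ <= X]card_ord max_card. Qed.


End Bounds.

(** * Extremal graphs for the lower bounds *)

Section Lower.
Variables (h : nat) (H : ograph h).
Hypothesis chi2 : chi_lt H = 2.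
Local Notation a := (a1 H).
Local Notation q := (b1 H).

Lemma perfect_card n (G : ograph n) T : is_perfect_tiling H G T -> n = #|T| * h.
Proof.
move=> pT; have := perfect_count predT pT.
rewrite (eq_card (_ : [pred v : 'I_n | predT v] =i predT)) // card_ord => {1}->.
rewrite -sum_nat_const; apply: eq_bigr => phi _.
by rewrite -[RHS]card_ord; apply: eq_card.
Qed.

Lemma perfect_below n (G : ograph n) T k : is_perfect_tiling H G T -> k <= n ->
  k = \sum_(phi in T) #|[pred i | phi i < k]|.
Proof.
by move=> pT kn; rewrite -(perfect_count (fun v => v < k) pT) card_ord_lt.
Qed.

Lemma copy_edge n (e : rel nat) (phi : {ffun 'I_h -> 'I_n}) (i j : 'I_h) :
  is_copy H (rel_ograph n e) phi -> H i j -> e (phi i) (phi j) || e (phi j) (phi i).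
Proof. by move=> [_ adjphi] /adjphi /andP[]. Qed.

(** The first [a * t + 1] vertices, t = n / h, are made independent and all other pairs adjacent.
    Each of the t copies meets them in an initial independent interval of [H], so in at most a
    vertices. *)
Lemma delta_lt_initial n : 0 < n -> h %| n -> n - a * (n %/ h) <= delta_lt H n + 1.
Proof.
move=> n0 /dvdnP[t nE]; have ah := a1_lt chi2; have h0 : 0 < h by lia.
have -> : n %/ h = t by rewrite nE mulnK.
have t0 : 0 < t by move: n0; rewrite nE; case: (t).
set K := a * t + 1.
have Kn : K <= n by rewrite nE /K; nia.
pose e := [rel u v : nat | ~~ ((u < K) && (v < K))].
suff : n - K - 1 < delta_lt H n by rewrite /K; lia.
apply: (@delta_lt_gt _ _ _ (rel_ograph n e)) => //.
  move=> v; have : n - K <= (degree (rel_ograph n e) v).+1; last by lia.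
  by apply: degree_interval => // u /andP[Ku _] _; rewrite /= [u < K]ltnNge Ku andbF.
move=> [T pT]; have [[copT _] _] := pT.
have nT := perfect_card pT.
have TE : #|T| = t by apply/eqP; rewrite -(eqn_pmul2r h0) -nT nE.
have := perfect_below pT Kn.
suff : \sum_(phi in T) #|[pred i | phi i < K]| <= \sum_(phi in T) a.
  by rewrite sum_nat_const TE /K; lia.
apply: leq_sum => phi phiT; apply: leq_a1; first exact: card_below.
have cphi := copT _ phiT; apply/indepP => i j ic jc; apply/negP => /(copy_edge cphi).
rewrite /= !(copy_below K cphi); move: ic jc; move: #|_| => c; lia.
Qed.

(** Here all vertices after the first [q * t - 1] are independent, and each of the t copies needs at
    least q vertices before them. *)
Lemma delta_lt_final n : 0 < n -> h %| n -> n - (h - q) * (n %/ h) <= delta_lt H n + 1.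
Proof.
move=> n0 /dvdnP[t nE]; have ah := a1_lt chi2; have h0 : 0 < h by lia.
have q0 := b1_gt0 chi2; have qa := b1_le_a1 chi2.
have -> : n %/ h = t by rewrite nE mulnK.
have t0 : 0 < t by move: n0; rewrite nE; case: (t).
set K := q * t - 1.
have Kn : K <= n by rewrite nE /K; nia.
pose e := [rel u v : nat | ~~ ((K <= u) && (K <= v))].
suff : K - 1 < delta_lt H n by rewrite /K; nia.
apply: (@delta_lt_gt _ _ _ (rel_ograph n e)) => //.
  move=> v; have : K - 0 <= (degree (rel_ograph n e) v).+1; last by lia.
  by apply: degree_interval => // u /andP[_ uK] _; rewrite /= [K <= u]leqNgt uK andbF.
move=> [T pT]; have [[copT _] _] := pT.
have nT := perfect_card pT.
have TE : #|T| = t by apply/eqP; rewrite -(eqn_pmul2r h0) -nT nE.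
have := perfect_below pT Kn.
suff : \sum_(phi in T) q <= \sum_(phi in T) #|[pred i | phi i < K]|.
  by rewrite sum_nat_const TE /K; nia.
apply: leq_sum => phi phiT; apply: b1_leq; first exact: card_below.
have cphi := copT _ phiT; apply/indepP => i j ic jc; apply/negP => /(copy_edge cphi).
by rewrite /= ![K <= _]leqNgt !(copy_below K cphi); move: ic jc; move: #|_| => c; lia.
Qed.

(** Two cliques on intervals: Property B keeps every copy inside one of them, so the size k of the
    first would be divisible by h. As h >= 2, one of two consecutive integers near n/2 is not. *)
Lemma delta_lt_propertyB n : propertyB H -> 0 < n -> n./2 <= delta_lt H n + 2.
Proof.
move=> pB n0; have h2 := h_ge2 chi2.
have [k [kn hk]] : exists k, n./2 <= k <= n./2.+1 /\ ~~ (h %| k).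
  have [hn|hn] := boolP (h %| n./2); last by exists n./2; rewrite leqnn leqnSn.
  exists n./2.+1; rewrite leqnn leqnSn -addn1 dvdn_addr //; split=> //.
  by rewrite dvdn1; lia.
have nE := odd_double_half n.
have kn' : k <= n by lia.
pose e := [rel u v : nat | (u < k) == (v < k)].
suff : n./2 - 2 < delta_lt H n by lia.
apply: (@delta_lt_gt _ _ _ (rel_ograph n e)) => //.
  move=> v; case: (ltnP v k) => vk.
    have := @degree_interval n e v 0 k kn'; rewrite subn0 => D.
    have : k <= (degree (rel_ograph n e) v).+1.
      by apply: D => u /andP[_ uk] _; rewrite /= vk uk.
    lia.
  have : n - k <= (degree (rel_ograph n e) v).+1.
    apply: degree_interval => // u /andP[ku _] _.
    by rewrite /= !ltnNge vk ku.
  lia.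
move=> [T pT]; have [[copT _] _] := pT.
case/negP: hk; rewrite (perfect_below pT kn'); apply: dvdn_sum => phi phiT.
have cphi := copT _ phiT; set c := #|_|.
have ch : c <= h by exact: card_below.
have [c0|c0] := posnP c; first by rewrite c0 dvdn0.
have [->|ch'] := eqVneq c h; first exact: dvdnn.
have [|x [y [xc yc Hxy]]] := pB c; first by rewrite c0 ltn_neqAle ch' ch.
have := copy_edge cphi Hxy; rewrite /label_in /label in xc yc.
by rewrite /= !(copy_below k cphi) -/c; move: xc yc; clearbody c; lia.
Qed.

(** The last vertex is adjacent exactly to the other positions from k on, which are independent. In
    its copy it plays h, so [s(H), h - 1] is mapped into the independent set, against the edge given
    by Property C. *)
Lemma delta_lt_propertyC_last n : propertyC_last H -> 0 < n -> n./2 <= delta_lt H n + 2.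
Proof.
move=> [niso edgeC] n0; have h2 := h_ge2 chi2.
have nE := odd_double_half n; set k := n./2 in nE *.
have [n1|n2] := leqP n 1; first by lia.
pose e := [rel u v : nat | [&& u.+1 < n, v.+1 < n & ~~ ((k <= u) && (k <= v))]
                           || (u.+1 == n) && (k <= v)].
suff : k - 2 < delta_lt H n by lia.
apply: (@delta_lt_gt _ _ _ (rel_ograph n e)) => //.
  move=> v; have vn := ltn_ord v.
  have [vk|kv] := ltnP v k.
    have : n.-1 - 0 <= (degree (rel_ograph n e) v).+1; last by lia.
    by apply: degree_interval => [|u un _]; rewrite /=; lia.
  have [vn1|vn1] := eqVneq v.+1 n.
    have : n - k <= (degree (rel_ograph n e) v).+1; last by lia.
    by apply: degree_interval => [|u un _]; rewrite /=; lia.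
  have : k - 0 <= (degree (rel_ograph n e) v).+1; last by lia.
  by apply: degree_interval => [|u un _]; rewrite /=; lia.
move=> [T [[copT _] covT]].
have n1n : n.-1 < n by lia.
have [phi phiT /codomP[i phii]] := covT (Ordinal n1n).
have cphi := copT _ phiT; have [phi_lt _] := cphi.
have phiin : phi i = n.-1 :> nat by rewrite -phii.
have ih : i.+1 = h.
  apply/eqP; rewrite eqn_leq ltn_ord leqNgt; apply/negP => ih.
  have := phi_lt i (Ordinal ih) (leqnn _); rewrite phiin.
  by case: (phi (Ordinal ih)) => w /= wn; lia.
have /adjP[i' [j [i'h js Hij]]] := s_vertex_adj niso.
have i'i : i' = i by apply: val_inj => /=; lia.
rewrite i'i in Hij; set s := s_vertex H in js edgeC.
have kj : k <= phi j.
  by have := copy_edge cphi Hij; have := ltn_ord (phi j); rewrite /= phiin; lia.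
have inC (x : 'I_h) : label_in s h.-1 x -> (k <= phi x) && ((phi x).+1 < n).
  rewrite /label_in /label => /andP[sx xh].
  have le1 : phi j <= phi x.
    have := leq_eqVlt j x; rewrite (_ : j <= x); last by lia.
    by move/esym/orP=> [/eqP/val_inj->//|/phi_lt/ltnW].
  have : phi x < phi i by apply: phi_lt; lia.
  by rewrite phiin; lia.
case/existsP: edgeC => x /existsP[y /and3P[/inC xC /inC yC /(copy_edge cphi)]].
by rewrite /=; move: xC yC; move: (nat_of_ord (phi x)) (nat_of_ord (phi y)) => u v; lia.
Qed.

Lemma delta_lt_propertyC_first n : propertyC_first H -> 0 < n -> n./2 <= delta_lt H n + 2.
Proof.
move=> [niso edgeC] n0; have h2 := h_ge2 chi2.
have nE := odd_double_half n; set k := n./2 in nE *.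
have [n1|n2] := leqP n 1; first by lia.
pose e := [rel u v : nat | [&& 0 < u, 0 < v & ~~ ((u < k) && (v < k))]
                           || (u == 0) && (v < k)].
suff : k - 2 < delta_lt H n by lia.
apply: (@delta_lt_gt _ _ _ (rel_ograph n e)) => //.
  move=> v; have vn := ltn_ord v.
  have [v0|v0] := posnP v.
    have : k - 0 <= (degree (rel_ograph n e) v).+1; last by lia.
    by apply: degree_interval => [|u un _]; rewrite /=; lia.
  have [vk|kv] := ltnP v k.
    have : n - k <= (degree (rel_ograph n e) v).+1; last by lia.
    by apply: degree_interval => [|u un _]; rewrite /=; lia.
  have : n - 1 <= (degree (rel_ograph n e) v).+1; last by lia.
  by apply: degree_interval => [|u un _]; rewrite /=; lia.
move=> [T [[copT _] covT]].
have [phi phiT /codomP[i phii]] := covT (Ordinal n0).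
have cphi := copT _ phiT; have [phi_lt _] := cphi.
have phiin : phi i = 0 :> nat by rewrite -phii.
have ih : i = 0 :> nat.
  apply/eqP; rewrite -leqn0 leqNgt; apply/negP => ih.
  by have := phi_lt (Ordinal (ltnW h2)) i ih; rewrite phiin.
have /adjP[i' [j [i'h js Hij]]] := l_vertex_adj niso.
have i'i : i' = i by apply: val_inj => /=; lia.
rewrite i'i in Hij; set l := l_vertex H in js edgeC.
have kj : phi j < k.
  by have := copy_edge cphi Hij; rewrite /= phiin; lia.
have inC (x : 'I_h) : label_in 2 l x -> (phi x < k) && (0 < phi x).
  rewrite /label_in /label => /andP[sx xh].
  have le1 : phi x <= phi j.
    have := leq_eqVlt x j; rewrite (_ : x <= j); last by lia.
    by move/esym/orP=> [/eqP/val_inj->//|/phi_lt/ltnW].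
  have : phi i < phi x by apply: phi_lt; lia.
  by rewrite phiin; lia.
case/existsP: edgeC => x /existsP[y /and3P[/inC xC /inC yC /(copy_edge cphi)]].
by rewrite /=; move: xC yC; move: (nat_of_ord (phi x)) (nat_of_ord (phi y)) => u v; lia.
Qed.

End Lower.

(** * Upper bounds for the threshold *)

Section UpperBounds.
Variables (h : nat) (H : ograph h).
Hypothesis chi2 : chi_lt H = 2.
Local Notation m := (msize H).

Lemma delta_lt_forces n k : (forall G : ograph n, (forall v, k <= degree G v) ->
  exists T, is_perfect_tiling H G T) -> delta_lt H n <= k.
Proof.
move=> fk; have [kn|nk] := leqP k n; last first.
  by apply: leq_trans (ltnW nk); rewrite /delta_lt; exact: bigminn_le_id.
apply: delta_lt_leq => // G kG; apply: fk => v.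
exact: leq_trans kG (min_degree_leq _ _).
Qed.

Lemma delta_lt_upper_free N : 0 < N -> h./2 < m -> ~ propertyB H ->
  ~ propertyC_first H -> ~ propertyC_last H -> exists n0, forall n,
  n0 <= n -> h %| n -> delta_lt H n <= (h - m) * (n %/ h) + (n %/ N).+1.
Proof.
move=> N0 hm nB nC1 nC2; have h2 := h_ge2 chi2.
have [n0 Hn0] := perfect_free_ends chi2 N0 hm nB nC1 nC2.
exists n0 => n nbig hn; apply: delta_lt_forces => G degG; apply: Hn0 => // v.
have nE : n %/ h * h = n by rewrite divnK.
have nN : n < (n %/ N).+1 * N by rewrite -ltn_divLR.
move: (degG v); set d := degree G v; move: (n %/ h) (n %/ N) nE nN => t r nE nN le1.
have e1 := leq_mul (leqnn (N * h)) le1.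
have e2 : r.+1 * N <= r.+1 * N * h by rewrite leq_pmulr //; lia.
rewrite -{1}nE; lia.
Qed.

(** Since m <= h/2, the bound (1 - m/h) n is at least n/2 and implies both degree conditions of
    [perfect_half_degree]. *)
Lemma delta_lt_upper_small N : 0 < N -> m <= h./2 -> exists n0, forall n,
  n0 <= n -> h %| n -> delta_lt H n <= (h - m) * (n %/ h) + (n %/ N).+1.
Proof.
move=> N0 hm; have h2 := h_ge2 chi2.
have [n0 Hn0] := perfect_half_degree chi2 N0.
exists n0 => n nbig hn; apply: delta_lt_forces => G degG.
have nE : n %/ h * h = n by rewrite divnK.
have nN : n < (n %/ N).+1 * N by rewrite -ltn_divLR.
have hmm : h <= 2 * (h - m) by have := odd_double_half h; lia.
apply: Hn0 => // v; move: (degG v); set d := degree G v.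
  move: (n %/ h) (n %/ N) nE nN => t r nE nN le1.
  have e1 := leq_mul (leqnn (N * h)) le1.
  have e2 : r.+1 * N <= r.+1 * N * h by rewrite leq_pmulr //; lia.
  rewrite -{1}nE; lia.
move: (n %/ h) (n %/ N) nE nN => t r nE nN le1.
have e1 := leq_mul (leqnn (2 * N)) le1.
have e2 : N * t * h <= N * t * (2 * (h - m)) by rewrite leq_mul2l hmm orbT.
rewrite mulnDl -{1}nE; lia.
Qed.

(** Now (1 - m/h) n is at most n/2, so the half-degree condition is the stronger one. The additive 2
    covers the rounding of n / N and an odd n. *)
Lemma delta_lt_upper_half N : 0 < N -> h./2 < m -> exists n0, forall n,
  n0 <= n -> h %| n -> delta_lt H n <= n./2 + (n %/ N).+2.
Proof.
move=> N0 hm; have h2 := h_ge2 chi2.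
have [n0 Hn0] := perfect_half_degree chi2 N0.
exists n0 => n nbig hn; apply: delta_lt_forces => G degG.
have nE := odd_double_half n.
have nN : n < (n %/ N).+1 * N by rewrite -ltn_divLR.
have hmm : 2 * (h - m) <= h by have := odd_double_half h; lia.
have main d : n./2 + (n %/ N).+2 <= d -> (N + 2) * n <= 2 * N * d.
  move: (n %/ N) nN => r nN le1.
  have e1 := leq_mul (leqnn (2 * N)) le1.
  have e2 : N * n <= N * (2 * n./2 + 1) by rewrite leq_mul2l; lia.
  by lia.
apply: Hn0 => // v; have /main := degG v => //; set d := degree G v => le1.
have e1 := leq_mul (leqnn h) le1.
have e2 : N * n * (2 * (h - m)) <= N * n * h by rewrite leq_mul2l hmm orbT.
have e3 : 2 * n <= h * (2 * n) by rewrite leq_pmull; lia.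
lia.
Qed.

End UpperBounds.

Import Order.TTheory GRing.Theory Num.Theory.
Import numFieldNormedType.Exports.
Local Open Scope ring_scope.

(** * Passage to the asymptotic statements *)

Section Asymptotics.
Variable R : realType.

Lemma delta_lt_asymp_of_bounds h (H : ograph h) (c : R) (K : nat) :
  (forall N, (0 < N)%N -> exists n0, forall n, (n0 <= n)%N -> (0 < n)%N -> (h %| n)%N ->
     `|(delta_lt H n)%:R - c * n%:R| <= n%:R / N%:R + K%:R) ->
  delta_lt_asymp H c.
Proof.
move=> bounds.
(* The value 0 at the other n makes convergence a matter of positive multiples of h only. *)
exists (fun n => if (0 < n)%N && (h %| n)%N then (delta_lt H n)%:R / n%:R - c else 0).
split; last first.
  move=> n n0 hn; rewrite n0 hn /= addrCA subrr addr0 divfK //.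
  by rewrite pnatr_eq0 -lt0n.
apply/cvgrPdist_le => e e0.
pose N := (Num.Def.archi_bound (2 / e)).+1.
have Ne : 2 / e < N%:R.
  apply: (lt_trans (archi_boundP _)); first by rewrite divr_ge0 // ltW.
  by rewrite ltr_nat.
have [n0 Hn0] := bounds N isT.
(* From [K * N] on, the constant K is at most n / N, so the error is at most 2n / N. *)
exists (n0 + K * N)%N => // n /= nbig; rewrite sub0r normrN.
case: ifP => [/andP[n_gt0 hn]|_]; last by rewrite normr0 ltW.
have n0R : 0 < n%:R :> R by rewrite ltr0n.
have N0R : 0 < N%:R :> R by rewrite ltr0n.
have bnd : `|(delta_lt H n)%:R - c * n%:R| <= n%:R / N%:R + K%:R.
  by apply: Hn0 => //; lia.
have -> : (delta_lt H n)%:R / n%:R - c = ((delta_lt H n)%:R - c * n%:R) / n%:R.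
  by rewrite mulrBl mulfK // gt_eqF.
rewrite normrM normfV (gtr0_norm n0R) ler_pdivrMr //.
apply: (le_trans bnd); apply: (@le_trans _ _ (2 / N%:R * n%:R)).
  have -> : 2 / N%:R * n%:R = n%:R / N%:R + n%:R / N%:R :> R by ring.
  by rewrite lerD2l ler_pdivlMr // -natrM ler_nat; lia.
rewrite ler_pM2r // ler_pdivrMr // mulrC -ler_pdivrMr //.
exact: ltW.
Qed.

Lemma alpha_starE h (H : ograph h) : chi_lt H = 2%N ->
  alpha_star R H = (msize H)%:R / h%:R.
Proof.
move=> chi2; have h2 := h_ge2 chi2; have ah := a1_lt chi2; have qa := b1_le_a1 chi2.
have h0R : 0 < h%:R :> R by rewrite ltr0n; lia.
rewrite /alpha_star chi2 big_ltn // big_geq // !mul1r -/(a1 H).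
have -> : h%:R - (alpha_minus H 1)%:R + 1 = (h - b1 H)%:R :> R.
  rewrite natrB; last by lia.
  rewrite -[alpha_minus H 1]prednK ?alpha_minus1_gt0 // -/(b1 H) -natr1; lra.
have -> : Num.min ((a1 H)%:R / h%:R) ((h - b1 H)%:R / h%:R) = (msize H)%:R / h%:R :> R.
  have [le1|lt1] := leqP (a1 H) (h - b1 H).
    rewrite /msize (minn_idPl le1); apply/min_idPl.
    by rewrite ler_pM2r ?invr_gt0 // ler_nat.
  rewrite /msize (minn_idPr (ltnW lt1)); apply/min_idPr.
  by rewrite ler_pM2r ?invr_gt0 // ler_nat ltnW.
(* The default value 1 of the minimum is harmless because m <= h. *)
apply/min_idPl; rewrite ler_pdivrMr // mul1r ler_nat /msize; lia.
Qed.

Lemma asymp_alpha_star h (H : ograph h) : chi_lt H = 2%N ->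
  (forall N, (0 < N)%N -> exists n0, forall n, (n0 <= n)%N -> (h %| n)%N ->
     (delta_lt H n <= (h - msize H) * (n %/ h) + (n %/ N).+1)%N) ->
  delta_lt_asymp H (1 - alpha_star R H).
Proof.
move=> chi2 upper; rewrite alpha_starE //.
have h2 := h_ge2 chi2; have ah := a1_lt chi2.
apply: (@delta_lt_asymp_of_bounds _ _ _ 1) => N N0.
have [n0 Hn0] := upper N N0; exists n0 => n nbig n_gt0 hn.
have up := Hn0 n nbig hn.
have low : (n - msize H * (n %/ h) <= delta_lt H n + 1)%N.
  rewrite /msize; case: (leqP (a1 H) (h - b1 H)) => _;
    [exact: delta_lt_initial | exact: delta_lt_final].
have nE : (n %/ h * h)%N = n by rewrite divnK.
have h0R : h%:R != 0 :> R by rewrite pnatr_eq0; lia.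
have cE : (1 - (msize H)%:R / h%:R) * n%:R = ((h - msize H) * (n %/ h))%:R :> R.
  rewrite -{1}nE !natrM natrB; last by rewrite /msize; lia.
  by field.
rewrite cE; set t := (n %/ h)%N in nE up low *.
have mh : (msize H <= h)%N by rewrite /msize; lia.
have low' : ((h - msize H) * t <= delta_lt H n + 1)%N.
  by apply: leq_trans low; rewrite mulnBl [(h * t)%N]mulnC nE.
have rN : (n %/ N)%:R <= n%:R / N%:R :> R.
  by rewrite ler_pdivlMr ?ltr0n // -natrM ler_nat leq_trunc_div.
have upR : (delta_lt H n)%:R <= ((h - msize H) * t)%:R + (n %/ N)%:R + 1 :> R.
  by rewrite -natrD natr1 ler_nat; lia.
have lowR : ((h - msize H) * t)%:R <= (delta_lt H n)%:R + 1 :> R.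
  by rewrite natr1 ler_nat -addn1.
have r0 : 0 <= (n %/ N)%:R :> R by rewrite ler0n.
by rewrite ler_norml; apply/andP; split; lra.
Qed.

Lemma asymp_half h (H : ograph h) : chi_lt H = 2%N -> (h./2 < msize H)%N ->
  (forall n, (0 < n)%N -> (n./2 <= delta_lt H n + 2)%N) ->
  delta_lt_asymp H (1 / 2%:R : R).
Proof.
move=> chi2 hm low; apply: (@delta_lt_asymp_of_bounds _ _ _ 3) => N N0.
have [n0 Hn0] := delta_lt_upper_half chi2 N0 hm; exists n0 => n nbig n_gt0 hn.
have up := Hn0 n nbig hn; have {}low := low n n_gt0.
have nE : n%:R = (odd n)%:R + 2 * (n./2)%:R :> R.
  by rewrite -{1}(odd_double_half n) natrD -mul2n natrM.
have o0 : 0 <= (odd n)%:R :> R by rewrite ler0n.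
have o1 : (odd n)%:R <= 1 :> R by rewrite lern1; case: odd.
have rN : (n %/ N)%:R <= n%:R / N%:R :> R.
  by rewrite ler_pdivlMr ?ltr0n // -natrM ler_nat leq_trunc_div.
have upR : (delta_lt H n)%:R <= (n./2)%:R + (n %/ N)%:R + 2 :> R.
  by rewrite -!natrD ler_nat; lia.
have lowR : (n./2)%:R <= (delta_lt H n)%:R + 2 :> R.
  by rewrite -natrD ler_nat.
have r0 : 0 <= (n %/ N)%:R :> R by rewrite ler0n.
by rewrite ler_norml; apply/andP; split; lra.
Qed.

End Asymptotics.

Theorem theorem1p9 (R : realType) (h : nat) (H : ograph h)
    (hchi : chi_lt H = 2%N) :
  (~ propertyA H -> delta_lt_asymp H (1 - alpha_star R H)) /\
  (propertyA H -> propertyB H ->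
     delta_lt_asymp H (1 - 1 / (chi_lt H)%:R : R) /\
     delta_lt_asymp H (1 / 2%:R : R)) /\
  (propertyA H -> ~ propertyB H -> propertyC_first H \/ propertyC_last H ->
     delta_lt_asymp H (1 - 1 / (chi_lt H)%:R : R) /\
     delta_lt_asymp H (1 / 2%:R : R)) /\
  (propertyA H -> ~ propertyB H -> ~ propertyC_first H -> ~ propertyC_last H ->
     delta_lt_asymp H (1 - alpha_star R H)).
Proof.
have AP := propertyAP hchi.
have halfE : 1 - 1 / (chi_lt H)%:R = 1 / 2%:R :> R by rewrite hchi; lra.
rewrite halfE; split; last split; last split.
- move=> nA; apply: asymp_alpha_star => // N N0; apply: delta_lt_upper_small => //.
  by rewrite leqNgt; apply/negP => /AP.
- move=> /AP hm pB; suff asy : delta_lt_asymp H (1 / 2%:R : R) by split.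
  by apply: asymp_half => // n n0; exact: delta_lt_propertyB.
- move=> /AP hm _ pC; suff asy : delta_lt_asymp H (1 / 2%:R : R) by split.
  apply: asymp_half => // n n0.
  by case: pC => pC; [exact: delta_lt_propertyC_first | exact: delta_lt_propertyC_last].
- move=> /AP hm nB nC1 nC2; apply: asymp_alpha_star => // N N0.
  exact: delta_lt_upper_free.
Qed.
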